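(* Let $T\in(0,\infty)$, $n,d\in\mathbb{N}$, $x_0\in\mathbb{R}^n$, $A^\star\in\mathbb{R}^{n\times n}$, $B^\star\in\mathbb{R}^{n\times d}$, $Q\in\mathbb{R}^{n\times n}$ symmetric positive semidefinite, $R\in\mathbb{R}^{d\times d}$ symmetric positive definite, $\theta^\star=(A^\star,B^\star)^\top$, and let $\Theta$ be a bounded subset of $\mathbb{R}^{(n+d)\times n}$. For $\theta\in\Theta$ and $N\in\mathbb{N}$ let $\tau=T/N$, let $\psi^{\theta,\tau}(t,x)=K^{\theta,\tau}_tx$, let $X^{\psi^{\theta,\tau}}$ be the solution of $$\mathrm{d}X_t=(A^\star X_t+B^\star K^{\theta,\tau}_tX_t)\,\mathrm{d}t+\mathrm{d}W_t,\ t\in[0,T];\quad X_0=x_0,$$ and let $U^{\psi^{\theta,\tau}}_t=\psi^{\theta,\tau}(t,X^{\psi^{\theta,\tau}}_t)$. Let $X^{\theta^\star}$ be the solution of $\mathrm{d}X_t=(A^\star X_t+B^\star K^{\theta^\star}_tX_t)\,\mathrm{d}t+\mathrm{d}W_t$, $X_0=x_0$, and let $U^{\theta^\star}_t=K^{\theta^\star}_tX^{\theta^\star}_t$. Then there exists $C>0$ such that $$|J^{\theta^\star}(U^{\psi^{\theta,\tau}})-J^{\theta^\star}(U^{\theta^\star})|\le C(N^{-2}+|\theta-\theta^\star|^2),\qquad\forall\theta\in\Theta,\ N\in\mathbb{N}.$$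
   Context: $W$ is an $n$-dimensional standard Brownian motion on a complete probability space with augmented filtration $\mathbb{F}$; $|\cdot|$ is the Euclidean norm (Frobenius norm for matrices). Cost: for an $\mathbb{F}$-progressively measurable $\mathbb{R}^d$-valued $U$ with $\mathbb{E}\int_0^T|U_t|^2\,\mathrm{d}t<\infty$, $J^{\theta^\star}(U)=\mathbb{E}\big[\int_0^T(X_t^\top QX_t+U_t^\top RU_t)\,\mathrm{d}t\big]$, where $\mathrm{d}X_t=(A^\star X_t+B^\star U_t)\,\mathrm{d}t+\mathrm{d}W_t$, $X_0=x_0$. Continuous-time gain: for $\theta=(A,B)^\top\in\mathbb{R}^{(n+d)\times n}$ ($A\in\mathbb{R}^{n\times n}$, $B\in\mathbb{R}^{n\times d}$), $K^\theta_t=-R^{-1}B^\top P^\theta_t$, where $P^\theta$ is the unique solution of $\tfrac{\mathrm{d}}{\mathrm{d}t}P_t+A^\top P_t+P_tA-P_tBR^{-1}B^\top P_t+Q=0$ on $[0,T]$, $P_T=0$. Piecewise constant gain: with $\tau=T/N$, $t_i=i\tau$, set $P^{\theta,\tau}_T=0$ and, for $i=N,N-1,\dots,1$, $$P^{\theta,\tau}_{t_{i-1}}=\tau Q+(I+\tau A)^\top P^{\theta,\tau}_{t_i}(I+\tau A)-(I+\tau A)^\top P^{\theta,\tau}_{t_i}\tau B(R+\tau B^\top P^{\theta,\tau}_{t_i}B)^{-1}B^\top P^{\theta,\tau}_{t_i}(I+\tau A);$$ then $K^{\theta,\tau}_t=-(R+\tau B^\top P^{\theta,\tau}_{t_{i+1}}B)^{-1}B^\top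 P^{\theta,\tau}_{t_{i+1}}(I+\tau A)$ for $t\in[t_i,t_{i+1})$, $i=0,\dots,N-1$. (The value at the single time $t=T$ is irrelevant.) *)

(* Defs.v *)
From HB Require Import structures.
From mathcomp Require Import all_boot all_order all_algebra.
From mathcomp Require Import all_classical all_reals all_analysis.

Set Implicit Arguments.
Unset Strict Implicit.
Unset Printing Implicit Defensive.
Import Order.TTheory GRing.Theory Num.Theory.
Import numFieldNormedType.Exports.

Local Open Scope classical_set_scope.
Local Open Scope ring_scope.

(* The library norm on matrices is the sup norm. *)
Definition frobenius {R : realType} {m n : nat} (M : 'M[R]_(m, n)) : R :=
  Num.sqrt (\sum_i \sum_j M i j ^+ 2).

Definition qform {R : realType} {n : nat} (M : 'M[R]_n) (x : 'cV[R]_n) : R :=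
  (x^T *m M *m x) 0 0.

Definition sym_psd {R : realType} {n : nat} (M : 'M[R]_n) : Prop :=
  M^T = M /\ forall x : 'cV[R]_n, 0 <= qform M x.

Definition sym_pd {R : realType} {n : nat} (M : 'M[R]_n) : Prop :=
  M^T = M /\ forall x : 'cV[R]_n, x != 0 -> 0 < qform M x.

Definition frobenius_bounded {R : realType} {m n : nat}
    (Theta : set 'M[R]_(m, n)) : Prop :=
  exists M : R, forall theta, Theta theta -> frobenius theta <= M.

(* theta = (A, B)^T, of size (n + d) x n *)
Section parameter.
Context {R : realType} {n d : nat}.

Definition mk_theta (A : 'M[R]_n) (B : 'M[R]_(n, d)) : 'M[R]_(n + d, n) :=
  col_mx A^T B^T.

Definition theta_A (theta : 'M[R]_(n + d, n)) : 'M[R]_n := (usubmx theta)^T.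

Definition theta_B (theta : 'M[R]_(n + d, n)) : 'M[R]_(n, d) :=
  (dsubmx theta)^T.

End parameter.

Section brownian.
Context {R : realType} {disp : measure_display} {Omega : measurableType disp}.
Context {n : nat}.
Implicit Types (Pr : probability Omega R) (W : R -> Omega -> 'cV[R]_n).

Definition natural_gen W (t : R) : set (set Omega) :=
  [set E | exists s i (B : set R),
     [/\ 0 <= s <= t, measurable B & E = (fun w => W s w i 0) @^-1` B]].

Definition increment_gen W (s t : R) : set (set Omega) :=
  [set E | exists i (B : set R),
     measurable B /\ E = (fun w => W t w i 0 - W s w i 0) @^-1` B].

Definition indep_classes Pr (F G : set (set Omega)) : Prop :=
  forall E H, F E -> G H -> Pr (E `&` H) = (Pr E * Pr H)%E.

(* The third argument of normal_prob is the standard deviation.  The values on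
   boxes say that the increment over [s, t] has law N(0, (t - s) I_n). *)
Definition brownian_motion Pr W : Prop :=
  [/\ forall t i, 0 <= t -> measurable_fun setT (fun w => W t w i 0),
      {ae Pr, forall w, W 0 w = 0},
      {ae Pr, forall w, {within `[0, +oo[, continuous (W ^~ w)}},
      (forall s t (B : 'I_n -> set R), 0 <= s < t ->
         (forall i, measurable (B i)) ->
         Pr [set w | forall i, B i (W t w i 0 - W s w i 0)] =
         (\prod_(i < n) normal_prob 0 (Num.sqrt (t - s)) (B i))%E)
    & forall s t, 0 <= s < t ->
        indep_classes Pr <<s natural_gen W s >> <<s increment_gen W s t >> ].

(* The augmented filtration is F_t = <<s augmented_gen Pr W t >>. *)
Definition augmented_gen Pr W (t : R) : set (set Omega) :=
  natural_gen W t `|` Pr.-negligible.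

Definition progressive Pr W (T : R) {m : nat} (Y : R -> Omega -> 'cV[R]_m) :
    Prop :=
  forall t i, 0 <= t <= T ->
    measurable_fun (`[0, t] `*` setT)
      (fun p : measurableTypeR R * g_sigma_algebraType (augmented_gen Pr W t) =>
         Y p.1 p.2 i 0).

(* X_t = x0 + \int_0^t b(s, w, X_s) ds + W_t on [0, T].  Since the noise is
   additive with identity diffusion, no stochastic integral is involved. *)
Definition sde_solution Pr W (T : R) (x0 : 'cV[R]_n)
    (b : R -> Omega -> 'cV[R]_n -> 'cV[R]_n) (X : R -> Omega -> 'cV[R]_n) :
    Prop :=
  [/\ progressive Pr W T X,
      {ae Pr, forall w, forall i, lebesgue_measure.-integrable `[0, T]
         (fun s : measurableTypeR R => (b s w (X s w) i 0)%:E)}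
    & {ae Pr, forall w, forall t i, 0 <= t <= T ->
         X t w i 0 =
         x0 i 0 + Rintegral lebesgue_measure `[0, t]
                    (fun s : measurableTypeR R => b s w (X s w) i 0)
         + W t w i 0} ].

End brownian.

Section lqr.
Context {R : realType} {disp : measure_display} {Omega : measurableType disp}.
Context {n d : nat}.
Variables (Pr : probability Omega R) (W : R -> Omega -> 'cV[R]_n) (T : R).
Variables (x0 : 'cV[R]_n) (A : 'M[R]_n) (B : 'M[R]_(n, d)).
Variables (Q : 'M[R]_n) (S : 'M[R]_d).

Definition admissible (U : R -> Omega -> 'cV[R]_d) : Prop :=
  progressive Pr W T U /\
  (\int[Pr]_w \int[lebesgue_measure]_(t in `[0%R, T])
     (frobenius (U t w) ^+ 2)%R%:E < +oo)%E.

(* A solution of the controlled equation dX = (A X + B U) dt + dW, X_0 = x0;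
   solutions are indistinguishable on [0, T], so that the choice made by xget
   is immaterial. *)
Definition controlled_state (U : R -> Omega -> 'cV[R]_d) :
    R -> Omega -> 'cV[R]_n :=
  xget (fun _ _ => 0)
    [set X | sde_solution Pr W T x0 (fun t w x => A *m x + B *m U t w) X].

(* J is only meaningful for admissible controls; the value +oo elsewhere makes
   any finite bound on a difference of costs entail admissibility, because
   |+oo - x| = |x - (+oo)| = +oo for every x in \bar R. *)
Definition lqr_cost (U : R -> Omega -> 'cV[R]_d) : \bar R :=
  if `[< admissible U >] then
    (\int[Pr]_w \int[lebesgue_measure]_(t in `[0%R, T])
       (qform Q (controlled_state U t w) + qform S (U t w))%R%:E)%E
  else +oo%E.

Definition feedback (K : R -> 'M[R]_(d, n)) (X : R -> Omega -> 'cV[R]_n) :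
    R -> Omega -> 'cV[R]_d :=
  fun t w => K t *m X t w.

Definition closed_loop_solution (K : R -> 'M[R]_(d, n)) :
    (R -> Omega -> 'cV[R]_n) -> Prop :=
  sde_solution Pr W T x0 (fun t _ x => A *m x + B *m K t *m x).

End lqr.

Section gains.
Context {R : realType} {n d : nat}.
Variables (T : R) (A : 'M[R]_n) (B : 'M[R]_(n, d)).
Variables (Q : 'M[R]_n) (S : 'M[R]_d).

Definition riccati_solution (P : R -> 'M[R]_n) : Prop :=
  [/\ {within `[0, T], continuous P},
      P T = 0
    & forall t, 0 < t < T -> exists2 dP : 'M[R]_n, is_derive t (1 : R) P dP &
        dP + A^T *m P t + P t *m A - P t *m B *m invmx S *m B^T *m P t + Q = 0].

Definition riccati_gain (P : R -> 'M[R]_n) (t : R) : 'M[R]_(d, n) :=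
  - (invmx S *m B^T *m P t).

Variable N : nat.
Let tau : R := T / N%:R.
Let Phi : 'M[R]_n := 1%:M + tau *: A.

Definition discrete_riccati_step (P : 'M[R]_n) : 'M[R]_n :=
  tau *: Q + Phi^T *m P *m Phi
  - Phi^T *m P *m (tau *: B) *m invmx (S + tau *: (B^T *m P *m B))
      *m B^T *m P *m Phi.

(* The value at t_i = i tau, obtained from the terminal value 0 at t_N = T *)
Definition discrete_riccati (i : nat) : 'M[R]_n :=
  iter (N - i) discrete_riccati_step 0.

Definition discrete_gain (i : nat) : 'M[R]_(d, n) :=
  let P := discrete_riccati i.+1 in
  - (invmx (S + tau *: (B^T *m P *m B)) *m B^T *m P *m Phi).

(* For t >= 0, Num.truncn (t / tau) is the index i with t_i <= t < t_{i+1}. *)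
Definition piecewise_gain (t : R) : 'M[R]_(d, n) :=
  discrete_gain (Num.truncn (t / tau)).

End gains.

(* Main.v *)
Require Import Defs.
From HB Require Import structures.
From mathcomp Require Import all_boot all_order all_algebra.
From mathcomp Require Import all_classical all_reals all_analysis.
From mathcomp Require Import measurable_realfun ring lra.
Import Order.TTheory GRing.Theory Num.Theory.
Import numFieldNormedType.Exports.

Local Open Scope classical_set_scope.
Local Open Scope ring_scope.

Set Implicit Arguments.
Unset Strict Implicit.
Unset Printing Implicit Defensive.

(** The cost of a linear feedback [K] is compared with the cost of the optimal
    gain [Kstar t = riccati_gain Bstar S Pstar t] by completing a square.  Write
    [P] for the Riccati solution, [M = A + B K] for the closed-loop drift and
    [W] for the noise.  The noise is additive, so [X - W] has Lipschitz paths,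
    and the derivative of [qform (P t) (X t - W t)] is computed path by path.
    With the Riccati equation it gives
    ([cost_identity]; [K'] and [P'] are the transpose of [K] and the derivative
    of [P])
<<
      \int qform (Q + K' S K) X = qform (P 0) x0
         + \int qform ((K - Kstar)' S (K - Kstar)) X
         + \int qform P' W - 2 * \int W^T (P' + P M) X.
>>
    The last two terms have an expectation that does not depend on [K].  Indeed
    let [D t = E (X t) (W t)^T] and [V t = E (W t) (W t)^T].  The increments of
    the noise are uncorrelated with the past of the noise, hence with that of
    the state, because both families of correlations solve the same linear
    equation ([correlation_ahead]).  So [D - V] has derivative [M D]
    ([correlation_primitive]), and [\tr (P (D - V))], which vanishes at both ends
    of [0, T], has derivative [\tr ((P' + P M) D) - \tr (P' V)]
    ([cross_moment]).  Therefore the difference of the two costs is the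
    expectation of [\int qform ((K - Kstar)' S (K - Kstar)) X]
    ([expected_cost_identity], [feedback_cost]): it is quadratic in the error of
    the gain, and this is why the bound has squares in it.

    It remains to bound the two factors uniformly in the parameter and in the
    number of time steps.  The second moments of the state are controlled by
    those of the noise through Gronwall's inequality on paths
    ([path_sqr_bound], [state_moment_bound]).  The gain error is of first order
    ([piecewise_gain_error]): the backward recursion is a consistent one-step
    scheme for the Riccati equation; it is stable, because each step is the cost
    of its own gain ([riccati_step_completed_square]), so that the value matrices
    stay positive, their traces stay bounded, and the inverse of the regularised
    weight is below that of [S].  Run at the true parameter, the same scheme shows
    that [P] is symmetric ([riccati_solution_sym]), as the completion of the
    square requires. *)

(** * Integrals over time intervals *)

Section real_analysis.
Context {R : realType}.
Notation mu := (@lebesgue_measure R).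
Implicit Types (f g F G u : R -> R) (a b c s t T L : R).

Lemma bounded_integrable_itv f a b c : measurable_fun `[a, b] f ->
  (forall x, a <= x <= b -> `|f x| <= c) ->
  mu.-integrable `[a, b] (EFin \o f).
Proof.
move=> mf fc; apply: measurable_bounded_integrable => //.
  by rewrite /= lebesgue_measure_itv/=; case: ifPn => // _; rewrite -EFinD ltry.
exists c; split; first exact: num_real.
move=> M cM x /=; rewrite in_itv/= => xab.
by apply: le_trans (fc _ xab) (ltW cM).
Qed.

Lemma Rintegral_itv_cst a b c : a <= b ->
  \int[mu]_(_ in `[a, b]) c = c * (b - a).
Proof.
move=> ab; rewrite Rintegral_cst//= lebesgue_measure_itv/=.
rewrite lte_fin; case: ltP => //= ba.
by rewrite (le_anti (introT andP (conj ab ba))) subrr.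
Qed.

Lemma le_normr_Rintegral_itv f a b c : a <= b -> measurable_fun `[a, b] f ->
  (forall x, a <= x <= b -> `|f x| <= c) ->
  `|\int[mu]_(x in `[a, b]) f x| <= c * (b - a).
Proof.
move=> ab mf fc; have iF := bounded_integrable_itv mf fc.
apply: le_trans (le_normr_Rintegral _ iF) _ => //.
rewrite -Rintegral_itv_cst//; apply: le_Rintegral => //.
- exact: integrable_norm.
- exact: (@bounded_integrable_itv (cst c) _ _ `|c|).
Qed.

Lemma Rintegral_itv_split f a s t : a <= s <= t ->
  mu.-integrable `[a, t] (EFin \o f) ->
  \int[mu]_(x in `[a, t]) f x =
  \int[mu]_(x in `[a, s]) f x + \int[mu]_(x in `[s, t]) f x.
Proof.
move=> /andP[sa st] iF.
have := @Rintegral_itvB R f (BLeft a) (BRight t) s iF.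
rewrite !bnd_simp sa st => /(_ isT isT)/(canRL (subrK _)) ->.
rewrite Rintegral_itv_obnd_cbnd 1?addrC//.
by apply: integrableS iF => //; exact: subset_itvr.
Qed.

Lemma integrable_subitv f a b s t : a <= s -> t <= b ->
  mu.-integrable `[a, b] (EFin \o f) -> mu.-integrable `[s, t] (EFin \o f).
Proof.
move=> sa st; apply: integrableS => //.
by apply: subset_itv; rewrite bnd_simp.
Qed.

Lemma Rintegral_derivative F f a b : a <= b ->
  {within `[a, b], continuous F} -> {within `[a, b], continuous f} ->
  (forall x, a < x < b -> is_derive x 1 F (f x)) ->
  \int[mu]_(x in `[a, b]) f x = F b - F a.
Proof.
rewrite le_eqVlt => /predU1P[<- _ _ _|ab cF cf dF].
  by rewrite set_itv1 Rintegral_set1 subrr.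
rewrite /Rintegral (@continuous_FTC2 _ f F)//.
- have [_ ? ?] := (continuous_within_itvP _ ab).1 cF; split => // x.
  by rewrite in_itv/= => /dF[].
- by move=> x; rewrite in_itv/= => /dF dFx; rewrite derive1E derive_val.
Qed.

(** Gronwall's inequality.  With [lam := 2 * L], the supremum [m] of
    [exp (- lam t) u t] satisfies [m <= a + m / 2], which gives the constant
    [2 * a].  The integrand is some [g <= L * u] instead of [L * u] itself, so
    that the norm of a drift can be taken for [g]. *)
Lemma gronwall T L a u g : 0 <= T -> 0 < L -> 0 <= a ->
  (exists b, forall t, 0 <= t <= T -> u t <= b) ->
  (forall t, 0 <= t <= T -> 0 <= u t) ->
  mu.-integrable `[0, T] (EFin \o g) ->
  (forall t, 0 <= t <= T -> g t <= L * u t) ->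
  (forall t, 0 <= t <= T -> u t <= a + \int[mu]_(s in `[0, t]) g s) ->
  forall t, 0 <= t <= T -> u t <= 2 * a * expR (2 * L * T).
Proof.
move=> T0 L0 a0 [b ub] u0 ig gu ug.
pose lam := 2 * L; have lam0 : 0 < lam by rewrite mulr_gt0.
pose S := [set expR (- lam * t) * u t | t in `[0, T]].
have S0 : S !=set0.
  by exists (expR (- lam * 0) * u 0), 0 => //=; rewrite in_itv/= lexx.
have Sub : has_sup S.
  split=> //; exists `|b| => _ [t /= + <-]; rewrite in_itv/= => tT.
  rewrite -[leRHS]mul1r; apply: ler_pM => //.
  - exact: u0.
  - rewrite -expR0 ler_expR mulNr oppr_le0 mulr_ge0 ?(ltW lam0)//.
    by case/andP: tT.
  - exact: le_trans (ub _ tT) (ler_norm _).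
pose m := sup S.
have um t : 0 <= t <= T -> u t <= m * expR (lam * t).
  move=> tT; have : expR (- lam * t) * u t <= m.
    by apply: sup_upper_bound => //; exists t => //=; rewrite in_itv.
  by rewrite mulNr expRN ler_pdivrMl ?expR_gt0// mulrC.
have m0 : 0 <= m.
  have T00 : 0 <= (0 : R) <= T by rewrite lexx.
  by have := um _ T00; rewrite mulr0 expR0 mulr1; apply: le_trans; exact: u0.
have dE x : is_derive x (1 : R) (fun t => m / 2 * expR (lam * t))
    (L * m * expR (lam * x)).
  apply: is_derive_eq; rewrite /GRing.scale/= /lam; lra.
have cE x : is_derive x (1 : R) (fun t => L * m * expR (lam * t))
    (lam * L * m * expR (lam * x)).
  apply: is_derive_eq; rewrite /GRing.scale/= /lam; lra.
have cont f g' : (forall x, is_derive x (1 : R) f (g' x)) -> continuous f.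
  move=> df x; apply: differentiable_continuous; apply/derivable1_diffP.
  by case: (df x).
have m2a : m <= 2 * a.
  suff : m <= a + m / 2 by lra.
  apply: ge_sup => // _ [t /= + <-]; rewrite in_itv/= => tT.
  have [t0 tT'] := andP tT.
  rewrite mulNr expRN ler_pdivrMl ?expR_gt0//.
  apply: le_trans (ug _ tT) _.
  have : \int[mu]_(s in `[0, t]) g s <=
      \int[mu]_(s in `[0, t]) (L * m * expR (lam * s)).
    apply: le_Rintegral => //.
    - exact: integrable_subitv ig.
    - apply: (@continuous_compact_integrable R (fun s => L * m * expR (lam * s))).
        exact: segment_compact.
      by apply: continuous_subspaceT; apply: cont cE.
    - move=> s /=; rewrite in_itv/= => /andP[s0 st].
      have sT : 0 <= s <= T by rewrite s0 (le_trans st).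
      by rewrite -mulrA; apply: le_trans (gu _ sT) _; rewrite ler_pM2l// um.
  rewrite (@Rintegral_derivative (fun s => m / 2 * expR (lam * s)))//.
  - have e1 : 1 <= expR (lam * t) by rewrite -expR0 ler_expR mulr_ge0// ltW.
    by rewrite mulr0 expR0 mulr1 => ?; nra.
  - by apply: continuous_subspaceT; apply: cont dE.
  - by apply: continuous_subspaceT; apply: cont cE.
move=> t tT; apply: le_trans (um _ tT) _.
apply: ler_pM => //.
by rewrite ler_expR ler_pM2l//; case/andP: tT.
Qed.

(** Over [N] equal subintervals the increments add up to [O(1 / N)].  In this
    form, the argument that a vanishing derivative forces a constant function
    applies to indefinite integrals, which need not be differentiable. *)
Lemma eq0_quadratic_increments T c F : F 0 = 0 ->
  (forall s t, 0 <= s -> s <= t -> t <= T -> `|F t - F s| <= c * (t - s) ^+ 2) ->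
  forall t, 0 <= t <= T -> F t = 0.
Proof.
move=> F0 Fc t /andP[t0 tT].
have step N : `|F t| <= c * t ^+ 2 / N.+1%:R.
  have N0 : 0 < N.+1%:R :> R by [].
  pose x (k : nat) := t * (k%:R / N.+1%:R).
  have xS k : (k <= N.+1)%N -> x k <= t.
    by move=> kN; rewrite ler_piMr// ler_pdivrMr// mul1r ler_nat.
  have x0 k : 0 <= x k by rewrite mulr_ge0// divr_ge0.
  have bound k : (k <= N.+1)%N ->
      `|F (x k)| <= k%:R * (c * t ^+ 2 / N.+1%:R ^+ 2).
    elim: k => [_|k IH kN]; first by rewrite /x !mul0r mulr0 F0 normr0.
    rewrite -(subrK (F (x k)) (F (x k.+1))) -natr1 mulrDl mul1r addrC.
    apply: le_trans (ler_normD _ _) _; apply: lerD; first exact/IH/ltnW.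
    have -> : c * t ^+ 2 / N.+1%:R ^+ 2 = c * (x k.+1 - x k) ^+ 2.
      rewrite /x -mulrBr -mulrBl -(@natr1 _ k) addrAC subrr add0r mul1r.
      by rewrite -mulrA -exprVn -exprMn.
    apply: Fc; [exact: x0| |exact: le_trans (xS _ kN) tT].
    by rewrite /x ler_wpM2l// ler_pM2r ?invr_gt0// ler_nat.
  have := bound _ (leqnn N.+1).
  have -> : x N.+1 = t by rewrite /x divff ?mulr1// pnatr_eq0.
  move/le_trans; apply; rewrite le_eqVlt; apply/orP; left; apply/eqP.
  by move: N0 => /lt0r_neq0; set M := N.+1%:R => M0; field.
apply/eqP; rewrite -normr_le0 leNgt; apply/negP => Ft0.
have c0 : 0 < c * t ^+ 2.
  by rewrite (lt_le_trans Ft0)//; have := step 0; rewrite divr1.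
have [k] := ltr_add_invr (divr_gt0 Ft0 c0).
rewrite add0r ltr_pdivlMr// => kc; have := step k.
by rewrite leNgt mulrC kc.
Qed.

(** Feedback gains are only piecewise continuous in time, so that the solutions
    of the closed-loop equation, once freed from the noise, are not differentiable
    at every time.  Indefinite integrals take the place of derivatives. *)
Definition primitive T f F :=
  [/\ measurable_fun `[0, T] f,
      exists c, forall t, 0 <= t <= T -> `|f t| <= c
    & forall t, 0 <= t <= T -> F t = F 0 + \int[mu]_(s in `[0, t]) f s].

Lemma primitive_integrable T f F : primitive T f F ->
  mu.-integrable `[0, T] (EFin \o f).
Proof. by move=> [mf [c fc] _]; exact: bounded_integrable_itv fc. Qed.

Lemma primitive_increment T f F s t : primitive T f F ->
  0 <= s -> s <= t -> t <= T -> F t - F s = \int[mu]_(x in `[s, t]) f x.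
Proof.
move=> pF s0 st tT; have [_ _ FE] := pF.
rewrite FE; last by rewrite (le_trans s0).
rewrite (FE s); last by rewrite s0 (le_trans st).
rewrite (@Rintegral_itv_split f 0 s t) ?s0//; first lra.
by apply: integrable_subitv (primitive_integrable pF).
Qed.

Lemma primitive_lipschitz T f F : primitive T f F ->
  exists2 c, 0 <= c & forall s t, 0 <= s -> s <= t -> t <= T ->
    `|F t - F s| <= c * (t - s).
Proof.
move=> pF; have [mf [c fc] _] := pF; exists `|c| => // s t s0 st tT.
rewrite (primitive_increment pF)//; apply: le_normr_Rintegral_itv => //.
  by apply: measurable_funS mf => //; apply: subset_itv; rewrite bnd_simp.
move=> x /andP[sx xt]; apply: le_trans (fc _ _) (ler_norm _).
by rewrite (le_trans s0 sx) (le_trans xt tT).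
Qed.

Lemma primitive_bounded T f F : primitive T f F ->
  exists2 c, 0 <= c & forall t, 0 <= t <= T -> `|F t| <= c.
Proof.
move=> pF; have [c c0 Fc] := primitive_lipschitz pF.
exists (`|F 0| + c * `|T|); first by rewrite addr_ge0// mulr_ge0.
move=> t /andP[t0 tT]; rewrite -(subrK (F 0) (F t)) addrC.
apply: le_trans (ler_normD _ _) _; rewrite lerD2l.
apply: le_trans (Fc _ _ _ t0 tT) _ => //.
by rewrite subr0 ler_wpM2l//; exact: le_trans tT (ler_norm _).
Qed.

Lemma primitive_continuous T f F : primitive T f F ->
  {within `[0, T], continuous F}.
Proof.
move=> pF; have [c c0 Fc] := primitive_lipschitz pF.
apply/subspace_continuousP => x /=; rewrite in_itv/= => /andP[x0 xT].
apply/cvgrPdist_le => e e0; rewrite near_withinE; near=> y.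
rewrite /= in_itv/= => /andP[y0 yT].
have cy : (c + 1) * `|x - y| <= e.
  rewrite mulrC -ler_pdivlMr ?ltr_wpDl//.
  by near: y; apply: cvgr_dist_le; [exact: cvg_id|rewrite divr_gt0 ?ltr_wpDl].
apply: le_trans cy.
have [xy|yx] := leP x y.
  rewrite distrC; apply: le_trans (Fc _ _ x0 xy yT) _.
  by rewrite -[leRHS]mulr1 distrC ger0_norm ?subr_ge0// mulr1 ler_wpM2r ?subr_ge0// lerDl.
apply: le_trans (Fc _ _ y0 (ltW yx) xT) _.
by rewrite ger0_norm ?subr_ge0 ?(ltW yx)// ler_wpM2r ?lerDl// subr_ge0 ltW.
Unshelve. all: by end_near. Qed.

Lemma primitive_measurable T f F : primitive T f F ->
  measurable_fun `[0, T] F.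
Proof.
move=> pF; apply: subspace_continuous_measurable_fun => //.
exact: primitive_continuous pF.
Qed.

Lemma primitive_cst T c : primitive T (fun=> 0) (fun=> c).
Proof.
split; [exact: measurable_cst|by exists 0 => *; rewrite normr0|].
by move=> t /andP[t0 _]; rewrite Rintegral_itv_cst// mul0r addr0.
Qed.

Lemma primitiveD T f F g G : primitive T f F -> primitive T g G ->
  primitive T (f \+ g) (F \+ G).
Proof.
move=> pF pG; have [mf [c fc] FE] := pF; have [mg [c' gc] GE] := pG; split.
- exact: measurable_funD.
- exists (c + c') => t tT; apply: le_trans (ler_normD _ _) _.
  by rewrite lerD ?fc ?gc.
- move=> t tT /=; rewrite FE// GE// RintegralD//; first lra.
  + apply: integrable_subitv (primitive_integrable pF) => //; by case/andP: tT.
  + apply: integrable_subitv (primitive_integrable pG) => //; by case/andP: tT.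
Qed.

Lemma primitive_sum T (I : Type) (r : seq I) (f F : I -> R -> R) :
  (forall i, primitive T (f i) (F i)) ->
  primitive T (fun t => \sum_(i <- r) f i t) (fun t => \sum_(i <- r) F i t).
Proof.
move=> pF; elim: r => [|i r IH].
  by under eq_fun do rewrite big_nil; under [X in primitive _ _ X]eq_fun do
    rewrite big_nil; exact: primitive_cst.
under eq_fun do rewrite big_cons; under [X in primitive _ _ X]eq_fun do
  rewrite big_cons.
exact: primitiveD.
Qed.

(** Integration by parts.  Over a short interval the increment of [F * G]
    differs from the integral of [f * G + F * g] by a quadratic error. *)
Lemma primitiveM T f F g G : primitive T f F -> primitive T g G ->
  primitive T (fun t => f t * G t + F t * g t) (fun t => F t * G t).
Proof.
move=> pF pG; have [mf [a fa] FE] := pF; have [mg [b gb] GE] := pG.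
have [c c0 Fc] := primitive_bounded pF; have [d d0 Gd] := primitive_bounded pG.
have [l l0 Fl] := primitive_lipschitz pF.
have [m m0 Gm] := primitive_lipschitz pG.
have mF := primitive_measurable pF; have mG := primitive_measurable pG.
pose h t := f t * G t + F t * g t.
have mh : measurable_fun `[0, T] h.
  by apply: measurable_funD; exact: measurable_funM.
have hb t : 0 <= t <= T -> `|h t| <= a * d + c * b.
  move=> tT; apply: le_trans (ler_normD _ _) _; rewrite !normrM.
  by apply: lerD; apply: ler_pM => //; [exact: fa|exact: Gd|exact: Fc|exact: gb].
have ih := bounded_integrable_itv mh hb.
split => //; first by exists (a * d + c * b).
move=> t tT; apply/eqP; rewrite -subr_eq0; apply/eqP.
pose E t := F t * G t - (F 0 * G 0 + \int[mu]_(s in `[0, t]) h s).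
rewrite -/(E t); apply: (@eq0_quadratic_increments T (a * m + l * b)) => //.
  by rewrite /E set_itv1 Rintegral_set1 addr0 subrr.
move=> {tT}s {}t s0 st tT.
have sub : `[s, t] `<=` `[0, T] by apply: subset_itv; rewrite bnd_simp.
have mI : measurable (`[s, t] : set (measurableTypeR R)) by [].
have ifst := integrable_subitv s0 tT (primitive_integrable pF).
have igst := integrable_subitv s0 tT (primitive_integrable pG).
have ihst := integrable_subitv s0 tT ih.
have i1 : mu.-integrable `[s, t] (EFin \o (fun r => f r * G t)).
  by have := integrableZr mI (G t) ifst.
have i2 : mu.-integrable `[s, t] (EFin \o (fun r => F s * g r)).
  by have := integrableZl mI (F s) igst.
have -> : E t - E s = \int[mu]_(r in `[s, t])
    (f r * (G t - G r) + (F s - F r) * g r).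
  rewrite /E (@Rintegral_itv_split h 0 s t) ?s0//; last first.
    exact: integrable_subitv ih.
  transitivity ((F t - F s) * G t + F s * (G t - G s) -
      \int[mu]_(r in `[s, t]) h r); first ring.
  rewrite (primitive_increment pF)// (primitive_increment pG)//.
  rewrite -RintegralZr// -RintegralZl// -RintegralD// -RintegralB//; last first.
    by have := integrableD mI i1 i2.
  by apply: eq_Rintegral => r _; rewrite /h; ring.
rewrite expr2 mulrA; apply: le_normr_Rintegral_itv => //.
  have mS (k : R -> R) : measurable_fun `[0, T] k -> measurable_fun `[s, t] k.
    exact: measurable_funS.
  apply: measurable_funD; apply: measurable_funM;
    [exact: mS mf| |  |exact: mS mg].
    by apply: measurable_funB; [exact: measurable_cst|exact: mS mG].
  by apply: measurable_funB; [exact: measurable_cst|exact: mS mF].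
move=> r /andP[sr rt]; have rT : 0 <= r <= T by rewrite (le_trans s0)//=; lra.
have r0 : 0 <= r by case/andP: rT.
apply: le_trans (ler_normD _ _) _; rewrite !normrM mulrDl; apply: lerD.
  rewrite -mulrA; apply: ler_pM => //; first exact: fa.
  apply: le_trans (Gm _ _ r0 rt tT) _; rewrite ler_wpM2l//; lra.
rewrite mulrAC; apply: ler_pM => //; last exact: gb.
rewrite distrC; apply: le_trans (Fl _ _ s0 sr _) _; first lra.
rewrite ler_wpM2l//; lra.
Qed.

End real_analysis.

(** * Square integrable variables and the normal law *)

Section expectation.
Context {R : realType} {d : measure_display} {Omega : measurableType d}.
Variable Pr : probability Omega R.
Implicit Types xi eta : Omega -> R.

Definition square_integrable xi :=
  measurable_fun setT xi /\ Pr.-integrable setT (fun w => (xi w ^+ 2)%:E).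

(** By [2 * `|xi * eta| <= xi ^+ 2 + eta ^+ 2]. *)
Lemma square_integrable_mul xi eta :
  square_integrable xi -> square_integrable eta ->
  Pr.-integrable setT (fun w => (xi w * eta w)%:E).
Proof.
move=> [mx ix] [me ie].
apply: (@le_integrable _ _ _ _ _ _ _
  (fun w => (xi w ^+ 2)%:E + (eta w ^+ 2)%:E)%E) => //.
- by apply/measurable_EFinP; exact: measurable_funM.
- move=> w _ /=; rewrite lee_fin [leRHS]ger0_norm ?addr_ge0 ?sqr_ge0//.
  rewrite -(real_normK (num_real (xi w))).
  rewrite -(real_normK (num_real (eta w))) normrM.
  have := normr_ge0 (xi w); have := normr_ge0 (eta w); nra.
- exact: integrableD.
Qed.

Lemma square_integrable_cst c : square_integrable (fun=> c).
Proof.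
split; first exact: measurable_cst.
exact: (finite_measure_integrable_cst Pr (c ^+ 2)).
Qed.

Lemma square_integrable_integrable xi :
  square_integrable xi -> Pr.-integrable setT (fun w => (xi w)%:E).
Proof.
move=> /square_integrable_mul/(_ (square_integrable_cst 1)).
by under eq_fun do rewrite mulr1.
Qed.

Lemma square_integrableD xi eta :
  square_integrable xi -> square_integrable eta ->
  square_integrable (fun w => xi w + eta w).
Proof.
move=> xi2 eta2; have im := square_integrable_mul xi2 eta2.
have [[mx ix] [me ie]] := (xi2, eta2); split; first exact: measurable_funD.
have -> : (fun w => ((xi w + eta w) ^+ 2)%:E) =
    (fun w => (xi w ^+ 2)%:E + (2%:E * (xi w * eta w)%:E + (eta w ^+ 2)%:E))%E.
  by apply/funext => w; rewrite -EFinM -!EFinD; congr EFin; ring.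
by apply: integrableD => //; apply: integrableD => //; exact: integrableZl.
Qed.

(** The joint law is the product of the laws, and Fubini's theorem splits the
    integral of the product. *)
Lemma Rintegral_indep_mul xi eta :
  measurable_fun setT xi -> measurable_fun setT eta ->
  (forall A B, measurable A -> measurable B ->
    Pr (xi @^-1` A `&` eta @^-1` B) = (Pr (xi @^-1` A) * Pr (eta @^-1` B))%E) ->
  Pr.-integrable setT (EFin \o xi) -> Pr.-integrable setT (EFin \o eta) ->
  Pr.-integrable setT (fun w => (xi w * eta w)%:E) ->
  \int[Pr]_w (xi w * eta w) = (\int[Pr]_w xi w) * (\int[Pr]_w eta w).
Proof.
move=> mxi meta indep ixi ieta im.
pose X : {mfun Omega >-> R} :=
  HB.pack xi (isMeasurableFun.Build _ _ _ _ xi mxi).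
pose Y : {mfun Omega >-> R} :=
  HB.pack eta (isMeasurableFun.Build _ _ _ _ eta meta).
have mZ : measurable_fun setT (fun w => (xi w, eta w)).
  exact: measurable_fun_pair.
pose Z : {mfun Omega >-> (R * R)%type} :=
  HB.pack (fun w => (xi w, eta w)) (isMeasurableFun.Build _ _ _ _ _ mZ).
pose m1 := distribution Pr X; pose m2 := distribution Pr Y.
pose m := distribution Pr Z.
pose f (p : R * R) := (p.1 * p.2)%:E.
have mf : measurable_fun setT f.
  by apply/measurable_EFinP; apply: measurable_funM;
    [exact: measurable_fst|exact: measurable_snd].
have mE A : measurable A -> (m1 \x m2)%E A = m A.
  apply: product_measure_unique => {}A B mA mB.
  by rewrite -indep.
have intm : m.-integrable setT f.
  exact: (integrable_pushforward mZ mf).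
have intp : (m1 \x m2)%E.-integrable setT f.
  move/integrableP : intm => [_ fin]; apply/integrableP; split => //.
  by rewrite (eq_measure_integral m)// => A mA _; exact: mE.
have E1 : (\int[Pr]_w (xi w * eta w)%:E = \int[m]_p f p)%E.
  by rewrite (integral_pushforward mZ mf).
rewrite /Rintegral E1.
rewrite (eq_measure_integral (m1 \x m2)%E); last first.
  by move=> A mA _; exact/esym/mE.
rewrite -integral12_prod_meas1// /fubini_F /=.
have im1 : m1.-integrable setT (EFin \o id).
  by apply: (integrable_pushforward mxi) => //; exact/measurable_EFinP.
have im2 : m2.-integrable setT (EFin \o id).
  by apply: (integrable_pushforward meta) => //; exact/measurable_EFinP.
have Ex : (\int[Pr]_w (xi w)%:E = \int[m1]_x x%:E)%E.
  rewrite (@integral_distribution _ _ _ _ _ Pr X (EFin \o id))//.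
  exact/measurable_EFinP.
have Ey : (\int[Pr]_w (eta w)%:E = \int[m2]_x x%:E)%E.
  rewrite (@integral_distribution _ _ _ _ _ Pr Y (EFin \o id))//.
  exact/measurable_EFinP.
rewrite Ex Ey -fineM; last 2 first.
- exact: integrable_fin_num im1.
- exact: integrable_fin_num im2.
congr fine; rewrite /f /=.
have fy : (\int[m2]_y y%:E)%E \is a fin_num by exact: integrable_fin_num im2.
rewrite -(fineK fy) -integralZr//; apply: eq_integral => x _.
rewrite fineK// -integralZl//.
Qed.

End expectation.

Section normal_moments.
Context {R : realType}.
Notation mu := (@lebesgue_measure R).
Variable s : R.
Hypothesis s0 : s != 0.

Lemma ge0_integral_normal (f : R -> R) : (forall x, 0 <= f x) ->
  measurable_fun setT f ->
  (\int[normal_prob 0 s]_x (f x)%:E = \int[mu]_x (f x * normal_pdf 0 s x)%:E)%E.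
Proof.
move=> f0 mf.
have dom := normal_prob_dominates 0 s.
rewrite -(Radon_Nikodym_SigmaFinite.change_of_variables dom)//; last first.
  exact/measurable_EFinP.
under [RHS]eq_integral do rewrite EFinM.
have irn := Radon_Nikodym_SigmaFinite.f_integrable dom.
apply: ae_eq_integral => //.
- apply: emeasurable_funM; first exact/measurable_EFinP.
  exact: (measurable_int mu).
- apply: emeasurable_funM; first exact/measurable_EFinP.
  by apply/measurable_EFinP; exact: measurable_normal_pdf.
- apply: ae_eqe_mul2l; apply: integral_ae_eq => //.
  + by apply/measurable_EFinP; exact: measurable_normal_pdf.
  + by move=> E _ mE; rewrite -Radon_Nikodym_SigmaFinite.f_integral.
Qed.

(** [x^2 * pdf_s x] is dominated by a multiple of the density with standard
    deviation [sqrt 2 * s], by the bound [y <= exp y] at [y = x^2 / (4 s^2)]. *)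
Lemma integrable_normal_sqr :
  (normal_prob 0 s).-integrable setT (fun x : R => (x ^+ 2)%:E).
Proof.
apply/integrableP; split; first exact/measurable_EFinP/measurable_funX.
under eq_integral do rewrite gee0_abs ?lee_fin ?sqr_ge0//.
rewrite ge0_integral_normal//; last by move=> x; exact: sqr_ge0.
pose r := Num.sqrt 2 * s; have r0 : r != 0 by rewrite mulf_neq0// sqrtr_eq0 -ltNge.
have r2 : r ^+ 2 = 2 * s ^+ 2 by rewrite /r exprMn sqr_sqrtr.
pose c := 4 * s ^+ 2 * normal_peak s / normal_peak r.
have c0 : 0 <= c.
  by rewrite mulr_ge0 ?invr_ge0 ?normal_peak_ge0// mulr_ge0 ?normal_peak_ge0//
    mulr_ge0 ?sqr_ge0.
apply: (@le_lt_trans _ _ (\int[mu]_x (c%:E * (normal_pdf 0 r x)%:E))%E).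
  apply: ge0_le_integral => //.
  - by move=> x _; rewrite lee_fin mulr_ge0 ?sqr_ge0// normal_pdf_ge0.
  - apply/measurable_EFinP/measurable_funM; first exact: measurable_funX.
    exact: measurable_normal_pdf.
  - apply/measurable_EFinP/measurable_funM; first exact: measurable_cst.
    exact: measurable_normal_pdf.
  - move=> x _; rewrite lee_fin !normal_pdfE// /normal_fun subr0 r2.
    have s2 : 0 < s ^+ 2 by rewrite exprn_even_gt0.
    have p0 := normal_peak_gt0 r0.
    set y := x ^+ 2 / (4 * s ^+ 2).
    have -> : - x ^+ 2 / (s ^+ 2 *+ 2) = - y + - y.
      by rewrite /y -(mulr_natl _ 2); field.
    have -> : - x ^+ 2 / ((2 * s ^+ 2) *+ 2) = - y.
      by rewrite /y -(mulr_natl _ 2); field.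
    have -> : x ^+ 2 = 4 * s ^+ 2 * y by rewrite /y; field.
    have -> : c * (normal_peak r * expR (- y)) =
        4 * s ^+ 2 * normal_peak s * expR (- y).
      by rewrite /c; field; rewrite gt_eqF.
    have -> : 4 * s ^+ 2 * y * (normal_peak s * expR (- y - y)) =
        4 * s ^+ 2 * normal_peak s * (y * expR (- y) * expR (- y)).
      by rewrite expRD; ring.
    rewrite ler_wpM2l//.
      by rewrite mulr_ge0 ?normal_peak_ge0// mulr_ge0 ?sqr_ge0.
    rewrite ler_piMl ?expR_ge0//.
    rewrite expRN ler_pdivrMr ?expR_gt0// mul1r.
    by apply: le_trans (expR_ge1Dx y); rewrite lerDr.
rewrite ge0_integralZl//.
- by rewrite integral_normal_pdf mule1 ltry.
- by apply/measurable_EFinP; exact: measurable_normal_pdf.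
- by move=> x _; rewrite lee_fin normal_pdf_ge0.
Qed.

Lemma integrable_normal_id :
  (normal_prob 0 s).-integrable setT (fun x : R => x%:E).
Proof.
by apply: square_integrable_integrable; split; [exact: measurable_id|
  exact: integrable_normal_sqr].
Qed.

Lemma ge0_integral_opp (G : R -> R) : (forall x, 0 <= G x) ->
  measurable_fun setT G -> (\int[mu]_x (G x)%:E = \int[mu]_x (G (- x))%:E)%E.
Proof.
move=> G0 mG.
have mN : measurable_fun setT (-%R : measurableTypeR R -> measurableTypeR R).
  exact: continuous_measurable_fun opp_continuous.
transitivity (\int[pushforward mu (-%R : _ -> measurableTypeR R)]_x (G x)%:E)%E.
  by apply: eq_measure_integral => A mA _; exact/esym/lebesgue_measureN.
rewrite (ge0_integral_pushforward mN)//; first exact/measurable_EFinP.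
by move=> x _; rewrite lee_fin.
Qed.

(** The density is even, so that the positive and the negative parts of the
    identity have the same integral. *)
Lemma Rintegral_normal_id : \int[normal_prob 0 s]_x x = 0.
Proof.
rewrite /Rintegral integralE.
have pE : (fun x : R => x%:E)^\+%E = (fun x : R => (Num.max x 0)%:E).
  by apply/funext => x; rewrite funeposE EFin_max.
have nE : (fun x : R => x%:E)^\-%E = (fun x : R => (Num.max (- x) 0)%:E).
  by apply/funext => x; rewrite funenegE EFin_max.
have cmax : continuous (fun x : R => Num.max x 0).
  by move=> x; apply: continuous_max => //; exact: cvg_cst.
have mmax : measurable_fun setT (fun x : R => Num.max x 0).
  exact: continuous_measurable_fun.
have max0 (x : R) : 0 <= Num.max x 0 by rewrite le_max lexx orbT.
have mmaxN : measurable_fun setT (fun x : R => Num.max (- x) 0).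
  by apply: (measurableT_comp mmax).
rewrite pE nE !ge0_integral_normal//.
rewrite (@ge0_integral_opp (fun x => Num.max x 0 * normal_pdf 0 s x)).
- under eq_integral => x _.
    have -> : normal_pdf 0 s (- x) = normal_pdf 0 s x.
      by rewrite !normal_pdfE// /normal_fun !subr0 sqrrN.
    over.
  rewrite /= subee//.
  rewrite ge0_fin_numE; last first.
    by apply: integral_ge0 => x _; rewrite lee_fin mulr_ge0 ?normal_pdf_ge0.
  rewrite -(@ge0_integral_normal (fun x => Num.max (- x) 0))//.
  have := integrable_funeneg measurableT integrable_normal_id.
  rewrite nE => /integrableP[_]; apply: le_lt_trans.
  by under [leRHS]eq_integral do rewrite gee0_abs ?lee_fin//.
- by move=> x; rewrite mulr_ge0// normal_pdf_ge0.
- by apply: measurable_funM => //; exact: measurable_normal_pdf.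
Qed.

End normal_moments.

(** The law is prescribed by its values on Borel sets, which is how it is given
    for the increments of a Brownian motion. *)
Lemma normal_law_moments {R : realType} {d : measure_display}
    {Omega : measurableType d} (Pr : probability Omega R) (xi : Omega -> R) s :
  s != 0 -> measurable_fun setT xi ->
  (forall B, measurable B -> Pr (xi @^-1` B) = normal_prob 0 s B) ->
  square_integrable Pr xi /\ \int[Pr]_w xi w = 0.
Proof.
move=> s0 mxi law.
pose X : {mfun Omega >-> measurableTypeR R} :=
  HB.pack xi (isMeasurableFun.Build _ _ Omega (measurableTypeR R) xi mxi).
have lawE A : measurable A -> distribution Pr X A = normal_prob 0 s A.
  by move=> mA; exact: law.
have xi2 : square_integrable Pr xi.
  split=> //; apply/integrableP; split.
    exact/measurable_EFinP/measurable_funX.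
  have /integrableP[m2] := integrable_normal_sqr s0.
  rewrite (eq_measure_integral (distribution Pr X)); last first.
    by move=> A mA _; exact/esym/lawE.
  rewrite (ge0_integral_distribution X)//.
  by apply/measurable_EFinP; apply: measurableT_comp => //; exact: measurable_funX.
split=> //; rewrite -(Rintegral_normal_id s0) /Rintegral.
rewrite [in RHS](eq_measure_integral (distribution Pr X)); last first.
  by move=> A mA _; exact/esym/lawE.
congr fine; rewrite (integral_distribution (X := X))//.
exact: square_integrable_integrable xi2.
Qed.

(** * Square integrable processes *)

Section processes.
Context {R : realType} {d : measure_display} {Omega : measurableType d}.
Variable Pr : probability Omega R.
Notation mu := (@lebesgue_measure R).
Implicit Types (Y Z : R -> Omega -> R) (b : R -> R).

(** Products of two such processes are the only random quantities that the cost
    involves, and Fubini's theorem applies to them. *)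
Definition L2_process Y :=
  measurable_fun setT (fun p : measurableTypeR R * Omega => Y p.1 p.2) /\
  exists c : R, forall t, (\int[Pr]_w (Y t w ^+ 2)%:E <= c%:E)%E.

Lemma L2_process_measurable Y t : L2_process Y -> measurable_fun setT (Y t).
Proof. by move=> [mY _]; exact: (measurable_fun_pair2 t mY). Qed.

Lemma L2_process_square_integrable Y t : L2_process Y ->
  square_integrable Pr (Y t).
Proof.
move=> Y2; have mY := L2_process_measurable t Y2; have [_ [c Yc]] := Y2.
split => //; apply/integrableP; split.
  exact/measurable_EFinP/measurable_funX.
under eq_integral do rewrite gee0_abs ?lee_fin ?sqr_ge0//.
by apply: le_lt_trans (Yc t) _; rewrite ltry.
Qed.

(** Iterated integrals are extended real valued; an integrable function is
    finite almost everywhere, so that its real part carries the same integral. *)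
Lemma integrable_fine_comp dT (T' : measurableType dT)
    (m : {measure set T' -> \bar R}) (f : T' -> \bar R) :
  m.-integrable setT f -> m.-integrable setT (fun x => (fine (f x))%:E).
Proof.
move=> intf; have mf := measurable_int _ intf.
apply: (le_integrable _ _ _ intf) => //.
  by apply/measurable_EFinP; exact: measurableT_comp.
by move=> x _; case: (f x) => [r| |] //=; rewrite ?normr0 ?leey.
Qed.

Lemma integral_fine_comp dT (T' : measurableType dT)
    (m : {measure set T' -> \bar R}) (f : T' -> \bar R) :
  m.-integrable setT f -> (\int[m]_x (fine (f x))%:E = \int[m]_x f x)%E.
Proof.
move=> intf; have mf := measurable_int _ intf.
apply: ae_eq_integral => //.
  by apply/measurable_EFinP; exact: measurableT_comp.
have := integrable_ae measurableT intf.
by apply: filterS => x + _ => /(_ I) /fineK.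
Qed.

Section fubini.
Variables (b : R -> R) (Y Z : R -> Omega -> R) (a t beta : R).
Hypotheses (mb : measurable_fun `[a, t] b)
  (bb : forall s, a <= s <= t -> `|b s| <= beta).
Hypotheses (Y2 : L2_process Y) (Z2 : L2_process Z).

Let f (p : Omega * measurableTypeR R) : \bar R :=
  ((b \_ `[a, t]) p.2 * (Y p.2 p.1 * Z p.2 p.1))%:E.

Let mf : measurable_fun setT f.
Proof.
apply/measurable_EFinP; apply: measurable_funM; last first.
  by case: Y2 Z2 => mY _ [mZ _]; apply: measurable_funM;
    [exact: (measurableT_comp mY (@measurable_swap _ _ Omega (measurableTypeR R)))|
     exact: (measurableT_comp mZ (@measurable_swap _ _ Omega (measurableTypeR R)))].
apply: (measurableT_comp (f := b \_ `[a, t])); last exact: measurable_snd.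
by apply/(measurable_restrictT _ _).1.
Qed.

Let intf : (Pr \x mu)%E.-integrable setT f.
Proof.
apply/(integrable21ltyP _ _ mf).
have [_ [c Yc]] := Y2; have [_ [e Ze]] := Z2.
pose K := `|beta| * (c + e).
apply: (@le_lt_trans _ _ (\int[mu]_s (((cst K) \_ `[a, t]) s)%:E)%E); last first.
  rewrite (_ : (fun s => _) = (cst K%:E) \_ `[a, t]); last first.
    by apply/funext => s; rewrite !patchE; case: ifPn.
  rewrite -integral_mkcond integral_cst//= lebesgue_measure_itv/=.
  by case: ifPn => _; rewrite -?EFinD -EFinM ltry.
apply: ge0_le_integral => //.
- by move=> s _; exact: integral_ge0.
- apply: (@measurable_fun_fubini_tonelli_G _ _ _ _ _ Pr (abse \o f)) => //=.
  exact: measurableT_comp.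
- by apply/measurable_EFinP/(measurable_restrictT _ _).1.
- move=> s _; rewrite /f /= !patchE; case: ifPn => sat; last first.
    under eq_integral do rewrite mul0r normr0.
    by rewrite integral0.
  have sat' : a <= s <= t by move: sat; rewrite inE/= in_itv.
  have mYs := L2_process_measurable s Y2; have mZs := L2_process_measurable s Z2.
  have := Yc s; have := Ze s => Zs Ys.
  apply: (@le_trans _ _ (\int[Pr]_w (`|beta|%:E *
      ((Y s w ^+ 2)%:E + (Z s w ^+ 2)%:E)))%E).
    apply: ge0_le_integral => //.
    + apply/measurable_EFinP; apply: measurableT_comp => //.
      by apply: measurable_funM => //; exact: measurable_funM.
    + apply: emeasurable_funM => //; apply/measurable_EFinP.
      by apply: measurable_funD; exact: measurable_funX.
    + move=> w _; rewrite -EFinD -EFinM lee_fin normrM; apply: ler_pM => //.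
        exact: le_trans (bb sat') (ler_norm _).
      rewrite -(real_normK (num_real (Y s w))).
      rewrite -(real_normK (num_real (Z s w))) normrM.
      have := normr_ge0 (Y s w); have := normr_ge0 (Z s w); nra.
  rewrite ge0_integralZl//; last 2 first.
  - by apply/measurable_EFinP/measurable_funD; exact: measurable_funX.
  - by move=> w _; rewrite -EFinD lee_fin addr_ge0 ?sqr_ge0.
  rewrite ge0_integralD//; last 4 first.
  - by move=> w _; rewrite lee_fin sqr_ge0.
  - exact/measurable_EFinP/measurable_funX.
  - by move=> w _; rewrite lee_fin sqr_ge0.
  - exact/measurable_EFinP/measurable_funX.
  rewrite /K EFinM EFinD; apply: lee_wpmul2l; first by rewrite lee_fin.
  exact: leeD.
Qed.

Let pathE w : (\int[mu]_s f (w, s) =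
  \int[mu]_(s in `[a, t]) (b s * (Y s w * Z s w))%:E)%E.
Proof.
rewrite [RHS]integral_mkcond; apply: eq_integral => s _.
by rewrite /f /= !patchE; case: ifPn => //; rewrite mul0r.
Qed.

Lemma integrable_Rintegral_process : Pr.-integrable setT
  (fun w => (\int[mu]_(s in `[a, t]) (b s * (Y s w * Z s w)))%:E).
Proof.
have := integrable_fine_comp (integrable_fubini_F intf).
by under eq_fun do rewrite /fubini_F pathE.
Qed.

Lemma Rintegral_process_Fubini :
  \int[Pr]_w \int[mu]_(s in `[a, t]) (b s * (Y s w * Z s w)) =
  \int[mu]_(s in `[a, t]) (b s * \int[Pr]_w (Y s w * Z s w)).
Proof.
rewrite /Rintegral; congr fine.
transitivity (\int[Pr]_w \int[mu]_s f (w, s))%E.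
  rewrite -(integral_fine_comp (integrable_fubini_F intf)).
  by apply: eq_integral => w _; rewrite /fubini_F pathE.
rewrite (Fubini intf) [RHS]integral_mkcond; apply: eq_integral => s _.
rewrite /f /= !patchE; case: ifPn => sat; last first.
  by under eq_integral do rewrite mul0r; rewrite integral0.
have iYZ := square_integrable_mul (L2_process_square_integrable s Y2)
  (L2_process_square_integrable s Z2).
rewrite EFinM fineK ?integrable_fin_num// -integralZl//.
Qed.

End fubini.

Lemma measurable_moment Y Z : L2_process Y -> L2_process Z ->
  measurable_fun setT (fun s : R => \int[Pr]_w (Y s w * Z s w)).
Proof.
move=> [mY _] [mZ _].
pose g (p : measurableTypeR R * Omega) := (Y p.1 p.2 * Z p.1 p.2)%:E.
have mg : measurable_fun setT g.
  by apply/measurable_EFinP; exact: measurable_funM.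
apply: (measurableT_comp (f := fine)) => //.
have -> : (fun s => \int[Pr]_w (Y s w * Z s w)%:E)%E =
    (fun s => \int[Pr]_w g^\+ (s, w) - \int[Pr]_w g^\- (s, w))%E.
  apply/funext => s; rewrite integralE; congr (_ - _)%E;
    apply: eq_integral => w _; by rewrite !(funeposE, funenegE).
apply: emeasurable_funB.
- apply: (@measurable_fun_fubini_tonelli_F _ _ (measurableTypeR R) _ _ Pr g^\+%E) => //.
  exact: measurable_funepos.
- apply: (@measurable_fun_fubini_tonelli_F _ _ (measurableTypeR R) _ _ Pr g^\-%E) => //.
  exact: measurable_funeneg.
Qed.

Lemma moment_le Y Z c e s : L2_process Y -> L2_process Z ->
  (\int[Pr]_w (Y s w ^+ 2)%:E <= c%:E)%E ->
  (\int[Pr]_w (Z s w ^+ 2)%:E <= e%:E)%E ->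
  `|\int[Pr]_w (Y s w * Z s w)| <= c + e.
Proof.
move=> Y2 Z2 Yc Ze.
have iY := (L2_process_square_integrable s Y2).
have iZ := (L2_process_square_integrable s Z2).
have iYZ := square_integrable_mul iY iZ.
apply: le_trans (le_normr_Rintegral measurableT iYZ) _.
apply: (@le_trans _ _ (\int[Pr]_w (Y s w ^+ 2 + Z s w ^+ 2))).
  apply: le_Rintegral => //.
  - exact: integrable_norm.
  - by have := integrableD measurableT iY.2 iZ.2.
  - move=> w _; rewrite -(real_normK (num_real (Y s w))).
    rewrite -(real_normK (num_real (Z s w))) normrM.
    have := normr_ge0 (Y s w); have := normr_ge0 (Z s w); nra.
rewrite RintegralD//; [|exact: iY.2|exact: iZ.2].
rewrite -lee_fin !EFinD /Rintegral !fineK; first exact: leeD.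
- exact: integrable_fin_num iZ.2.
- exact: integrable_fin_num iY.2.
Qed.

Lemma moment_bounded Y Z : L2_process Y -> L2_process Z ->
  exists c : R, forall s, `|\int[Pr]_w (Y s w * Z s w)| <= c.
Proof.
move=> Y2 Z2; have [_ [c Yc]] := Y2; have [_ [e Ze]] := Z2.
by exists (c + e) => s; exact: moment_le.
Qed.

(** It lets a product of a process with a variable observed at a fixed time be
    treated as a product of two processes. *)
Lemma L2_process_time_cst (xi : Omega -> R) : square_integrable Pr xi ->
  L2_process (fun=> xi).
Proof.
move=> [mxi ixi]; split.
  by apply: (measurableT_comp mxi); exact: measurable_snd.
exists (\int[Pr]_w (xi w ^+ 2)) => t.
by rewrite /Rintegral fineK ?integrable_fin_num.
Qed.

End processes.

(** * Brownian motion *)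

Lemma within_continuous_entry {R : realType} (m n : nat) (A : set R)
    (M : R -> 'M[R]_(m, n)) i j :
  {within A, continuous M} -> {within A, continuous (fun t => M t i j)}.
Proof.
move=> /subspace_continuousP cM; apply/subspace_continuousP => x Ax.
apply: (@cvg_comp _ _ _ M (fun B : 'M[R]_(m, n) => B i j)); first exact: cM Ax.
exact: coord_continuous.
Qed.

Section joint_measurability.
Context {R : realType} {d : measure_display} {Omega : measurableType d}.

(** The process is the limit of its values at the times [truncn (k * t) / k]. *)
Lemma measurable_continuous_process (Y : R -> Omega -> R) :
  (forall t, 0 <= t -> measurable_fun setT (Y t)) ->
  (forall w, {within `[0, +oo[, continuous (Y^~ w)}) ->
  measurable_fun (`[0, +oo[ `*` setT : set (measurableTypeR R * Omega))
    (fun p : measurableTypeR R * Omega => Y p.1 p.2).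
Proof.
move=> mY cY.
pose D : set (measurableTypeR R * Omega) := `[0, +oo[ `*` setT.
pose tau (k : nat) (t : R) : R := (Num.truncn (k.+1%:R * t))%:R / k.+1%:R.
have k0 (k : nat) : 0 < k.+1%:R :> R by [].
apply: (@measurable_fun_cvg _ _ _ D (fun k p => Y (tau k p.1) p.2)).
- move=> k.
  (* The approximation does not depend on time on each of the strips [E j]. *)
  pose E (j : nat) : set (measurableTypeR R * Omega) :=
    `[j%:R / k.+1%:R, j.+1%:R / k.+1%:R[ `*` setT.
  have tauE j (t : R) : j%:R / k.+1%:R <= t -> t < j.+1%:R / k.+1%:R ->
      Num.truncn (k.+1%:R * t) = j.
    rewrite ler_pdivrMr// ltr_pdivlMr// mulrC => jt tj.
    by apply/eqP; rewrite truncn_eq ?jt ?tj// (le_trans _ jt).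
  have -> : D = \bigcup_j E j.
    apply/seteqP; split=> [[t w] [/= + _]|[t w] [j _] [/= + _]].
      rewrite in_itv/= andbT => t0.
      have : 0 <= k.+1%:R * t by rewrite mulr_ge0.
      move/truncn_itv => /andP[tj jt].
      exists (Num.truncn (k.+1%:R * t)) => //; split => //=; rewrite in_itv/=.
      by rewrite ler_pdivrMr// ltr_pdivlMr// (mulrC t) tj jt.
    rewrite in_itv/= => /andP[jt _]; split => //=; rewrite in_itv/= andbT.
    by apply: le_trans jt; rewrite divr_ge0.
  have mE j : measurable (E j) by apply: measurableX.
  apply/measurable_fun_bigcup => // j.
  apply: (@eq_measurable_fun _ _ _ _ _ (fun p => Y (j%:R / k.+1%:R) p.2)).
    move=> [t w]; rewrite inE => -[/=]; rewrite in_itv/= => /andP[jt tj] _.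
    by rewrite /tau (tauE j).
  apply: measurable_funTS.
  apply: (measurableT_comp (mY _ _)); [by rewrite divr_ge0|].
  exact: measurable_snd.
- move=> [t w] [/= + _]; rewrite in_itv/= andbT => t0.
  have /subspace_continuousP/(_ t) := cY w.
  rewrite /= in_itv/= andbT => /(_ t0) ct.
  apply: (@cvg_comp _ _ _ (fun k => tau k t) (Y^~ w) _
    (within `[0, +oo[ (nbhs t))) ct.
  have tau0 k : 0 <= tau k t by rewrite divr_ge0.
  have tau_le k : `|t - tau k t| <= k.+1%:R^-1.
    have : 0 <= k.+1%:R * t by rewrite mulr_ge0.
    move/truncn_itv => /andP[tj]; rewrite -[X in _ < X]natr1 => jt.
    have E : k.+1%:R * tau k t = (Num.truncn (k.+1%:R * t))%:R.
      by rewrite mulrC divfK// pnatr_eq0.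
    rewrite -E in tj; rewrite -E in jt.
    rewrite ger0_norm; last by rewrite subr_ge0 -(ler_pM2l (k0 k)).
    by rewrite -(ler_pM2l (k0 k)) divff ?pnatr_eq0// mulrBr; lra.
  have tau_cvg : tau k t @[k --> \oo] --> t.
    apply/cvgrPdist_le => e e0; near=> k.
    apply: le_trans (tau_le k) _; near: k.
    apply: filterS (near_infty_natSinv_lt (PosNum e0)) => j; exact: ltW.
  move=> A; rewrite /within /= => At.
  have : \forall k \near \oo, `[0, +oo[%classic (tau k t) -> A (tau k t).
    exact: tau_cvg _ At.
  by apply: filterS => k; apply; rewrite /= in_itv/= andbT.
Unshelve. all: by end_near. Qed.

End joint_measurability.

Section almost_sure_equality.
Context {R : realType} {d : measure_display} {Omega : measurableType d}.
Variable Pr : probability Omega R.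
Implicit Types xi eta : Omega -> R.

Lemma ae_eq_square_integrable xi eta : measurable_fun setT eta ->
  {ae Pr, forall w, xi w = eta w} ->
  square_integrable Pr xi -> square_integrable Pr eta.
Proof.
move=> meta xe [mxi /integrableP[_ ixi]]; split => //; apply/integrableP; split.
  exact/measurable_EFinP/measurable_funX.
rewrite (ae_eq_integral (fun w => `|(xi w ^+ 2)%:E|)%E)//.
- by apply: measurableT_comp => //; apply/measurable_EFinP/measurable_funX.
- by apply: measurableT_comp => //; apply/measurable_EFinP/measurable_funX.
- by apply: filterS xe => w + _ => ->.
Qed.

Lemma ae_eq_Rintegral xi eta :
  measurable_fun setT xi -> measurable_fun setT eta ->
  {ae Pr, forall w, xi w = eta w} -> \int[Pr]_w xi w = \int[Pr]_w eta w.
Proof.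
move=> mxi meta xe; congr fine; apply: ae_eq_integral => //.
- exact/measurable_EFinP.
- exact/measurable_EFinP.
- by apply: filterS xe => w + _ => ->.
Qed.

End almost_sure_equality.

Section brownian_motion_moments.
Context {R : realType} {d : measure_display} {Omega : measurableType d}.
Context {n : nat}.
Variables (Pr : probability Omega R) (W : R -> Omega -> 'cV[R]_n).
Hypothesis BM : brownian_motion Pr W.

Let mW t i : 0 <= t -> measurable_fun setT (fun w => W t w i 0).
Proof. by case: BM => + _ _ _ _; apply. Qed.

Lemma BM_increment s t i : 0 <= s < t ->
  square_integrable Pr (fun w => W t w i 0 - W s w i 0) /\
  \int[Pr]_w (W t w i 0 - W s w i 0) = 0.
Proof.
move=> /[dup] st /andP[s0 lt_st]; have [_ _ _ law _] := BM.
apply: (@normal_law_moments _ _ _ _ _ (Num.sqrt (t - s))).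
- by rewrite sqrtr_eq0 -ltNge subr_gt0.
- apply: measurable_funB; apply: mW => //.
  exact: le_trans s0 (ltW lt_st).
- move=> B mB.
  have := law s t (fun j => if j == i then B else setT) st.
  rewrite (bigD1 i)//= eqxx big1 ?mule1; last first.
    by move=> j /negbTE ->; exact: probability_setT.
  move=> <-; last by move=> j; case: ifP.
  congr (Pr _); apply/seteqP; split=> w /=.
    by move=> Bw j; case: eqP => // ->.
  by move=> /(_ i); rewrite eqxx.
Qed.

Lemma BM_square_integrable t i : 0 <= t ->
  square_integrable Pr (fun w => W t w i 0).
Proof.
have [_ W0 _ _ _] := BM.
have sq0 : square_integrable Pr (fun w => W 0 w i 0).
  apply: ae_eq_square_integrable (square_integrable_cst Pr 0); first exact: mW.
  by apply: filterS W0 => w ->; rewrite mxE.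
rewrite le_eqVlt => /predU1P[<-//|t0].
have [sqt _] := @BM_increment 0 t i (introT andP (conj (lexx 0) t0)).
have := square_integrableD sqt sq0.
by under eq_fun do rewrite subrK.
Qed.

(** The increment after time [s] is centred and independent of the value at
    time [s]. *)
Lemma BM_increment_orthogonal s t i j : 0 <= s <= t ->
  \int[Pr]_w (W s w i 0 * W t w j 0) = \int[Pr]_w (W s w i 0 * W s w j 0).
Proof.
move=> /andP[s0]; rewrite le_eqVlt => /predU1P[<-//|st].
have st' : 0 <= s < t by rewrite s0.
have t0 : 0 <= t := le_trans s0 (ltW st).
have [sqi mean0] := @BM_increment s t j st'.
have sqs k := @BM_square_integrable s k s0.
have [_ _ _ _ indep] := BM.
have ortho : \int[Pr]_w (W s w i 0 * (W t w j 0 - W s w j 0)) = 0.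
  rewrite Rintegral_indep_mul ?mean0 ?mulr0//.
  - exact: mW.
  - by case: sqi.
  - move=> A B mA mB; apply: (indep s t st').
      apply: sub_sigma_algebra; exists s, i, A; split => //.
      by rewrite s0 lexx.
    by apply: sub_sigma_algebra; exists j, B.
  - exact: square_integrable_integrable (sqs i).
  - exact: square_integrable_integrable sqi.
  - exact: square_integrable_mul (sqs i) sqi.
have := RintegralD measurableT (square_integrable_mul (sqs i) sqi)
  (square_integrable_mul (sqs i) (sqs j)).
rewrite ortho add0r => <-; apply: eq_Rintegral => w _; ring.
Qed.

(** By orthogonality, the difference is the second moment of the increment. *)
Lemma BM_second_moment_le s t i : 0 <= s <= t ->
  \int[Pr]_w (W s w i 0 ^+ 2) <= \int[Pr]_w (W t w i 0 ^+ 2).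
Proof.
move=> st; have [s0 s_t] := andP st; have t0 := le_trans s0 s_t.
have sqs := @BM_square_integrable s i s0.
have sqt := @BM_square_integrable t i t0.
rewrite -subr_ge0.
have -> : \int[Pr]_w (W t w i 0 ^+ 2) - \int[Pr]_w (W s w i 0 ^+ 2) =
    \int[Pr]_w ((W t w i 0 - W s w i 0) ^+ 2).
  have -> : \int[Pr]_w ((W t w i 0 - W s w i 0) ^+ 2) =
      \int[Pr]_w (W t w i 0 ^+ 2 +
        (W s w i 0 ^+ 2 - 2 * (W s w i 0 * W t w i 0))).
    by apply: eq_Rintegral => w _; ring.
  have ist := square_integrable_mul sqs sqt.
  have i2 : Pr.-integrable setT (fun w => (2 * (W s w i 0 * W t w i 0))%:E).
    by have := integrableZl measurableT 2 ist.
  have i3 : Pr.-integrable setT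
      (fun w => (W s w i 0 ^+ 2 - 2 * (W s w i 0 * W t w i 0))%:E).
    by have := integrableB measurableT sqs.2 i2.
  rewrite RintegralD//; last exact: sqt.2.
  rewrite RintegralB//; last exact: sqs.2.
  rewrite RintegralZl// (BM_increment_orthogonal _ _ st).
  have -> : \int[Pr]_w (W s w i 0 * W s w i 0) = \int[Pr]_w (W s w i 0 ^+ 2).
    by apply: eq_Rintegral => w _; rewrite expr2.
  lra.
by apply: Rintegral_ge0 => w _; exact: sqr_ge0.
Qed.

End brownian_motion_moments.

(** When [N] is a null set outside which the paths of [Y] are regular, the
    truncated process agrees with [Y] almost surely on [0, T], while its
    regularity holds for all outcomes and all times. *)
Definition truncated {R : realType} {Omega : Type} {V : nmodType} (T : R)
    (N : set Omega) (Y : R -> Omega -> V) (t : R) (w : Omega) : V :=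
  if (0 <= t <= T) && (w \notin N) then Y t w else 0.

Lemma truncatedE {R : realType} {Omega : Type} {V : nmodType} (T : R)
    (N : set Omega) (Y : R -> Omega -> V) t w :
  0 <= t <= T -> ~ N w -> truncated T N Y t w = Y t w.
Proof. by move=> tT Nw; rewrite /truncated tT/= memNset. Qed.

Lemma truncated_entry {R : realType} {Omega : Type} {V : nmodType} m k (T : R)
    (N : set Omega) (Y : R -> Omega -> 'M[V]_(m, k)) t w i j :
  truncated T N Y t w i j = truncated T N (fun t w => Y t w i j) t w.
Proof. by rewrite /truncated; case: ifP => // _; rewrite mxE. Qed.

Section truncated_brownian_motion.
Context {R : realType} {d : measure_display} {Omega : measurableType d}.
Context {n : nat}.
Variables (Pr : probability Omega R) (W : R -> Omega -> 'cV[R]_n).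
Hypothesis BM : brownian_motion Pr W.
Variables (T : R) (N : set Omega).
Hypotheses (mN : measurable N) (PrN : Pr N = 0%E).
Hypothesis cW : forall w, ~ N w -> {within `[0, +oo[, continuous (W ^~ w)}.

Notation Wt i := (truncated T N (fun t w => W t w i 0)).



Lemma truncated_ae t i : 0 <= t <= T ->
  {ae Pr, forall w, W t w i 0 = Wt i t w}.
Proof.
move=> tT; exists N; split => // w /=; apply: contra_notP => Nw.
by rewrite truncatedE.
Qed.

Let mWt i t : measurable_fun setT (Wt i t).
Proof.
rewrite /truncated; have [tT|_] /= := boolP (0 <= t <= T); last first.
  exact: measurable_cst.
apply: measurable_fun_ifT => //.
- apply: (measurable_fun_bool true) => /=; rewrite setTI.
  rewrite (_ : _ @^-1` _ = ~` N); first exact: measurableC.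
  apply/seteqP; split=> w /=; last by move=> Nw; rewrite memNset.
  by move=> + Nw; rewrite mem_set.
- by case: BM => mW _ _ _ _; apply: mW; case/andP: tT.
Qed.

Lemma truncated_BM_measurable i : measurable_fun setT
  (fun p : measurableTypeR R * Omega => Wt i p.1 p.2).
Proof.
pose Y t w := if w \in N then 0 else W t w i 0.
have mY t : 0 <= t -> measurable_fun setT (Y t).
  move=> t0; apply: measurable_fun_ifT => //.
    apply: (measurable_fun_bool true); rewrite setTI.
    rewrite (_ : _ @^-1` _ = N)//.
    by apply/seteqP; split=> w /=; [move/set_mem|move/mem_set].
  by case: BM => mW _ _ _ _; exact: mW.
have cY w : {within `[0, +oo[, continuous (Y^~ w)}.
  have [Nw|] := boolP (w \in N).
    rewrite (_ : Y^~ w = fun=> 0); last by apply/funext => t; rewrite /Y Nw.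
    by apply: continuous_subspaceT; exact: cst_continuous.
  move=> Nw'; have Nw : ~ N w by rewrite -notin_setE.
  rewrite (_ : Y^~ w = fun t => W t w i 0); last first.
    by apply/funext => t; rewrite /Y (negbTE Nw').
  exact: within_continuous_entry (cW Nw).
have := measurable_continuous_process mY cY.
pose D : set (measurableTypeR R * Omega) := `[0, T] `*` setT.
move=> mY'; have mYD : measurable_fun D (fun p => Y p.1 p.2).
  apply: measurable_funS mY'; first exact: measurableX.
  by apply: setSX => // t /=; rewrite !in_itv/= => /andP[-> _].
have mD : measurable D by exact: measurableX.
have /(measurable_restrictT _ mD) := mYD.
apply: eq_measurable_fun => -[t w] _; rewrite patchE /truncated /Y /=.
have -> : ((t, w) \in D) = (0 <= t <= T).
  apply/idP/idP => [/[!inE] -[/=]|tT]; first by rewrite in_itv.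
  by rewrite inE; split => //=; rewrite in_itv.
by case: ifP => //=; case: ifP.
Qed.

Lemma truncated_BM_second_moment_le i t :
  (\int[Pr]_w (Wt i t w ^+ 2)%:E <= (\int[Pr]_w (W T w i 0 ^+ 2))%:E)%E.
Proof.
have [tT|tT] := boolP (0 <= t <= T); last first.
  under eq_integral do rewrite /truncated (negbTE tT) expr0n.
  by rewrite integral0 lee_fin; apply: Rintegral_ge0 => w _; exact: sqr_ge0.
have [t0 t_T] := andP tT; have T0 := le_trans t0 t_T.
have sqt := BM_square_integrable BM i t0.
have -> : (\int[Pr]_w (Wt i t w ^+ 2)%:E = (\int[Pr]_w (W t w i 0 ^+ 2))%:E)%E.
  rewrite /Rintegral fineK ?integrable_fin_num//; last exact: sqt.2.
  apply: ae_eq_integral => //.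
  - exact/measurable_EFinP/measurable_funX.
  - by apply/measurable_EFinP/measurable_funX; case: sqt.
  - by apply: filterS (truncated_ae i tT) => w + _ => ->.
by rewrite lee_fin; exact: BM_second_moment_le.
Qed.

Lemma truncated_BM_L2 i : L2_process Pr (Wt i).
Proof.
split; first exact: truncated_BM_measurable.
by eexists => t; exact: truncated_BM_second_moment_le.
Qed.

Lemma truncated_BM_orthogonal s t i j : 0 <= s -> s <= t -> t <= T ->
  \int[Pr]_w (Wt i s w * Wt j t w) = \int[Pr]_w (Wt i s w * Wt j s w).
Proof.
move=> s0 st tT.
have t0 := le_trans s0 st; have sT := le_trans st tT.
have sT' : 0 <= s <= T by rewrite s0.
have tT' : 0 <= t <= T by rewrite t0.
have mW k r : 0 <= r -> measurable_fun setT (fun w => W r w k 0).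
  by case: BM => + _ _ _ _; apply.
have E r k r' l : 0 <= r <= T -> 0 <= r' <= T ->
    \int[Pr]_w (Wt k r w * Wt l r' w) = \int[Pr]_w (W r w k 0 * W r' w l 0).
  move=> rT rT'; apply: ae_eq_Rintegral; first exact: measurable_funM.
    by apply: measurable_funM; apply: mW; [case/andP: rT|case/andP: rT'].
  by apply: filterS2 (truncated_ae k rT) (truncated_ae l rT') => w -> ->.
by rewrite !E// (BM_increment_orthogonal BM) ?s0.
Qed.

End truncated_brownian_motion.

(** * A matrix norm and positive matrices *)

Section l1_norm.
Context {R : realType}.

(** The entrywise l^1 norm is submultiplicative in all formats, by mere
    rearrangement of finite sums, and it dominates the trace. *)
Definition l1norm {m n} (A : 'M[R]_(m, n)) : R := \sum_i \sum_j `|A i j|.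

Lemma l1norm_ge0 m n (A : 'M[R]_(m, n)) : 0 <= l1norm A.
Proof. by apply: sumr_ge0 => i _; apply: sumr_ge0. Qed.

Lemma l1norm0 m n : l1norm (0 : 'M[R]_(m, n)) = 0.
Proof. by apply: big1 => i _; apply: big1 => j _; rewrite mxE normr0. Qed.

Lemma le_entry_l1norm m n (A : 'M[R]_(m, n)) i j : `|A i j| <= l1norm A.
Proof.
rewrite /l1norm (bigD1 i)//= (bigD1 j)//= -addrA lerDl addr_ge0//.
  exact: sumr_ge0.
by apply: sumr_ge0 => k _; exact: sumr_ge0.
Qed.

Lemma l1norm_le_entries m n (A : 'M[R]_(m, n)) c :
  (forall i j, `|A i j| <= c) -> l1norm A <= (m * n)%:R * c.
Proof.
move=> Ac; apply: (@le_trans _ _ (\sum_(i < m) \sum_(j < n) c)).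
  by apply: ler_sum => i _; apply: ler_sum => j _.
by rewrite !sumr_const !card_ord -mulrnA mulr_natl mulnC.
Qed.

Lemma l1normT m n (A : 'M[R]_(m, n)) : l1norm A^T = l1norm A.
Proof.
rewrite /l1norm exchange_big/=.
by apply: eq_bigr => i _; apply: eq_bigr => j _; rewrite mxE.
Qed.

Lemma l1normN m n (A : 'M[R]_(m, n)) : l1norm (- A) = l1norm A.
Proof. by apply: eq_bigr => i _; apply: eq_bigr => j _; rewrite mxE normrN. Qed.

Lemma l1normZ m n c (A : 'M[R]_(m, n)) : l1norm (c *: A) = `|c| * l1norm A.
Proof.
rewrite /l1norm mulr_sumr; apply: eq_bigr => i _.
by rewrite mulr_sumr; apply: eq_bigr => j _; rewrite mxE normrM.
Qed.

Lemma l1normD m n (A B : 'M[R]_(m, n)) : l1norm (A + B) <= l1norm A + l1norm B.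
Proof.
rewrite /l1norm -big_split/=; apply: ler_sum => i _.
by rewrite -big_split/=; apply: ler_sum => j _; rewrite mxE ler_normD.
Qed.

Lemma l1normM m n p (A : 'M[R]_(m, n)) (B : 'M[R]_(n, p)) :
  l1norm (A *m B) <= l1norm A * l1norm B.
Proof.
rewrite /l1norm mulr_suml; apply: ler_sum => i _.
apply: (@le_trans _ _ (\sum_k \sum_j `|A i j| * `|B j k|)).
  apply: ler_sum => k _; rewrite mxE; apply: le_trans (ler_norm_sum _ _ _) _.
  by apply: ler_sum => j _; rewrite normrM.
rewrite exchange_big/= mulr_suml; apply: ler_sum => j _.
rewrite -mulr_sumr ler_wpM2l// [leRHS](bigD1 j)//= lerDl.
by apply: sumr_ge0 => k _; exact: sumr_ge0.
Qed.

Lemma normr_mxtrace_le_l1norm n (A : 'M[R]_n) : `|\tr A| <= l1norm A.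
Proof.
apply: le_trans (ler_norm_sum _ _ _) _; apply: ler_sum => i _.
by rewrite (bigD1 i)//= lerDl sumr_ge0.
Qed.

Lemma mxtrace_le_l1norm n (A : 'M[R]_n) : \tr A <= l1norm A.
Proof. exact: le_trans (ler_norm _) (normr_mxtrace_le_l1norm A). Qed.

Lemma le_entry_frobenius m n (A : 'M[R]_(m, n)) i j : `|A i j| <= frobenius A.
Proof.
rewrite -sqrtr_sqr ler_wsqrtr// (bigD1 i)//= (bigD1 j)//= -addrA lerDl.
apply: addr_ge0; first by apply: sumr_ge0 => k _; exact: sqr_ge0.
by apply: sumr_ge0 => k _; apply: sumr_ge0 => l _; exact: sqr_ge0.
Qed.

Lemma frobenius_sqr m n (A : 'M[R]_(m, n)) :
  frobenius A ^+ 2 = \sum_i \sum_j A i j ^+ 2.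
Proof.
by rewrite sqr_sqrtr// sumr_ge0// => i _; apply: sumr_ge0 => j _; exact: sqr_ge0.
Qed.

(** A perturbation estimate bundled with bounds on both matrices is stable under
    the matrix operations, with constants that depend on the constants of the
    arguments only.  So the estimates for the Riccati maps follow the structure
    of their formulas. *)
Definition close (eps c b : R) {m n} (A A' : 'M[R]_(m, n)) :=
  [/\ 0 <= c, l1norm (A - A') <= c * eps, l1norm A <= b & l1norm A' <= b].

Variable eps : R.
Hypothesis eps0 : 0 <= eps.

Lemma close_refl b m n (A : 'M[R]_(m, n)) : l1norm A <= b -> close eps 0 b A A.
Proof. by move=> Ab; split; rewrite // subrr l1norm0 mul0r. Qed.

Lemma closeD c c' b b' m n (A A' B B' : 'M[R]_(m, n)) :
  close eps c b A A' -> close eps c' b' B B' ->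
  close eps (c + c') (b + b') (A + B) (A' + B').
Proof.
move=> [c0 AA' Ab A'b] [c'0 BB' Bb B'b]; split; first exact: addr_ge0.
- rewrite opprD addrACA mulrDl; apply: le_trans (l1normD _ _) _; exact: lerD.
- by apply: le_trans (l1normD _ _) _; exact: lerD.
- by apply: le_trans (l1normD _ _) _; exact: lerD.
Qed.

Lemma closeN c b m n (A A' : 'M[R]_(m, n)) :
  close eps c b A A' -> close eps c b (- A) (- A').
Proof. by move=> [c0 AA' Ab A'b]; split; rewrite -?opprD ?l1normN. Qed.

Lemma closeT c b m n (A A' : 'M[R]_(m, n)) :
  close eps c b A A' -> close eps c b A^T A'^T.
Proof.
move=> [c0 AA' Ab A'b]; split; rewrite // ?l1normT//.
by rewrite -[A'^T]/(trmx A') -linearB/= l1normT.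
Qed.

Lemma closeM c c' b b' m n p (A A' : 'M[R]_(m, n)) (B B' : 'M[R]_(n, p)) :
  close eps c b A A' -> close eps c' b' B B' ->
  close eps (b * c' + c * b') (b * b') (A *m B) (A' *m B').
Proof.
move=> [c0 AA' Ab A'b] [c'0 BB' Bb B'b].
have b0 : 0 <= b := le_trans (l1norm_ge0 A) Ab.
have b'0 : 0 <= b' := le_trans (l1norm_ge0 B) Bb.
split; first by rewrite addr_ge0// mulr_ge0.
- have -> : A *m B - A' *m B' = A *m (B - B') + (A - A') *m B'.
    by rewrite mulmxBr mulmxBl addrA subrK.
  apply: le_trans (l1normD _ _) _; rewrite mulrDl; apply: lerD.
    apply: le_trans (l1normM _ _) _.
    by rewrite -mulrA; apply: ler_pM; rewrite ?l1norm_ge0.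
  apply: le_trans (l1normM _ _) _.
  by rewrite mulrAC; apply: ler_pM; rewrite ?l1norm_ge0.
- by apply: le_trans (l1normM _ _) _; apply: ler_pM; rewrite ?l1norm_ge0.
- by apply: le_trans (l1normM _ _) _; apply: ler_pM; rewrite ?l1norm_ge0.
Qed.

Lemma close_small a m n (A : 'M[R]_(m, n)) t b : l1norm A <= a ->
  0 <= t -> t <= eps -> t <= b -> close eps a (b * a) (t *: A) 0.
Proof.
move=> Aa t0 te tb.
have a0 : 0 <= a := le_trans (l1norm_ge0 A) Aa.
split; rewrite // ?subr0 ?l1norm0 ?l1normZ ?(ger0_norm t0).
- by rewrite mulrC; apply: ler_pM; rewrite ?l1norm_ge0.
- by apply: ler_pM; rewrite ?l1norm_ge0.
- by rewrite mulr_ge0// (le_trans t0).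
Qed.

End l1_norm.

Section positive_matrices.
Context {R : realType}.

Lemma qformD n (M M' : 'M[R]_n) x : qform (M + M') x = qform M x + qform M' x.
Proof. by rewrite /qform mulmxDr mulmxDl mxE. Qed.

Lemma qformZ n c (M : 'M[R]_n) x : qform (c *: M) x = c * qform M x.
Proof. by rewrite /qform -scalemxAr -scalemxAl mxE. Qed.

Lemma qform_conj m n (M : 'M[R]_m) (B : 'M[R]_(m, n)) x :
  qform (B^T *m M *m B) x = qform M (B *m x).
Proof. by rewrite /qform trmx_mul !mulmxA. Qed.

Lemma qform_delta n (M : 'M[R]_n) i : qform M (delta_mx i 0) = M i i.
Proof.
by rewrite /qform trmx_delta -rowE -colE !mxE.
Qed.

(** A scalar is its own transpose. *)
Lemma bilinear_sym n (M : 'M[R]_n) (x y : 'cV[R]_n) : M^T = M ->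
  (x^T *m M *m y) 0 0 = (y^T *m M *m x) 0 0.
Proof.
move=> sM; have -> : y^T *m M *m x = (x^T *m M *m y)^T.
  by rewrite !trmx_mul trmxK sM mulmxA.
by rewrite [RHS]mxE.
Qed.

Lemma qform_addZ n (M : 'M[R]_n) (x y : 'cV[R]_n) c : M^T = M ->
  qform M (x + c *: y) =
  qform M x + c * (2 * (x^T *m M *m y) 0 0) + c ^+ 2 * qform M y.
Proof.
move=> sM; rewrite mulr_natl mulr2n {2}(bilinear_sym x y sM) /qform.
have -> : (x + c *: y)^T = x^T + c *: y^T by rewrite linearD/= linearZ.
rewrite !mulmxDl !mulmxDr -!scalemxAr -!scalemxAl.
move: (x^T *m M *m x) (x^T *m M *m y) (y^T *m M *m x) (y^T *m M *m y).
by move=> xx xy yx yy; rewrite !mxE; ring.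
Qed.

Lemma sym_psdD n (M M' : 'M[R]_n) : sym_psd M -> sym_psd M' -> sym_psd (M + M').
Proof.
move=> [sM pM] [sM' pM']; split; first by rewrite linearD/= sM sM'.
by move=> x; rewrite qformD addr_ge0.
Qed.

Lemma sym_psdZ n c (M : 'M[R]_n) : 0 <= c -> sym_psd M -> sym_psd (c *: M).
Proof.
move=> c0 [sM pM]; split; first by rewrite linearZ/= sM.
by move=> x; rewrite qformZ mulr_ge0.
Qed.

Lemma sym_psd_conj m n (M : 'M[R]_m) (B : 'M[R]_(m, n)) :
  sym_psd M -> sym_psd (B^T *m M *m B).
Proof.
move=> [sM pM]; split; first by rewrite !trmx_mul trmxK sM mulmxA.
by move=> x; rewrite qform_conj.
Qed.

Lemma sym_psd0 n : sym_psd (0 : 'M[R]_n).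
Proof. by split; rewrite ?trmx0// => x; rewrite /qform mulmx0 mul0mx mxE. Qed.

Lemma sym_pdW n (M : 'M[R]_n) : sym_pd M -> sym_psd M.
Proof.
move=> [sM pM]; split => // x; have [->|x0] := eqVneq x 0; last exact/ltW/pM.
by rewrite /qform mulmx0 mxE.
Qed.

Lemma sym_psd_mxtrace n (M : 'M[R]_n) : sym_psd M -> 0 <= \tr M.
Proof.
by move=> [_ pM]; apply: sumr_ge0 => i _; rewrite -qform_delta.
Qed.

(** The off-diagonal entries of a positive matrix are dominated by the
    diagonal ones, hence by the trace. *)
Lemma l1norm_psd n (M : 'M[R]_n) : sym_psd M -> l1norm M <= n%:R * \tr M.
Proof.
move=> [sM pM].
have Mij i j : `|M i j| <= (M i i + M j j) / 2.
  have q c : qform M (delta_mx i 0 + c *: delta_mx j 0) =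
      M i i + c * (2 * M i j) + c ^+ 2 * M j j.
    rewrite qform_addZ// !qform_delta trmx_delta -rowE -colE !mxE; ring.
  have := pM (delta_mx i 0 + 1 *: delta_mx j 0).
  have := pM (delta_mx i 0 + (-1) *: delta_mx j 0).
  rewrite !q => ? ?; rewrite ler_norml; apply/andP; split; lra.
apply: (@le_trans _ _ (\sum_(i < n) \sum_(j < n) (M i i + M j j) / 2)).
  by apply: ler_sum => i _; apply: ler_sum => j _.
under eq_bigr do rewrite -mulr_suml big_split/= sumr_const card_ord.
rewrite -mulr_suml big_split/= sumr_const card_ord.
have -> : \sum_(i < n) (M i i *+ n) = n%:R * \tr M by rewrite sumrMnl mulr_natl.
rewrite -mulr_natl -/(\tr M); lra.
Qed.

Lemma sym_pd_unitmx n (M : 'M[R]_n) : sym_pd M -> M \in unitmx.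
Proof.
move=> [sM pM]; rewrite unitmxE unitfE; apply/negP => /det0P[v v0 vM].
have := pM v^T; rewrite /qform trmxK vM mul0mx mxE ltxx => /(_ _)/notF; apply.
by apply: contra v0 => /eqP /(congr1 trmx); rewrite trmxK trmx0 => ->.
Qed.

Lemma sym_pdD n (M M' : 'M[R]_n) : sym_pd M -> sym_psd M' -> sym_pd (M + M').
Proof.
move=> [sM pM] [sM' pM']; split; first by rewrite linearD/= sM sM'.
by move=> x x0; rewrite qformD ltr_wpDr// pM.
Qed.

Lemma qform_inv n (M : 'M[R]_n) x : sym_pd M ->
  qform (invmx M) x = qform M (invmx M *m x).
Proof.
move=> Mpd; have uM := sym_pd_unitmx Mpd; have [sM _] := Mpd.
by rewrite /qform trmx_mul trmx_inv sM -!mulmxA (mulmxA M) mulmxV// mul1mx.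
Qed.

Lemma sym_pd_inv n (M : 'M[R]_n) : sym_pd M -> sym_psd (invmx M).
Proof.
move=> Mpd; split; first by rewrite trmx_inv; case: Mpd => ->.
by move=> x; rewrite qform_inv//; case: (sym_pdW Mpd).
Qed.

(** Inversion reverses the order of positive matrices: with [y] and [z] the
    images of [x] under the two inverses, expand [0 <= qform M (y - z)]. *)
Lemma qform_inv_le n (M M' : 'M[R]_n) x : sym_pd M -> sym_psd M' ->
  qform (invmx (M + M')) x <= qform (invmx M) x.
Proof.
move=> Mpd M'psd; have Zpd := sym_pdD Mpd M'psd.
have uM := sym_pd_unitmx Mpd; have uZ := sym_pd_unitmx Zpd.
pose y := invmx (M + M') *m x; pose z := invmx M *m x.
have My : qform (invmx (M + M')) x = (x^T *m y) 0 0.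
  by rewrite /qform mulmxA.
have Mz : qform (invmx M) x = (x^T *m z) 0 0 by rewrite /qform mulmxA.
have := (sym_pdW Mpd).2 (y - z).
have -> : qform M (y - z) = qform M y - 2 * (x^T *m y) 0 0 + qform M z.
  rewrite -[y - z]/(y + - z) -scaleN1r qform_addZ ?(proj1 Mpd)//.
  rewrite bilinear_sym ?(proj1 Mpd)// /z trmx_mul trmx_inv (proj1 Mpd).
  by rewrite -(mulmxA x^T) mulVmx// mulmx1; ring.
have : qform M y <= (x^T *m y) 0 0.
  rewrite -My qform_inv// qformD lerDl; exact: M'psd.2.
by rewrite -qform_inv// My Mz; lra.
Qed.

(** Adding a positive matrix to the weight does not spoil the bound on the
    inverse: this makes the discrete gains uniformly bounded. *)
Lemma l1norm_inv_le n (M M' : 'M[R]_n) : sym_pd M -> sym_psd M' ->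
  l1norm (invmx (M + M')) <= n%:R * \tr (invmx M).
Proof.
move=> Mpd M'psd; have Zpd := sym_pdD Mpd M'psd.
apply: le_trans (l1norm_psd (sym_pd_inv Zpd)) _.
rewrite ler_wpM2l//; apply: ler_sum => i _.
by rewrite -!qform_delta qform_inv_le.
Qed.

Lemma invmxD_sub n (M M' : 'M[R]_n) : M \in unitmx -> M + M' \in unitmx ->
  invmx (M + M') - invmx M = - (invmx (M + M') *m M' *m invmx M).
Proof.
move=> uM uZ; apply: (can_inj (mulmxK uM)).
rewrite mulmxBl mulVmx// mulNmx mulmxKV//.
have -> : invmx (M + M') *m M = invmx (M + M') *m (M + M' - M').
  by rewrite addrK.
by rewrite mulmxBr mulVmx// addrAC subrr add0r.
Qed.

End positive_matrices.

(** * The Riccati maps *)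

Section riccati_maps.
Context {R : realType} {n d : nat}.
Implicit Types (A : 'M[R]_n) (B : 'M[R]_(n, d)) (P : 'M[R]_n).
Variables (T : R) (Q : 'M[R]_n) (S : 'M[R]_d).
Hypotheses (T0 : 0 < T) (Qpsd : sym_psd Q) (Spd : sym_pd S).

Definition riccati_field A B P : 'M[R]_n :=
  A^T *m P + P *m A - P *m B *m invmx S *m B^T *m P + Q.

Definition regularised_weight (tau : R) B P : 'M[R]_d :=
  S + tau *: (B^T *m P *m B).

Definition euler_transition (tau : R) A : 'M[R]_n := 1%:M + tau *: A.

Definition optimal_gain tau A B P : 'M[R]_(d, n) :=
  - (invmx (regularised_weight tau B P) *m B^T *m P *m euler_transition tau A).

(** The increment of the discrete Riccati step, divided by the step size. *)
Definition discrete_riccati_field tau A B P : 'M[R]_n :=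
  Q + (A^T *m P + P *m A) + tau *: (A^T *m P *m A)
  - (euler_transition tau A)^T *m P *m B
    *m invmx (regularised_weight tau B P) *m B^T *m P *m euler_transition tau A.

Lemma euler_transition_tr tau A :
  (euler_transition tau A)^T = 1%:M + tau *: A^T.
Proof. by rewrite [LHS]linearD/= linearZ/= trmx1. Qed.

Lemma euler_transition_conj tau A P :
  (euler_transition tau A)^T *m P *m euler_transition tau A =
  P + tau *: (A^T *m P + P *m A) + tau ^+ 2 *: (A^T *m P *m A).
Proof.
rewrite euler_transition_tr /euler_transition.
rewrite mulmxDl mul1mx -scalemxAl mulmxDr mulmx1 -scalemxAr mulmxDl -scalemxAl.
move: (A^T *m P *m A) (A^T *m P) (P *m A) => X Y Z.
by apply/matrixP => i j; rewrite !mxE; ring.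
Qed.

Lemma discrete_riccati_stepE A B N P : let tau := T / N%:R in
  discrete_riccati_step T A B Q S N P =
  P + tau *: discrete_riccati_field tau A B P.
Proof.
move=> tau; rewrite /discrete_riccati_step -/tau.
rewrite -/(euler_transition tau A) -/(regularised_weight tau B P).
rewrite euler_transition_conj /discrete_riccati_field scalerBr.
rewrite -!scalemxAr -!scalemxAl !addrA; congr (_ - _).
by rewrite !scalerDr scalerA -expr2 !addrA [tau *: Q + P]addrC.
Qed.

Section psd.
Variables (tau : R) (A : 'M[R]_n) (B : 'M[R]_(n, d)) (P : 'M[R]_n).
Hypotheses (tau0 : 0 <= tau) (Ppsd : sym_psd P).

Let BPB : sym_psd (tau *: (B^T *m P *m B)).
Proof. exact/sym_psdZ/sym_psd_conj. Qed.

Let Zpd : sym_pd (regularised_weight tau B P).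
Proof. exact: sym_pdD. Qed.

Let Phi := euler_transition tau A.
Let K := optimal_gain tau A B P.

(** Written as the one-step cost of its own gain, the Riccati step is visibly
    positive, which the subtraction in its definition conceals. *)
Lemma riccati_step_completed_square :
  tau *: Q + Phi^T *m P *m Phi
  - Phi^T *m P *m (tau *: B) *m invmx (regularised_weight tau B P)
      *m B^T *m P *m Phi =
  tau *: Q + (tau *: (K^T *m S *m K) +
    (Phi + tau *: (B *m K))^T *m P *m (Phi + tau *: (B *m K))).
Proof.
rewrite -addrA; congr (_ + _).
have ZK : regularised_weight tau B P *m K = - (B^T *m P *m Phi).
  by rewrite /K /optimal_gain mulmxN !mulmxA mulmxV ?mul1mx// sym_pd_unitmx.
have PhiT : (Phi + tau *: (B *m K))^T = Phi^T + tau *: (K^T *m B^T).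
  by rewrite [LHS]linearD/= linearZ/= trmx_mul.
have ZK' : tau *: (K^T *m B^T *m P *m B *m K) =
    - (K^T *m S *m K) - K^T *m B^T *m P *m Phi.
  have : K^T *m (regularised_weight tau B P *m K) =
      - (K^T *m B^T *m P *m Phi) by rewrite ZK mulmxN !mulmxA.
  rewrite /regularised_weight mulmxDl mulmxDr -scalemxAl -scalemxAr !mulmxA.
  by move=> <-; rewrite addKr.
have KE : Phi^T *m P *m B *m K = - (Phi^T *m P *m B
    *m invmx (regularised_weight tau B P) *m B^T *m P *m Phi).
  by rewrite /K /optimal_gain mulmxN !mulmxA.
clearbody Phi K; rewrite PhiT !mulmxDl !mulmxDr -?scalemxAr -?scalemxAl -?scalemxAr -?scalemxAl.
rewrite !mulmxA KE ZK'.
move: (Phi^T *m P *m Phi) (K^T *m S *m K) (K^T *m B^T *m P *m Phi) => X Y V.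
move: (Phi^T *m P *m B *m _ *m _ *m _ *m _) => U.
by apply/matrixP => i j; rewrite !mxE; ring.
Qed.

Lemma riccati_step_psd : sym_psd (tau *: Q + Phi^T *m P *m Phi
  - Phi^T *m P *m (tau *: B) *m invmx (regularised_weight tau B P)
      *m B^T *m P *m Phi).
Proof.
rewrite riccati_step_completed_square; apply: sym_psdD; first exact: sym_psdZ.
apply: sym_psdD; last exact: sym_psd_conj.
by apply: sym_psdZ => //; apply/sym_psd_conj/sym_pdW.
Qed.

(** The subtracted term is positive, so that the trace grows at most linearly;
    by positivity of the step this controls the whole matrix. *)
Lemma riccati_step_mxtrace_le a : l1norm A <= a ->
  \tr (tau *: Q + Phi^T *m P *m Phi
    - Phi^T *m P *m (tau *: B) *m invmx (regularised_weight tau B P)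
      *m B^T *m P *m Phi) <=
  (1 + tau * (n%:R * (2 * a + tau * a ^+ 2))) * \tr P + tau * \tr Q.
Proof.
move=> Aa; have a0 : 0 <= a := le_trans (l1norm_ge0 A) Aa.
pose V := B^T *m P *m Phi.
have VE : V^T = Phi^T *m P *m B.
  by rewrite /V !trmx_mul trmxK (proj1 Ppsd) mulmxA.
have := sym_psd_mxtrace (sym_psd_conj V (sym_pd_inv Zpd)).
rewrite VE /V !mulmxA => tr0.
rewrite -scalemxAr -!scalemxAl linearB/= linearD/= !linearZ/=.
set t1 := \tr (Phi^T *m P *m B *m _ *m _ *m _ *m _) in tr0 *.
have trPhi : \tr (Phi^T *m P *m Phi) <=
    (1 + tau * (n%:R * (2 * a + tau * a ^+ 2))) * \tr P.
  rewrite /Phi euler_transition_conj !linearD/= !linearZ/=.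
  have trP := sym_psd_mxtrace Ppsd.
  have nP := l1norm_psd Ppsd.
  have Pn0 := l1norm_ge0 P.
  have AP : \tr (A^T *m P + P *m A) <= 2 * a * (n%:R * \tr P).
    rewrite linearD/=.
    have b1 : \tr (A^T *m P) <= a * (n%:R * \tr P).
      apply: le_trans (mxtrace_le_l1norm _) _; apply: le_trans (l1normM _ _) _.
      by rewrite l1normT; apply: ler_pM; rewrite ?l1norm_ge0.
    have b2 : \tr (P *m A) <= a * (n%:R * \tr P).
      apply: le_trans (mxtrace_le_l1norm _) _; apply: le_trans (l1normM _ _) _.
      by rewrite mulrC; apply: ler_pM; rewrite ?l1norm_ge0.
    lra.
  have APA : \tr (A^T *m P *m A) <= a ^+ 2 * (n%:R * \tr P).
    apply: le_trans (mxtrace_le_l1norm _) _; apply: le_trans (l1normM _ _) _.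
    rewrite expr2 -mulrA [leRHS]mulrC; apply: ler_pM; rewrite ?l1norm_ge0//.
    apply: le_trans (l1normM _ _) _.
    by rewrite l1normT; apply: ler_pM; rewrite ?l1norm_ge0.
  have := ler_wpM2l tau0 AP; have := ler_wpM2l (sqr_ge0 tau) APA.
  rewrite linearD/=; lra.
rewrite scalerN -[tau *: t1]/(tau * t1); have := mulr_ge0 tau0 tr0; lra.
Qed.

Lemma l1norm_regularised_inv :
  l1norm (invmx (regularised_weight tau B P)) <= d%:R * \tr (invmx S).
Proof. exact: l1norm_inv_le. Qed.

Lemma close_regularised_inv e b p : tau <= e -> l1norm B <= b -> l1norm P <= p ->
  let s := d%:R * \tr (invmx S) in
  close e (s * (b * p * b) * s) s
    (invmx (regularised_weight tau B P)) (invmx S).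
Proof.
move=> te Bb Pp s.
have b0 : 0 <= b := le_trans (l1norm_ge0 B) Bb.
have p0 : 0 <= p := le_trans (l1norm_ge0 P) Pp.
have s0 : 0 <= s by rewrite mulr_ge0// sym_psd_mxtrace//; exact: sym_pd_inv.
have Ss : l1norm (invmx S) <= s by exact: l1norm_psd (sym_pd_inv Spd).
have Zs : l1norm (invmx (regularised_weight tau B P)) <= s.
  exact: l1norm_regularised_inv.
split => //; first by do 4?apply: mulr_ge0 => //.
rewrite invmxD_sub ?l1normN ?sym_pd_unitmx//.
have -> : s * (b * p * b) * s * e = s * (e * (b * p * b)) * s by ring.
apply: le_trans (l1normM _ _) _; apply: ler_pM; rewrite ?l1norm_ge0//.
apply: le_trans (l1normM _ _) _; apply: ler_pM; rewrite ?l1norm_ge0//.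
rewrite l1normZ ger0_norm//; apply: ler_pM; rewrite ?l1norm_ge0//.
apply: le_trans (l1normM _ _) _; apply: ler_pM; rewrite ?l1norm_ge0//.
apply: le_trans (l1normM _ _) _.
by rewrite l1normT; apply: ler_pM; rewrite ?l1norm_ge0.
Qed.

End psd.

(** The continuous maps are the discrete ones with step size zero.  The single
    distance [e] covers the perturbations of the step size, of the parameter and
    of the value matrix. *)
Lemma close_riccati a b p : exists c q, forall e tau A A' B B' P P',
  0 <= tau -> tau <= e -> tau <= T ->
  l1norm A <= a -> l1norm A' <= a -> l1norm (A - A') <= e ->
  l1norm B <= b -> l1norm B' <= b -> l1norm (B - B') <= e ->
  sym_psd P -> l1norm P <= p -> l1norm P' <= p -> l1norm (P - P') <= e ->
  close e c q (discrete_riccati_field tau A B P) (riccati_field A' B' P') /\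
  close e c q (optimal_gain tau A B P) (- (invmx S *m B'^T *m P')).
Proof.
have weaken e c c' q q' m k (X Y : 'M[R]_(m, k)) : 0 <= e -> 0 <= c' ->
    close e c q X Y -> close e (c + c') (Num.max q q') X Y.
  move=> e0 c'0 [c0 XY Xq Yq]; split; first exact: addr_ge0.
  - by apply: le_trans XY _; rewrite ler_wpM2r// lerDl.
  - by rewrite le_max Xq.
  - by rewrite le_max Yq.
(* The constants are left to unification: the rules for [close] compute them. *)
have [cF [qF F]] : exists c q, forall e tau A A' B B' P P',
  0 <= tau -> tau <= e -> tau <= T ->
  l1norm A <= a -> l1norm A' <= a -> l1norm (A - A') <= e ->
  l1norm B <= b -> l1norm B' <= b -> l1norm (B - B') <= e ->
  sym_psd P -> l1norm P <= p -> l1norm P' <= p -> l1norm (P - P') <= e ->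
  close e c q (discrete_riccati_field tau A B P) (riccati_field A' B' P').
  eexists; eexists; move=> e tau A A' B B' P P' t0 te tT Aa A'a AA Bb B'b BB Ppsd Pp P'p PP.
  have e0 : 0 <= e := le_trans t0 te.
  have cA : close e 1 a A A' by split; rewrite // mul1r.
  have cB : close e 1 b B B' by split; rewrite // mul1r.
  have cP : close e 1 p P P' by split; rewrite // mul1r.
  have cZ := close_regularised_inv t0 Ppsd te Bb Pp.
  have cPhi : close e (0 + a) (l1norm (1%:M : 'M[R]_n) + T * a)
      (euler_transition tau A) 1%:M.
    rewrite -[X in close _ _ _ _ X]addr0; apply: closeD => //.
      exact: close_refl.
    exact: close_small.
  have Apsd : l1norm (A^T *m P *m A) <= a * p * a.
    have a0 := le_trans (l1norm_ge0 A) Aa; have p0 := le_trans (l1norm_ge0 P) Pp.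
    apply: le_trans (l1normM _ _) _; apply: ler_pM; rewrite ?l1norm_ge0//.
    apply: le_trans (l1normM _ _) _.
    by rewrite l1normT; apply: ler_pM; rewrite ?l1norm_ge0.
  have -> : riccati_field A' B' P' = Q + (A'^T *m P' + P' *m A') + 0
      - 1%:M^T *m P' *m B' *m invmx S *m B'^T *m P' *m 1%:M.
    rewrite /riccati_field trmx1 mul1mx mulmx1 addr0.
    by rewrite addrC addrA.
  apply: closeD => //; last apply: closeN.
    apply: closeD => //; last exact: close_small Apsd t0 te tT.
    apply: closeD => //; first exact: close_refl (lexx _).
    apply: closeD => //; apply: closeM => //;
      [exact: closeT cA|exact: cP|exact: cP|exact: cA].
  apply: closeM => //; last exact: cPhi.
  apply: closeM => //; last exact: cP.
  apply: closeM => //; last exact: closeT cB.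
  apply: closeM => //; last exact: cZ.
  apply: closeM => //; last exact: cB.
  apply: closeM => //; last exact: cP.
  exact: closeT cPhi.
have [cG [qG G]] : exists c q, forall e tau A A' B B' P P',
  0 <= tau -> tau <= e -> tau <= T ->
  l1norm A <= a -> l1norm A' <= a -> l1norm (A - A') <= e ->
  l1norm B <= b -> l1norm B' <= b -> l1norm (B - B') <= e ->
  sym_psd P -> l1norm P <= p -> l1norm P' <= p -> l1norm (P - P') <= e ->
  close e c q (optimal_gain tau A B P) (- (invmx S *m B'^T *m P')).
  eexists; eexists; move=> e tau A A' B B' P P' t0 te tT Aa A'a AA Bb B'b BB Ppsd Pp P'p PP.
  have e0 : 0 <= e := le_trans t0 te.
  have cA : close e 1 a A A' by split; rewrite // mul1r.
  have cB : close e 1 b B B' by split; rewrite // mul1r.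
  have cP : close e 1 p P P' by split; rewrite // mul1r.
  have cZ := close_regularised_inv t0 Ppsd te Bb Pp.
  have cPhi : close e (0 + a) (l1norm (1%:M : 'M[R]_n) + T * a)
      (euler_transition tau A) 1%:M.
    rewrite -[X in close _ _ _ _ X]addr0; apply: closeD => //.
      exact: close_refl.
    exact: close_small.
  rewrite -[invmx S *m B'^T *m P']mulmx1; apply: closeN.
  apply: closeM => //; last exact: cPhi.
  apply: closeM => //; last exact: cP.
  apply: closeM => //; last exact: closeT cB.
  exact: cZ.
exists (`|cF| + `|cG|), (Num.max qF qG) => e tau A A' B B' P P' t0 te *.
have e0 : 0 <= e := le_trans t0 te.
have HF := F e tau A A' B B' P P'; have HG := G e tau A A' B B' P P'.
split.
  have cl : close e cF qF (discrete_riccati_field tau A B P) (riccati_field A' B' P').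
    exact: HF.
  have cF0 : 0 <= cF by case: cl.
  by rewrite (ger0_norm cF0); apply: weaken cl.
have cl : close e cG qG (optimal_gain tau A B P) (- (invmx S *m B'^T *m P')).
  exact: HG.
have cG0 : 0 <= cG by case: cl.
by rewrite (ger0_norm cG0) addrC maxC; apply: weaken cl.
Qed.

End riccati_maps.

(** * The Riccati flow *)

(** By [1 + tau * c <= expR (tau * c)]; the bound is uniform in the number of
    steps as long as [k%:R * tau] stays bounded. *)
Lemma discrete_gronwall {R : realType} (tau c q : R) (x : nat -> R) :
  0 <= tau -> 0 <= c -> 0 <= q -> x 0%N <= 0 ->
  (forall k, x k.+1 <= (1 + tau * c) * x k + tau * q) ->
  forall k, x k <= expR (k%:R * tau * c) * (k%:R * tau * q).
Proof.
move=> tau0 c0 q0 x0 xS; elim => [|k IH]; first by rewrite !mul0r mulr0.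
apply: le_trans (xS k) _.
have kt0 : 0 <= k%:R * tau by rewrite mulr_ge0.
have tc0 : 0 <= tau * c by rewrite mulr_ge0.
have tq0 : 0 <= tau * q by rewrite mulr_ge0.
have K0 : 0 <= k%:R * tau * q by rewrite mulr_ge0.
have -> : expR (k.+1%:R * tau * c) = expR (k%:R * tau * c) * expR (tau * c).
  by rewrite -expRD -natr1; congr expR; ring.
have -> : k.+1%:R * tau * q = k%:R * tau * q + tau * q by rewrite -natr1; ring.
have : 1 <= expR (k%:R * tau * c).
  by rewrite -[leLHS]expR0 ler_expR mulr_ge0.
have : 1 + tau * c <= expR (tau * c) by exact: expR_ge1Dx.
move: (expR _) (expR _) (k%:R * tau * q) IH K0 => F E K IH K0 F1 E1.
have E0 : 0 <= E by lra.
have F0 : 0 <= F by lra.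
rewrite mulrDr; apply: lerD.
  apply: le_trans (ler_wpM2l _ IH) _; first lra.
  by rewrite mulrA [E * F]mulrC; rewrite ler_wpM2r// ler_wpM2r.
by rewrite -[leLHS]mul1r ler_wpM2r// -[leLHS]mulr1; apply: ler_pM; lra.
Qed.

Lemma within_continuous_bounded {R : realType} m n (T : R)
    (M : R -> 'M[R]_(m, n)) : 0 <= T -> {within `[0, T], continuous M} ->
  exists2 p, 0 <= p & forall t, 0 <= t <= T -> l1norm (M t) <= p.
Proof.
move=> T0 cM.
have bound ij : exists c, forall t, 0 <= t <= T -> `|M t ij.1 ij.2| <= c.
  have cabs : {within `[0, T], continuous (fun t => `|M t ij.1 ij.2|)}.
    apply/subspace_continuousP => t tT; apply: cvg_norm.
    have := @within_continuous_entry _ _ _ _ _ ij.1 ij.2 cM.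
    by move=> /subspace_continuousP; apply.
  have [c _ cmax] := EVT_max T0 cabs.
  by exists `|M c ij.1 ij.2| => t tT; apply: cmax; rewrite in_itv.
have [c cM'] := boolp.choice bound.
exists (\sum_i \sum_j `|c (i, j)|).
  by apply: sumr_ge0 => i _; apply: sumr_ge0.
move=> t tT; apply: ler_sum => i _; apply: ler_sum => j _.
exact: le_trans (cM' (i, j) t tT) (ler_norm _).
Qed.

Section riccati_flow.
Context {R : realType} {n d : nat}.
Variables (T : R) (A : 'M[R]_n) (B : 'M[R]_(n, d)) (Q : 'M[R]_n) (S : 'M[R]_d).
Variable P : R -> 'M[R]_n.
Hypotheses (T0 : 0 < T) (Pric : riccati_solution T A B Q S P).

Notation field := (riccati_field Q S A B).

Lemma riccati_continuous_entry i j :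
  {within `[0, T], continuous (fun t => P t i j)}.
Proof. by case: Pric => cP _ _; exact: within_continuous_entry. Qed.

Lemma riccati_derivative_entry t i j : 0 < t < T ->
  is_derive t (1 : R) (fun t => P t i j) (- field (P t) i j).
Proof.
move=> tT; have [_ _ /(_ t tT)[dP [dervP <-]]] := Pric.
rewrite -!addrA => /eqP; rewrite addr_eq0 !addrA -/(field (P t)) => /eqP.
rewrite derive_mx// => /matrixP/(_ i j); rewrite [LHS]mxE [RHS]mxE => DE.
have dE := (derivable_mxP P t 1).1 dervP i j.
exact: is_derive_eq (derivableP dE) DE.
Qed.

Lemma riccati_bounded : exists2 p, 0 <= p &
  forall t, 0 <= t <= T -> l1norm (P t) <= p.
Proof. by case: Pric => cP _ _; exact: within_continuous_bounded (ltW T0) cP. Qed.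

(** The mean value theorem applies entrywise only: the intermediate time depends
    on the entry. *)
Lemma riccati_MVT s t i j : 0 <= s -> s < t -> t <= T ->
  exists2 r, s < r < t & P t i j - P s i j = - field (P r) i j * (t - s).
Proof.
move=> s0 st tT.
have [||r] := @MVT R (fun t => P t i j) (fun r => - field (P r) i j) s t st.
- move=> r; rewrite in_itv/= => /andP[sr rt].
  by apply: riccati_derivative_entry; rewrite (le_lt_trans s0 sr) (lt_le_trans rt).
- have sub : `[s, t] `<=` `[0, T] by apply: subset_itv; rewrite bnd_simp.
  exact: (continuous_subspaceW sub (@riccati_continuous_entry i j)).
- by rewrite in_itv/= => sr ->; exists r.
Qed.

Lemma riccati_lipschitz : exists2 L, 0 <= L & forall s t,
  0 <= s -> s <= t -> t <= T -> l1norm (P t - P s) <= L * (t - s).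
Proof.
have [p p0 Pp] := riccati_bounded.
pose F := l1norm A * p + p * l1norm A +
  p * l1norm B * l1norm (invmx S) * l1norm B * p + l1norm Q.
have FB t : 0 <= t <= T -> l1norm (field (P t)) <= F.
  move=> tT; have Ptp := Pp t tT.
  apply: le_trans (l1normD _ _) _; rewrite lerD2r.
  apply: le_trans (l1normD _ _) _; apply: lerD.
    apply: le_trans (l1normD _ _) _; apply: lerD.
      apply: le_trans (l1normM _ _) _.
      by rewrite l1normT ler_wpM2l ?l1norm_ge0.
    apply: le_trans (l1normM _ _) _.
    by rewrite ler_wpM2r ?l1norm_ge0.
  rewrite l1normN.
  have step m k l (X : 'M[R]_(m, k)) (Y : 'M[R]_(k, l)) x y :
      l1norm X <= x -> l1norm Y <= y -> l1norm (X *m Y) <= x * y.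
    by move=> Xx Yy; apply: le_trans (l1normM _ _) _; apply: ler_pM;
      rewrite ?l1norm_ge0.
  apply: (step) => //; apply: (step); last by rewrite l1normT.
  by apply: (step) => //; exact: step.
have F0 : 0 <= F.
  by apply: le_trans (FB 0 _); rewrite ?l1norm_ge0// lexx ltW.
exists ((n * n)%:R * F); first by rewrite mulr_ge0.
move=> s t s0; rewrite le_eqVlt => /predU1P[->|st] tT.
  by rewrite !subrr l1norm0 mulr0.
rewrite -mulrA; apply: l1norm_le_entries => i j.
have [r /andP[sr rt]] := riccati_MVT i j s0 st tT.
rewrite ![(_ - P s) i j]mxE ![(- P s) i j]mxE => ->; rewrite normrM normrN (ger0_norm (x := t - s)); last lra.
rewrite ler_wpM2r//; first lra.
apply: le_trans (le_entry_l1norm _ _ _) (FB r _).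
by rewrite (le_trans s0 (ltW sr)) (le_trans (ltW rt) tT).
Qed.

Lemma riccati_field_lipschitz : exists2 c, 0 <= c & forall s t,
  0 <= s -> s <= t -> t <= T -> l1norm (field (P s) - field (P t)) <= c * (t - s).
Proof.
have [p p0 Pp] := riccati_bounded; have [L L0 PL] := riccati_lipschitz.
have [c [q cF]] : exists c q, forall e (X Y : 'M[R]_n), 0 <= e ->
    l1norm X <= p -> l1norm Y <= p -> l1norm (X - Y) <= e ->
    close e c q (field X) (field Y).
  eexists; eexists; move=> e X Y e0 Xp Yp XY.
  have cXY : close e 1 p X Y by split; rewrite // mul1r.
  apply: closeD => //; last exact: close_refl (lexx _).
  apply: closeD => //.
    apply: closeD => //; apply: closeM => //;
      [exact: close_refl (lexx _)|exact: cXY|exact: cXY|exact: close_refl (lexx _)].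
  apply: closeN; apply: closeM => //; last exact: cXY.
  apply: closeM => //; last exact: close_refl (lexx _).
  apply: closeM => //; last exact: close_refl (lexx _).
  apply: closeM => //; first exact: cXY.
  exact: close_refl (lexx _).
exists (`|c| * L); first by rewrite mulr_ge0.
move=> s t s0 st tT.
have Lts : 0 <= L * (t - s) by rewrite mulr_ge0// subr_ge0.
have Pst : l1norm (P s - P t) <= L * (t - s).
  by rewrite -opprB l1normN; exact: PL.
have Ps : l1norm (P s) <= p by apply: Pp; rewrite s0 (le_trans st).
have Pt : l1norm (P t) <= p by apply: Pp; rewrite (le_trans s0).
have [c0 cl _ _] := cF _ _ _ Lts Ps Pt Pst.
by apply: le_trans cl _; rewrite ger0_norm// -mulrA.
Qed.

(** The local error of an explicit Euler step backwards in time: by the mean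
    value theorem the increment is the slope at an intermediate time, and the
    slope is Lipschitz in time along the solution. *)
Lemma riccati_euler_error : exists2 C, 0 <= C & forall s t,
  0 <= s -> s <= t -> t <= T ->
  l1norm (P s - P t - (t - s) *: field (P t)) <= C * (t - s) ^+ 2.
Proof.
have [c c0 Fc] := riccati_field_lipschitz.
exists ((n * n)%:R * c); first by rewrite mulr_ge0.
move=> s t s0; rewrite le_eqVlt => /predU1P[->|st] tT.
  by rewrite !subrr scale0r subr0 l1norm0 expr0n mulr0.
have -> : (n * n)%:R * c * (t - s) ^+ 2 =
  (n * n)%:R * (c * (t - s) * (t - s)) by ring.
apply: l1norm_le_entries => i j.
have [r /andP[sr rt] PE] := riccati_MVT i j s0 st tT.
have r0 := le_trans s0 (ltW sr).
have -> : (P s - P t - (t - s) *: field (P t)) i j =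
    (t - s) * (field (P r) - field (P t)) i j.
  have PE' : P s i j = P t i j + field (P r) i j * (t - s) by lra.
  move: (field (P r)) (field (P t)) PE' => X Y PE'.
  by rewrite !mxE PE'; ring.
have ts : 0 <= t - s by lra.
rewrite normrM ger0_norm// mulrC ler_wpM2r//.
apply: le_trans (le_entry_l1norm _ _ _) _.
apply: le_trans (Fc _ _ r0 (ltW rt) tT) _.
by rewrite ler_wpM2l//; lra.
Qed.

End riccati_flow.

(** * Convergence of the discrete Riccati scheme *)

Section riccati_convergence.
Context {R : realType} {n d : nat}.
Variables (T : R) (Astar : 'M[R]_n) (Bstar : 'M[R]_(n, d)).
Variables (Q : 'M[R]_n) (S : 'M[R]_d) (Pstar : R -> 'M[R]_n).
Hypotheses (T0 : 0 < T) (Qpsd : sym_psd Q) (Spd : sym_pd S).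
Hypothesis Pric : riccati_solution T Astar Bstar Q S Pstar.
Variables a b : R.
Hypotheses (Astar_a : l1norm Astar <= a) (Bstar_b : l1norm Bstar <= b).

Notation step A B N := (discrete_riccati_step T A B Q S N).

Lemma discrete_riccati_psd A B N k : (0 < N)%N ->
  sym_psd (iter k (step A B N) 0).
Proof.
move=> N0; elim: k => [|k IH]; first exact: sym_psd0.
rewrite iterS; apply: riccati_step_psd => //.
by rewrite divr_ge0// ltW.
Qed.

(** Stability of the scheme: the trace obeys a discrete Gronwall inequality and
    dominates positive matrices. *)
Lemma discrete_riccati_bounded : exists2 p, 0 <= p &
  forall A (B : 'M[R]_(n, d)) N k, (k <= N)%N -> (0 < N)%N -> l1norm A <= a ->
  l1norm (iter k (step A B N) 0) <= p.
Proof.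
pose c := n%:R * (2 * a + T * a ^+ 2).
have a0 : 0 <= a := le_trans (l1norm_ge0 _) Astar_a.
have c0 : 0 <= c by rewrite mulr_ge0// addr_ge0// mulr_ge0 ?sqr_ge0// ltW.
have trQ := sym_psd_mxtrace Qpsd.
exists (n%:R * (expR (T * c) * (T * \tr Q))).
  by rewrite mulr_ge0// mulr_ge0 ?expR_ge0// mulr_ge0// ltW.
move=> A B N k kN N0 Aa.
have Npos : 0 < N%:R :> R by rewrite ltr0n.
set tau := T / N%:R; have tau0 : 0 <= tau by rewrite divr_ge0// ltW.
have tauT : tau <= T by rewrite ler_pdivrMr// ler_peMr ?(ltW T0)// ler1n.
have ktau : k%:R * tau <= T.
  by rewrite mulrCA ler_piMr ?(ltW T0)// ler_pdivrMr// mul1r ler_nat.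
have psd := discrete_riccati_psd A B _ N0.
apply: le_trans (l1norm_psd (psd k)) _; rewrite ler_wpM2l//.
have xS j : \tr (iter j.+1 (step A B N) 0) <=
    (1 + tau * c) * \tr (iter j (step A B N) 0) + tau * \tr Q.
  rewrite iterS.
  have := riccati_step_mxtrace_le Q Spd B tau0 (psd j) Aa.
  move/le_trans; apply.
  rewrite lerD2r ler_wpM2r ?sym_psd_mxtrace// lerD2l ler_wpM2l//.
  by rewrite ler_wpM2l// lerD2l ler_wpM2r ?sqr_ge0.
have tr0 : \tr (iter 0 (step A B N) 0) <= 0 by rewrite /= mxtrace0.
apply: le_trans (discrete_gronwall tau0 c0 trQ tr0 xS k) _.
apply: ler_pM; first exact: expR_ge0.
- by rewrite mulr_ge0// mulr_ge0.
- by rewrite ler_expR ler_wpM2r.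
- by rewrite ler_wpM2r.
Qed.

(** Consistency and stability give convergence: one step of the scheme at the
    perturbed parameter differs from one Euler step at the true parameter by
    [tau] times the distance of the arguments, the Euler step has error
    [O(tau ^+ 2)], and the errors are summed up by Gronwall's inequality. *)
Lemma discrete_riccati_convergence : exists2 C, 0 <= C &
  forall A B N k, (k <= N)%N -> (0 < N)%N -> l1norm A <= a -> l1norm B <= b ->
  l1norm (iter k (step A B N) 0 - Pstar (T - k%:R * (T / N%:R))) <=
  C * (T / N%:R + (l1norm (A - Astar) + l1norm (B - Bstar))).
Proof.
have [p1 p10 Dp] := discrete_riccati_bounded.
have [p2 p20 Pp] := riccati_bounded T0 Pric.
have [C1 C10 PC] := riccati_euler_error T0 Pric.
have [c [q close_cq]] := close_riccati T Q Spd a b (Num.max p1 p2).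
exists (expR (T * `|c|) * (T * (`|c| + C1))).
  by rewrite mulr_ge0 ?expR_ge0// mulr_ge0 ?addr_ge0// ltW.
move=> A B N k kN N0 Aa Bb; set tau := T / N%:R.
set delta := l1norm (A - Astar) + l1norm (B - Bstar).
have Npos : 0 < N%:R :> R by rewrite ltr0n.
have tau0 : 0 <= tau by rewrite divr_ge0// ltW.
have tauT : tau <= T by rewrite ler_pdivrMr// ler_peMr ?(ltW T0)// ler1n.
have jtau j : (j <= N)%N -> j%:R * tau <= T.
  by move=> jN; rewrite mulrCA ler_piMr ?(ltW T0)// ler_pdivrMr// mul1r ler_nat.
have delta0 : 0 <= delta by rewrite addr_ge0 ?l1norm_ge0.
(* Beyond [N] steps the time would be negative; the error is then set to zero,
   so that the recursion holds for all [j]. *)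
pose x j := if (j <= N)%N then
  l1norm (iter j (step A B N) 0 - Pstar (T - j%:R * tau)) else 0.
have x_ge0 j : 0 <= x j by rewrite /x; case: ifP => // _; exact: l1norm_ge0.
have x0 : x 0%N <= 0.
  by have [_ PT _] := Pric; rewrite /x /= mul0r subr0 PT subrr l1norm0.
pose q0 := (`|c| + C1) * (tau + delta).
have q00 : 0 <= q0 by rewrite mulr_ge0// addr_ge0.
have xS j : x j.+1 <= (1 + tau * `|c|) * x j + tau * q0.
  rewrite {1}/x; case: ifPn => [jN|_]; last first.
    by rewrite addr_ge0// mulr_ge0// addr_ge0// mulr_ge0.
  have jN' : (j <= N)%N := ltnW jN.
  have xj : x j = l1norm (iter j (step A B N) 0 - Pstar (T - j%:R * tau)).
    by rewrite /x jN'.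
  pose D := iter j (step A B N) 0; pose t := T - j%:R * tau.
  have tE : T - j.+1%:R * tau = t - tau by rewrite /t -natr1; ring.
  have tT : t <= T by rewrite /t lerBlDr lerDl mulr_ge0.
  have ttau : 0 <= t - tau by rewrite -tE subr_ge0 jtau.
  have t0 : 0 <= t by lra.
  have Ppsd : sym_psd D by exact: discrete_riccati_psd.
  (* A common bound for the step size and for the distance of each argument. *)
  pose e := tau + delta + x j.
  have xj0 := x_ge0 j.
  have te : tau <= e by rewrite /e; lra.
  have Ae : l1norm (A - Astar) <= e.
    by have := l1norm_ge0 (B - Bstar); rewrite /e /delta; lra.
  have Be : l1norm (B - Bstar) <= e.
    by have := l1norm_ge0 (A - Astar); rewrite /e /delta; lra.
  have D_le : l1norm D <= Num.max p1 p2 by rewrite le_max Dp.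
  have P_le : l1norm (Pstar t) <= Num.max p1 p2.
    by rewrite le_max Pp ?orbT// t0.
  have DPe : l1norm (D - Pstar t) <= e by rewrite -xj /e; lra.
  have [[c0 field_le _ _] _] := close_cq e tau A Astar B Bstar D (Pstar t)
    tau0 te tauT Aa Astar_a Ae Bb Bstar_b Be Ppsd D_le P_le DPe.
  rewrite iterS discrete_riccati_stepE -/D -/tau tE.
  have -> : D + tau *: discrete_riccati_field Q S tau A B D - Pstar (t - tau) =
      (D - Pstar t) + (tau *: (discrete_riccati_field Q S tau A B D -
        riccati_field Q S Astar Bstar (Pstar t)) -
      (Pstar (t - tau) - Pstar t
        - (t - (t - tau)) *: riccati_field Q S Astar Bstar (Pstar t))).
    move: (discrete_riccati_field Q S tau A B D).
    move: (riccati_field Q S Astar Bstar (Pstar t)) => X Y.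
    by apply/matrixP => i i'; rewrite !mxE; ring.
  apply: le_trans (l1normD _ _) _; rewrite -xj.
  rewrite /e in field_le.
  have e1 : l1norm (tau *: (discrete_riccati_field Q S tau A B D -
        riccati_field Q S Astar Bstar (Pstar t))) <=
      tau * (c * (tau + delta + x j)).
    by rewrite l1normZ ger0_norm// ler_wpM2l.
  have e2 : l1norm (Pstar (t - tau) - Pstar t - (t - (t - tau)) *:
        riccati_field Q S Astar Bstar (Pstar t)) <= C1 * tau ^+ 2.
    have := PC (t - tau) t ttau; rewrite subKr; apply => //.
    by rewrite lerBlDr lerDl.
  have e3 : l1norm (tau *: (discrete_riccati_field Q S tau A B D -
        riccati_field Q S Astar Bstar (Pstar t)) -
      (Pstar (t - tau) - Pstar t
        - (t - (t - tau)) *: riccati_field Q S Astar Bstar (Pstar t))) <=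
      tau * (c * (tau + delta + x j)) + C1 * tau ^+ 2.
    by apply: le_trans (l1normD _ _) _; rewrite l1normN lerD.
  rewrite (ger0_norm c0) /q0 (ger0_norm c0).
  have C1d : 0 <= tau * (C1 * delta) by apply: mulr_ge0 => //; exact: mulr_ge0.
  apply: le_trans (lerD (lexx (x j)) e3) _.
  rewrite -subr_ge0; apply: le_trans C1d _.
  by rewrite le_eqVlt; apply/orP; left; apply/eqP; ring.
have := discrete_gronwall tau0 (normr_ge0 c) q00 x0 xS k.
rewrite {1}/x kN => /le_trans; apply.
rewrite [leRHS](_ : _ = expR (T * `|c|) * (T * q0)); last first.
  by rewrite /q0 !mulrA.
apply: ler_pM; first exact: expR_ge0.
- by apply: mulr_ge0 => //; exact: mulr_ge0.
- by rewrite ler_expR ler_wpM2r// jtau.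
- by rewrite ler_wpM2r ?jtau.
Qed.

Lemma discrete_riccati_approximation : exists2 C, 0 <= C &
  forall A B N t, (0 < N)%N -> l1norm A <= a -> l1norm B <= b -> 0 <= t <= T ->
  let tau := T / N%:R in
  let D := discrete_riccati T A B Q S N (Num.truncn (t / tau)).+1 in
  [/\ sym_psd D, l1norm D <= C & l1norm (D - Pstar t) <=
    C * (tau + (l1norm (A - Astar) + l1norm (B - Bstar)))].
Proof.
have [p1 p10 Dp] := discrete_riccati_bounded.
have [C1 C10 DC] := discrete_riccati_convergence.
have [L L0 PL] := riccati_lipschitz T0 Pric.
exists (p1 + (C1 + L)); first by rewrite !addr_ge0.
move=> A B N t N0 Aa Bb /andP[t0 tT] tau D.
set delta := l1norm (A - Astar) + l1norm (B - Bstar).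
have Npos : 0 < N%:R :> R by rewrite ltr0n.
have tau0 : 0 < tau by rewrite divr_gt0.
have delta0 : 0 <= delta by rewrite addr_ge0 ?l1norm_ge0.
have td0 : 0 <= tau + delta by rewrite addr_ge0// ltW.
have kN : (N - (Num.truncn (t / tau)).+1 <= N)%N by exact: leq_subr.
split; first exact: discrete_riccati_psd.
  by apply: le_trans (Dp A B N _ kN N0 Aa) _; rewrite lerDl addr_ge0.
have := truncn_itv (divr_ge0 t0 (ltW tau0)); rewrite /D /discrete_riccati.
move: (Num.truncn (t / tau)) {D} kN => i kN /andP[it ti].
(* The index [N] is reached only at the final time, where both sides vanish. *)
have [Ni|iN] := leqP N i.
  have -> : t = T.
    apply/eqP; rewrite eq_le tT/=.
    have TE : T = N%:R * tau by rewrite mulrC divfK// lt0r_neq0.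
    move: it; rewrite ler_pdivlMr//; apply: le_trans.
    by rewrite [leLHS]TE ler_wpM2r ?ler_nat// ltW.
  have [_ PT _] := Pric.
  have -> : (N - i.+1 = 0)%N by apply/eqP; rewrite subn_eq0 ltnW.
  by rewrite /= PT subrr l1norm0 mulr_ge0// !addr_ge0.
have tE : T - (N - i.+1)%:R * tau = i.+1%:R * tau.
  by rewrite natrB// mulrBl [N%:R * tau]mulrC divfK ?lt0r_neq0// subKr.
have := DC A B N _ kN N0 Aa Bb; rewrite /= -/tau tE -/delta => conv.
have t1T : i.+1%:R * tau <= T.
  by rewrite -tE lerBlDr lerDl mulr_ge0// ltW.
have t1t : t <= i.+1%:R * tau by rewrite -ler_pdivrMr// ltW.
have t1tau : i.+1%:R * tau - t <= tau.
  move: it; rewrite ler_pdivlMr// -natr1; lra.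
have := PL t _ t0 t1t t1T => lip.
rewrite -(subrK (Pstar (i.+1%:R * tau)) (iter _ _ _)) -addrA.
apply: le_trans (l1normD _ _) _.
have h1 : L * (i.+1%:R * tau - t) <= L * (tau + delta) by rewrite ler_wpM2l//; lra.
have h2 : 0 <= p1 * (tau + delta) by rewrite mulr_ge0.
lra.
Qed.

(** The discrete value matrices are symmetric and converge to [Pstar] when the
    scheme is run at the true parameter. *)
Lemma riccati_solution_sym t : 0 <= t <= T -> (Pstar t)^T = Pstar t.
Proof.
move=> tT; have [C C0 approx] := discrete_riccati_approximation.
have bound N : l1norm ((Pstar t)^T - Pstar t) <= 2 * C * T / N.+1%:R.
  have [[sD _] _] := approx Astar Bstar N.+1 t isT Astar_a Bstar_b tT.
  rewrite !subrr !l1norm0 !addr0.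
  move: (discrete_riccati _ _ _ _ _ _ _) sD => D sD Dt.
  have -> : (Pstar t)^T - Pstar t = (D - Pstar t) - (D - Pstar t)^T.
    rewrite [X in _ = _ - X]linearB/= sD.
    by apply/matrixP => i j; rewrite !mxE; ring.
  apply: le_trans (l1normD _ _) _; rewrite l1normN l1normT.
  by rewrite -!mulrA mulr_natl mulr2n lerD.
have normz : l1norm ((Pstar t)^T - Pstar t) = 0.
  apply/eqP; rewrite eq_le l1norm_ge0 andbT leNgt; apply/negP => pos.
  have c0 : 0 < 2 * C * T.
    by apply: lt_le_trans pos _; have := bound 0%N; rewrite divr1.
  have [k] := ltr_add_invr (divr_gt0 pos c0).
  rewrite add0r ltr_pdivlMr// => kc; have := bound k.
  by rewrite leNgt mulrC kc.
apply/eqP; rewrite -subr_eq0; apply/eqP/matrixP => i j.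
rewrite [RHS]mxE; apply/eqP.
by rewrite -normr_le0 -normz le_entry_l1norm.
Qed.

(** The gain is a Lipschitz function of the parameter, the step size and the
    value matrix, and the error of the latter is of first order. *)
Lemma piecewise_gain_error : exists2 C, 0 <= C &
  forall A B N t, (0 < N)%N -> l1norm A <= a -> l1norm B <= b -> 0 <= t <= T ->
  l1norm (piecewise_gain T A B Q S N t) <= C /\
  l1norm (piecewise_gain T A B Q S N t - riccati_gain Bstar S Pstar t) <=
    C * (T / N%:R + (l1norm (A - Astar) + l1norm (B - Bstar))).
Proof.
have [C1 C10 approx] := discrete_riccati_approximation.
have [p2 p20 Pp] := riccati_bounded T0 Pric.
have [c [q close_cq]] := close_riccati T Q Spd a b (Num.max C1 p2).
exists (`|q| + `|c| * (1 + C1)); first by rewrite addr_ge0// mulr_ge0// addr_ge0.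
move=> A B N t N0 Aa Bb tT.
have := approx A B N t N0 Aa Bb tT.
set tau := T / N%:R; set delta := l1norm (A - Astar) + l1norm (B - Bstar).
rewrite /piecewise_gain -/tau; move: (Num.truncn _) => i /= [Dpsd DC DP].
have Npos : 0 < N%:R :> R by rewrite ltr0n.
have tau0 : 0 <= tau by rewrite divr_ge0// ltW.
have tauT : tau <= T by rewrite ler_pdivrMr// ler_peMr ?(ltW T0)// ler1n.
have delta0 : 0 <= delta by rewrite addr_ge0 ?l1norm_ge0.
have Cd0 : 0 <= C1 * (tau + delta) by rewrite mulr_ge0// addr_ge0.
set D := discrete_riccati _ _ _ _ _ _ _ in Dpsd DC DP.
pose e := tau + delta + C1 * (tau + delta).
have te : tau <= e by rewrite /e; lra.
have Ae : l1norm (A - Astar) <= e.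
  by have := l1norm_ge0 (B - Bstar); rewrite /e /delta in Cd0 *; lra.
have Be : l1norm (B - Bstar) <= e.
  by have := l1norm_ge0 (A - Astar); rewrite /e /delta in Cd0 *; lra.
have D_le : l1norm D <= Num.max C1 p2 by rewrite le_max DC.
have P_le : l1norm (Pstar t) <= Num.max C1 p2 by rewrite le_max Pp ?orbT.
have DPe : l1norm (D - Pstar t) <= e by apply: le_trans DP _; rewrite /e; lra.
have [_ [c0 gain_le gain_q _]] := close_cq e tau A Astar B Bstar D (Pstar t)
  tau0 te tauT Aa Astar_a Ae Bb Bstar_b Be Dpsd D_le P_le DPe.
rewrite -[optimal_gain S tau A B D]/(discrete_gain T A B Q S N i)
  -[- (invmx S *m Bstar^T *m Pstar t)]/(riccati_gain Bstar S Pstar t)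
  in gain_le gain_q.
rewrite (ger0_norm c0); split.
  apply: le_trans gain_q _; apply: le_trans (ler_norm q) _.
  by rewrite lerDl mulr_ge0// addr_ge0.
apply: le_trans gain_le _; rewrite /e.
have : 0 <= `|q| * (tau + delta) by rewrite mulr_ge0// addr_ge0.
lra.
Qed.

End riccati_convergence.

(** * Paths of the closed-loop equation *)

Section bounded_matrix_functions.
Context {R : realType}.
Notation mu := (@lebesgue_measure R).
Variable T : R.

(** The regularity that is stable under the matrix operations and that makes
    every integral over [0, T] below converge; feedback gains and paths share
    it. *)
Definition bounded_mx {m n} (M : R -> 'M[R]_(m, n)) :=
  (forall i j, measurable_fun `[0, T] (fun t => M t i j)) /\
  exists c, forall t, 0 <= t <= T -> l1norm (M t) <= c.

Lemma bounded_mx_cst m n (M : 'M[R]_(m, n)) : bounded_mx (fun=> M).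
Proof. by split; [move=> i j; exact: measurable_cst|exists (l1norm M)]. Qed.

Lemma bounded_mxD m n (M M' : R -> 'M[R]_(m, n)) :
  bounded_mx M -> bounded_mx M' -> bounded_mx (fun t => M t + M' t).
Proof.
move=> [mM [c Mc]] [mM' [c' Mc']]; split=> [i j|].
  have -> : (fun t => (M t + M' t) i j) = (fun t => M t i j + M' t i j).
    by apply/funext => t; rewrite mxE.
  exact: measurable_funD.
exists (c + c') => t tT; apply: le_trans (l1normD _ _) _.
by apply: lerD; [exact: Mc|exact: Mc'].
Qed.

Lemma bounded_mxN m n (M : R -> 'M[R]_(m, n)) :
  bounded_mx M -> bounded_mx (fun t => - M t).
Proof.
move=> [mM [c Mc]]; split=> [i j|].
  have -> : (fun t => (- M t) i j) = (fun t => - M t i j).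
    by apply/funext => t; rewrite mxE.
  exact: measurableT_comp.
by exists c => t tT; rewrite l1normN; exact: Mc.
Qed.

Lemma bounded_mxT m n (M : R -> 'M[R]_(m, n)) :
  bounded_mx M -> bounded_mx (fun t => (M t)^T).
Proof.
move=> [mM [c Mc]]; split=> [i j|].
  have -> : (fun t => (M t)^T i j) = (fun t => M t j i).
    by apply/funext => t; rewrite mxE.
  exact: mM.
by exists c => t tT; rewrite l1normT; exact: Mc.
Qed.

Lemma bounded_mxM m n p (M : R -> 'M[R]_(m, n)) (M' : R -> 'M[R]_(n, p)) :
  bounded_mx M -> bounded_mx M' -> bounded_mx (fun t => M t *m M' t).
Proof.
move=> [mM [c Mc]] [mM' [c' Mc']]; split=> [i j|].
  have -> : (fun t => (M t *m M' t) i j) = (fun t => \sum_k M t i k * M' t k j).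
    by apply/funext => t; rewrite mxE.
  by apply: measurable_sum => k; exact: measurable_funM.
exists (c * c') => t tT; apply: le_trans (l1normM _ _) _.
by apply: ler_pM; rewrite ?l1norm_ge0 ?Mc ?Mc'.
Qed.

Lemma bounded_mx_entry m n (M : R -> 'M[R]_(m, n)) i j : bounded_mx M ->
  exists c, forall t, 0 <= t <= T -> `|M t i j| <= c.
Proof.
by move=> [_ [c Mc]]; exists c => t tT; apply: le_trans (Mc t tT);
  exact: le_entry_l1norm.
Qed.

Lemma bounded_mx_integrable m n (M : R -> 'M[R]_(m, n)) i j : bounded_mx M ->
  mu.-integrable `[0, T] (EFin \o (fun t => M t i j)).
Proof.
move=> bM; have [c Mc] := bounded_mx_entry i j bM.
by case: bM => mM _; exact: bounded_integrable_itv Mc.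
Qed.

End bounded_matrix_functions.

Section integral_inequalities.
Context {R : realType}.
Notation mu := (@lebesgue_measure R).

(** The Cauchy-Schwarz inequality, as positivity of the variance of [f]. *)
Lemma sqr_Rintegral_le (T c : R) (f : R -> R) : 0 < T ->
  measurable_fun `[0, T] f -> (forall t, 0 <= t <= T -> `|f t| <= c) ->
  (\int[mu]_(t in `[0, T]) f t) ^+ 2 <= T * \int[mu]_(t in `[0, T]) (f t ^+ 2).
Proof.
move=> T0 mf fc; set I := \int[mu]_(t in `[0, T]) f t.
have intf := bounded_integrable_itv mf fc.
have mf2 : measurable_fun `[0, T] (fun t => f t ^+ 2) by exact: measurable_funX.
have intf2 : mu.-integrable `[0, T] (EFin \o (fun t => f t ^+ 2)).
  apply: (bounded_integrable_itv (c := c ^+ 2)) => // t tT.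
  by rewrite normrX lerXn2r ?nnegrE// ?fc// (le_trans _ (fc t tT)).
have mI : measurable (`[0, T] : set (measurableTypeR R)) by [].
have : 0 <= \int[mu]_(t in `[0, T]) ((f t - I / T) ^+ 2).
  by apply: Rintegral_ge0 => t _; exact: sqr_ge0.
have -> : \int[mu]_(t in `[0, T]) ((f t - I / T) ^+ 2) =
    \int[mu]_(t in `[0, T]) (f t ^+ 2 + ((- (2 * I / T)) * f t + (I / T) ^+ 2)).
  by apply: eq_Rintegral => t _; field; exact: lt0r_neq0.
have i1 : mu.-integrable `[0, T] (EFin \o (fun t => (- (2 * I / T)) * f t)).
  by have := integrableZl mI (- (2 * I / T)) intf.
have i2 : mu.-integrable `[0, T] (EFin \o (fun=> (I / T) ^+ 2)).
  apply: (bounded_integrable_itv (c := `|(I / T) ^+ 2|)) => //.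
have i3 := integrableD mI i1 i2.
rewrite RintegralD// RintegralD// RintegralZl// -/I.
rewrite Rintegral_itv_cst ?(ltW T0)// subr0.
have -> : (- (2 * I / T)) * I + (I / T) ^+ 2 * T = - (I ^+ 2 / T).
  by field; exact: lt0r_neq0.
by rewrite subr_ge0 ler_pdivrMr// mulrC.
Qed.

Lemma sqr_sum_le (I : finType) (a : I -> R) :
  (\sum_i a i) ^+ 2 <= #|I|%:R * \sum_i a i ^+ 2.
Proof.
rewrite expr2 mulr_suml.
apply: (@le_trans _ _ (\sum_i \sum_j (a i ^+ 2 + a j ^+ 2) / 2)).
  apply: ler_sum => i _; rewrite mulr_sumr; apply: ler_sum => j _.
  by have := sqr_ge0 (a i - a j); rewrite sqrrB; lra.
under eq_bigr do rewrite -mulr_suml big_split/= sumr_const.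
rewrite -mulr_suml big_split/= sumr_const.
have -> : \sum_i (a i ^+ 2 *+ #|I|) = #|I|%:R * \sum_i a i ^+ 2.
  by rewrite sumrMnl mulr_natl.
by rewrite -mulr_natl; lra.
Qed.

Lemma Rintegral_sum (d : measure_display) (T' : measurableType d)
    (m : {measure set T' -> \bar R}) (D : set T') (I : Type) (r : seq I)
    (f : I -> T' -> R) : measurable D ->
  (forall i, m.-integrable D (EFin \o f i)) ->
  m.-integrable D (EFin \o (fun t => \sum_(i <- r) f i t)) /\
  \int[m]_(t in D) (\sum_(i <- r) f i t) =
  \sum_(i <- r) \int[m]_(t in D) f i t.
Proof.
move=> mD intf; elim: r => [|i r [IH IHE]].
  have -> : (fun t => \sum_(i <- [::]) f i t) = fun=> 0.
    by apply/funext => t; rewrite big_nil.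
  rewrite big_nil; split; first exact: integrable0.
  by rewrite Rintegral_cst// mul0r.
have -> : (fun t => \sum_(j <- i :: r) f j t) =
    (fun t => f i t + \sum_(j <- r) f j t).
  by apply/funext => t; rewrite big_cons.
split; first by have := integrableD mD (intf i) IH.
by rewrite big_cons RintegralD// IHE.
Qed.

End integral_inequalities.

Section linear_equation_path.
Context {R : realType} {n : nat}.
Notation mu := (@lebesgue_measure R).
Variables (T L : R) (x0 : 'cV[R]_n) (M : R -> 'M[R]_n) (x omega : R -> 'cV[R]_n).
Hypotheses (T0 : 0 < T) (L0 : 0 < L).
Hypothesis ML : forall t, 0 <= t <= T -> l1norm (M t) <= L.
Hypothesis bomega : bounded_mx T omega.
Hypothesis ix : forall i,
  mu.-integrable `[0, T] (fun s => ((M s *m x s) i 0)%:E).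
Hypothesis xE : forall t i, 0 <= t <= T ->
  x t i 0 = x0 i 0 + \int[mu]_(s in `[0, t]) ((M s *m x s) i 0) + omega t i 0.

Let mI t : measurable (`[0, t] : set (measurableTypeR R)). Proof. by []. Qed.

Let l1cV (y : 'cV[R]_n) : l1norm y = \sum_i `|y i 0|.
Proof. by apply: eq_bigr => i _; rewrite big_ord1. Qed.

Let measurable_l1omega : measurable_fun `[0, T] (fun t => l1norm (omega t)).
Proof.
have [mo _] := bomega; have -> : (fun t => l1norm (omega t)) =
    (fun t => \sum_i `|omega t i 0|) by apply/funext => t; exact: l1cV.
by apply: measurable_sum => k; apply: measurableT_comp => //; exact: mo.
Qed.

Let int_l1omega :
  mu.-integrable `[0, T] (EFin \o (fun t => l1norm (omega t))).
Proof.
have [_ [c oc]] := bomega.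
apply: (bounded_integrable_itv (c := c)) => // t tT.
by rewrite ger0_norm ?l1norm_ge0 ?oc.
Qed.

(** The noise being additive, the path [x - omega] obeys a linear integral
    equation.  Gronwall's inequality bounds it by the integral of the noise,
    whose moments are obtained from those at fixed times. *)
Lemma path_bound t : 0 <= t <= T ->
  l1norm (x t - omega t) <=
  2 * (l1norm x0 + L * \int[mu]_(s in `[0, T]) l1norm (omega s)) *
  expR (2 * L * T).
Proof.
have in_norm i : mu.-integrable `[0, T] (EFin \o (fun s => `|(M s *m x s) i 0|)).
  by have := integrable_norm (ix i).
have [int_drift _] := Rintegral_sum (index_enum 'I_n) (mI T) in_norm.
have drift_bound s : 0 <= s <= T -> l1norm (x s - omega s) <=
    l1norm x0 + \int[mu]_(r in `[0, s]) (\sum_i `|(M r *m x r) i 0|).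
  move=> /[dup] sT /andP[s0 s_T].
  have in_s i := integrable_subitv (lexx 0) s_T (in_norm i).
  have [_ ->] := Rintegral_sum (index_enum 'I_n) (mI s) in_s.
  rewrite !l1cV -big_split/=; apply: ler_sum => i _.
  rewrite !mxE xE// addrK; apply: le_trans (ler_normD _ _) _.
  rewrite lerD2l; apply: le_normr_Rintegral => //.
  exact: integrable_subitv (lexx 0) s_T (ix i).
apply: (@gronwall R T L _ (fun t => l1norm (x t - omega t))
  (fun s => \sum_i `|(M s *m x s) i 0| - L * l1norm (omega s))) => //.
- exact: ltW.
- rewrite addr_ge0 ?l1norm_ge0// mulr_ge0 ?(ltW L0)// Rintegral_ge0// => s _.
  exact: l1norm_ge0.
- exists (l1norm x0 + \int[mu]_(r in `[0, T]) (\sum_i `|(M r *m x r) i 0|)).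
  move=> s sT; apply: le_trans (drift_bound s sT) _; rewrite lerD2l.
  have /andP[s0 s_T] := sT.
  rewrite [leRHS](@Rintegral_itv_split _ _ 0 s T) ?s0// lerDl.
  by apply: Rintegral_ge0 => r _; exact: sumr_ge0.
- by move=> s _; exact: l1norm_ge0.
- have i1 : mu.-integrable `[0, T] (EFin \o (fun s => L * l1norm (omega s))).
    by have := integrableZl (mI T) L int_l1omega.
  by have := integrableB (mI T) int_drift i1.
- move=> s sT; rewrite -l1cV lerBlDr -mulrDr.
  apply: le_trans (l1normM _ _) _; apply: ler_pM; rewrite ?l1norm_ge0 ?ML//.
  by rewrite -{1}(subrK (omega s) (x s)); exact: l1normD.
- move=> s /[dup] sT /andP[s0 s_T]; apply: le_trans (drift_bound s sT) _.
  rewrite -addrA lerD2l.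
  have i0 := integrable_subitv (lexx 0) s_T int_l1omega.
  have i1 : mu.-integrable `[0, s] (EFin \o (fun s => L * l1norm (omega s))).
    by have := integrableZl (mI s) L i0.
  rewrite RintegralB//; last exact: integrable_subitv (lexx 0) s_T int_drift.
  rewrite RintegralZl// (@Rintegral_itv_split _ (fun s => l1norm (omega s)) 0 s T) ?s0//.
  have : 0 <= L * \int[mu]_(r in `[s, T]) l1norm (omega r).
    by rewrite mulr_ge0 ?(ltW L0)// Rintegral_ge0// => r _; exact: l1norm_ge0.
  lra.
Qed.

Lemma path_bounded : (forall i, measurable_fun `[0, T] (fun t => x t i 0)) ->
  bounded_mx T x.
Proof.
move=> mx; split; first by move=> i j; rewrite (ord1 j); exact: mx.
have [_ [c oc]] := bomega.
eexists => t tT; rewrite -(subrK (omega t) (x t)).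
apply: le_trans (l1normD _ _) _; apply: lerD; [exact: path_bound|exact: oc].
Qed.

Let E := 2 * expR (2 * L * T).

(** The form of the previous bound that expectations can be taken of: only
    second moments of the noise at fixed times enter. *)
Lemma path_sqr_bound t i : 0 <= t <= T ->
  x t i 0 ^+ 2 <= 2 * omega t i 0 ^+ 2 + 4 * E ^+ 2 * l1norm x0 ^+ 2 +
    4 * E ^+ 2 * L ^+ 2 * T * n%:R *
      \sum_k \int[mu]_(s in `[0, T]) (omega s k 0 ^+ 2).
Proof.
move=> tT; have [mo [c oc]] := bomega.
set I := \int[mu]_(s in `[0, T]) l1norm (omega s).
have E0 : 0 <= E by rewrite mulr_ge0 ?expR_ge0.
have I2 : I ^+ 2 <= T * n%:R * \sum_k \int[mu]_(s in `[0, T]) (omega s k 0 ^+ 2).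
  have m1 := measurable_l1omega.
  have b1 s : 0 <= s <= T -> `|l1norm (omega s)| <= c.
    by move=> sT; rewrite ger0_norm ?l1norm_ge0 ?oc.
  apply: le_trans (sqr_Rintegral_le T0 m1 b1) _.
  rewrite -mulrA ler_wpM2l ?(ltW T0)//.
  have isq k : mu.-integrable `[0, T] (EFin \o (fun s => omega s k 0 ^+ 2)).
    apply: (bounded_integrable_itv (c := c ^+ 2)).
      by apply: measurable_funX; exact: mo.
    move=> s sT; rewrite normrX lerXn2r ?nnegrE//.
      by rewrite (le_trans _ (oc s sT))// l1norm_ge0.
    by apply: le_trans (oc s sT); exact: le_entry_l1norm.
  have [isum sumE] := Rintegral_sum (index_enum 'I_n) (mI T) isq.
  rewrite -sumE -RintegralZl//; apply: le_Rintegral => //.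
  - apply: (bounded_integrable_itv (c := c ^+ 2)); first exact: measurable_funX.
    move=> s sT; rewrite normrX lerXn2r ?nnegrE ?b1//.
    by rewrite (le_trans _ (oc s sT))// l1norm_ge0.
  - by have := integrableZl (mI T) n%:R isum.
  - move=> s _; rewrite l1cV; apply: le_trans (sqr_sum_le _) _.
    rewrite card_ord; under eq_bigr do rewrite real_normK ?num_real//.
    by [].
have I0 : 0 <= I by apply: Rintegral_ge0 => s _; exact: l1norm_ge0.
have D : `|x t i 0 - omega t i 0| <= E * (l1norm x0 + L * I).
  apply: (@le_trans _ _ (l1norm (x t - omega t))).
    by have := le_entry_l1norm (x t - omega t) i 0; rewrite !mxE.
  by apply: le_trans (path_bound tT) _; rewrite /E -/I; lra.
have D2 : (x t i 0 - omega t i 0) ^+ 2 <= (E * (l1norm x0 + L * I)) ^+ 2.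
  rewrite -(real_normK (num_real (x t i 0 - omega t i 0))).
  by rewrite lerXn2r ?nnegrE// (le_trans _ D).
have h1 : x t i 0 ^+ 2 <= 2 * omega t i 0 ^+ 2 + 2 * (x t i 0 - omega t i 0) ^+ 2.
  by have := sqr_ge0 (x t i 0 - 2 * omega t i 0); lra.
have h2 : (E * (l1norm x0 + L * I)) ^+ 2 <=
    2 * E ^+ 2 * l1norm x0 ^+ 2 + 2 * E ^+ 2 * L ^+ 2 * I ^+ 2.
  by have := sqr_ge0 (E * (l1norm x0 - L * I)); lra.
have h3 : E ^+ 2 * L ^+ 2 * I ^+ 2 <= E ^+ 2 * L ^+ 2 *
    (T * n%:R * \sum_k \int[mu]_(s in `[0, T]) (omega s k 0 ^+ 2)).
  by rewrite ler_wpM2l// mulr_ge0 ?sqr_ge0.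
move: h1 h2 h3 D2; move: (\sum_k _) ((x t i 0 - omega t i 0) ^+ 2) => V X.
lra.
Qed.

Lemma path_primitive i : bounded_mx T M -> bounded_mx T x ->
  primitive T (fun t => (M t *m x t) i 0) (fun t => x t i 0 - omega t i 0).
Proof.
move=> bM bx; have bMx := bounded_mxM bM bx; split.
- by case: bMx.
- exact: bounded_mx_entry.
- have T00 : 0 <= (0 : R) <= T by rewrite lexx ltW.
  move=> t tT; rewrite xE// (xE _ T00) !addrK.
  by rewrite set_itv1 Rintegral_set1 addr0.
Qed.

End linear_equation_path.

(** Gronwall's inequality without noise and with initial value zero.  It serves
    for the controlled state and for the correlation functions. *)
Lemma linear_equation_unique {R : realType} n (T L : R) (M : R -> 'M[R]_n)
    (x : R -> 'cV[R]_n) : 0 < T -> 0 < L ->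
  (forall t, 0 <= t <= T -> l1norm (M t) <= L) ->
  (forall i, (@lebesgue_measure R).-integrable `[0, T]
     (fun s => ((M s *m x s) i 0)%:E)) ->
  (forall t i, 0 <= t <= T ->
     x t i 0 = \int[@lebesgue_measure R]_(s in `[0, t]) ((M s *m x s) i 0)) ->
  forall t, 0 <= t <= T -> x t = 0.
Proof.
move=> T0 L0 ML ix xE t tT.
have xE0 s i : 0 <= s <= T -> x s i 0 = (0 : 'cV[R]_n) i 0 +
    \int[@lebesgue_measure R]_(r in `[0, s]) ((M r *m x r) i 0) +
    (0 : 'cV[R]_n) i 0.
  by move=> sT; rewrite !mxE add0r addr0 xE.
have := path_bound T0 L0 ML (bounded_mx_cst T 0) ix xE0 tT.
rewrite !l1norm0 Rintegral_cst// !mul0r mulr0 addr0 mulr0 mul0r subr0 => x0.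
apply/matrixP => i j; rewrite mxE; apply/eqP; rewrite -normr_le0.
exact: le_trans (le_entry_l1norm _ _ _) x0.
Qed.

Definition bform {R : realType} {m n : nat} (b : 'M[R]_(m, n)) (y : 'cV[R]_m)
  (z : 'cV[R]_n) : R := (y^T *m b *m z) 0 0.

Lemma bformE {R : realType} m n (b : 'M[R]_(m, n)) y z :
  bform b y z = \sum_i \sum_j b i j * (y i 0 * z j 0).
Proof.
rewrite /bform mxE exchange_big/=; apply: eq_bigr => j _.
rewrite mxE mulr_suml; apply: eq_bigr => i _; rewrite mxE; ring.
Qed.

Section cost_identity.
Context {R : realType} {n d : nat}.
Notation mu := (@lebesgue_measure R).
Variables (T : R) (A : 'M[R]_n) (B : 'M[R]_(n, d)) (Q : 'M[R]_n) (S : 'M[R]_d).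
Variable P : R -> 'M[R]_n.
Hypotheses (T0 : 0 < T) (Qpsd : sym_psd Q) (Spd : sym_pd S).
Hypothesis Pric : riccati_solution T A B Q S P.

Definition riccati_velocity t : 'M[R]_n := - riccati_field Q S A B (P t).

Notation Kstar := (riccati_gain B S P).
Notation dP := riccati_velocity.

Lemma bounded_mx_riccati : bounded_mx T P.
Proof.
split=> [i j|].
  apply: subspace_continuous_measurable_fun => //.
  exact: (@riccati_continuous_entry _ _ _ _ _ _ _ _ _ Pric i j).
by have [p _ Pp] := riccati_bounded T0 Pric; exists p.
Qed.

Lemma bounded_mx_riccati_velocity : bounded_mx T dP.
Proof.
have bP := bounded_mx_riccati; apply: bounded_mxN.
apply: bounded_mxD; last exact: bounded_mx_cst.
apply: bounded_mxD.
  by apply: bounded_mxD; apply: bounded_mxM => //; exact: bounded_mx_cst.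
apply: bounded_mxN; apply: bounded_mxM => //.
by do 3?apply: bounded_mxM => //; exact: bounded_mx_cst.
Qed.

Lemma bounded_mx_riccati_gain : bounded_mx T Kstar.
Proof.
apply: bounded_mxN; apply: bounded_mxM; first exact: bounded_mx_cst.
exact: bounded_mx_riccati.
Qed.

(** By the mean value theorem and the Lipschitz continuity of the velocity, the
    increments of [P] are those of the integral of its velocity up to quadratic
    errors. *)
Lemma riccati_primitive i j :
  primitive T (fun t => dP t i j) (fun t => P t i j).
Proof.
have bdP := bounded_mx_riccati_velocity.
have [mdP _] := bdP.
have [c dPc] := bounded_mx_entry i j bdP.
have [C C0 FC] := riccati_field_lipschitz T0 Pric.
have dP_lip s t : 0 <= s -> s <= t -> t <= T ->
    `|dP s i j - dP t i j| <= C * (t - s).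
  move=> s0 st tT; apply: le_trans (FC s t s0 st tT).
  have -> : dP s i j - dP t i j =
      - (riccati_field Q S A B (P s) - riccati_field Q S A B (P t)) i j.
    rewrite /riccati_velocity; move: (riccati_field _ _ _ _ (P s)).
    by move: (riccati_field _ _ _ _ (P t)) => X Y; rewrite !mxE; ring.
  by rewrite normrN; exact: le_entry_l1norm.
have int_dP := bounded_integrable_itv (mdP i j) dPc.
split => //; first by exists c.
move=> t tT; apply/eqP; rewrite -subr_eq0; apply/eqP.
pose E t := P t i j - (P 0 i j + \int[mu]_(s in `[0, t]) dP s i j).
rewrite -/(E t); apply: (@eq0_quadratic_increments _ T C E) => //.
  by rewrite /E set_itv1 Rintegral_set1 addr0 subrr.
move=> {tT}s {}t s0; rewrite le_eqVlt => /predU1P[<-|st] tT.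
  by rewrite !subrr normr0 expr0n mulr0.
have [r /andP[sr rt] PE] := riccati_MVT Pric i j s0 st tT.
have int_st := integrable_subitv s0 tT int_dP.
have -> : E t - E s = \int[mu]_(u in `[s, t]) (dP r i j - dP u i j).
  rewrite RintegralB//; last first.
    by apply: (bounded_integrable_itv (c := `|dP r i j|)) => //.
  rewrite Rintegral_itv_cst ?(ltW st)//.
  rewrite /E (@Rintegral_itv_split _ (fun s => dP s i j) 0 s t) ?s0 ?(ltW st)//; last first.
    exact: integrable_subitv int_dP.
  have -> : dP r i j * (t - s) = P t i j - P s i j.
    by rewrite PE /riccati_velocity mxE.
  ring.
rewrite expr2 mulrA; apply: le_normr_Rintegral_itv; first exact: ltW.
  apply: measurable_funB => //.
  by apply: measurable_funS (mdP i j) => //; apply: subset_itv; rewrite bnd_simp.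
move=> u /andP[su ut].
have [ur|ru] := leP u r.
  rewrite distrC; apply: le_trans (dP_lip u r _ ur _) _; [lra|lra|].
  by rewrite ler_wpM2l//; lra.
apply: le_trans (dP_lip r u _ (ltW ru) _) _; [lra|lra|].
by rewrite ler_wpM2l//; lra.
Qed.

(** The drift of the value function along the feedback [K] misses the running
    cost by a square in the deviation from the optimal gain.  Symmetry of [P]
    makes the two mixed terms of the square transposes of each other. *)
Lemma riccati_completed_square t (K : 'M[R]_(d, n)) : 0 <= t <= T ->
  dP t + P t *m (A + B *m K) + (A + B *m K)^T *m P t =
  (K - Kstar t)^T *m S *m (K - Kstar t) - (Q + K^T *m S *m K).
Proof.
move=> tT.
have sP := riccati_solution_sym T0 Qpsd Spd Pric (lexx _) (lexx _) tT.
have uS := sym_pd_unitmx Spd; have [sS _] := Spd.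
have SK : S *m Kstar t = - (B^T *m P t).
  by rewrite /riccati_gain mulmxN !mulmxA mulmxV ?mul1mx.
have KS : (Kstar t)^T *m S = - (P t *m B).
  rewrite -[LHS]trmxK trmx_mul trmxK sS SK.
  by rewrite [LHS]linearN/= trmx_mul trmxK sP.
have KSK : (Kstar t)^T *m S *m Kstar t = P t *m B *m invmx S *m B^T *m P t.
  by rewrite KS /riccati_gain mulmxN mulNmx opprK !mulmxA.
have -> : (K - Kstar t)^T = K^T - (Kstar t)^T by rewrite [LHS]linearB.
rewrite mulmxBl mulmxBr !mulmxBl KSK KS -(mulmxA K^T S (Kstar t)) SK.
have -> : (A + B *m K)^T = A^T + K^T *m B^T by rewrite [LHS]linearD/= trmx_mul.
rewrite mulmxDr mulmxDl /riccati_velocity /riccati_field mulmxN mulNmx !mulmxA.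
move: (A^T *m P t) (P t *m A) (P t *m B *m invmx S *m B^T *m P t) => a1 a2 a3.
move: (P t *m B *m K) (K^T *m B^T *m P t) (K^T *m S *m K) => a4 a5 a6.
by apply/matrixP => i j; rewrite !mxE; ring.
Qed.

Lemma bform_integrable m k (b : R -> 'M[R]_(m, k)) y z :
  bounded_mx T b -> bounded_mx T y -> bounded_mx T z ->
  mu.-integrable `[0, T] (EFin \o (fun t => bform (b t) (y t) (z t))).
Proof.
move=> bb by_ bz; have bv := bounded_mxM (bounded_mxM (bounded_mxT by_) bb) bz.
exact: (bounded_mx_integrable 0 0 bv).
Qed.

Variables (K : R -> 'M[R]_(d, n)) (x0 : 'cV[R]_n) (x omega : R -> 'cV[R]_n).
Hypotheses (bK : bounded_mx T K) (bx : bounded_mx T x) (bo : bounded_mx T omega).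
Notation M t := (A + B *m K t).
Hypothesis xprim : forall i,
  primitive T (fun t => (M t *m x t) i 0) (fun t => x t i 0 - omega t i 0).
Hypothesis x_init : x 0 - omega 0 = x0.

(** The derivative of [qform (P t) (x t - omega t)], with the noise path
    separated from the controlled path. *)
Let value_derivative t : 0 <= t <= T ->
  bform (P t) (M t *m x t) (x t - omega t) + qform (dP t) (x t - omega t)
    + bform (P t) (x t - omega t) (M t *m x t) =
  qform ((K t - Kstar t)^T *m S *m (K t - Kstar t)) (x t)
    - qform (Q + (K t)^T *m S *m K t) (x t)
    + (qform (dP t) (omega t)
       - 2 * bform (dP t + P t *m M t) (omega t) (x t)).
Proof.
move=> tT.
have sP := riccati_solution_sym T0 Qpsd Spd Pric (lexx _) (lexx _) tT.
have sdP : (dP t)^T = dP t.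
  have sQ := Qpsd.1; have sSi : (invmx S)^T = invmx S by rewrite trmx_inv Spd.1.
  rewrite /riccati_velocity /riccati_field [LHS]linearN/=; congr (- _).
  rewrite [LHS]linearD/= sQ; congr (_ + _).
  rewrite [LHS]linearB/= [X in X - _]linearD/= !trmx_mul !trmxK sP sSi !mulmxA.
  by congr (_ - _); rewrite addrC.
have square := riccati_completed_square (K t) tT.
have sym1 u v : bform (P t) u v = bform (P t) v u by exact: bilinear_sym.
have sym2 u v : bform (dP t) u v = bform (dP t) v u by exact: bilinear_sym.
have subr m k (b : 'M[R]_(m, k)) u v w :
    bform b u (v - w) = bform b u v - bform b u w.
  rewrite /bform mulmxBr; move: (_ *m v) (_ *m w) => X Y.
  by rewrite !mxE.
have addm m k (b b' : 'M[R]_(m, k)) u v :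
    bform (b + b') u v = bform b u v + bform b' u v.
  by rewrite /bform mulmxDr mulmxDl mxE.
have qb m (b : 'M[R]_m) u : qform b u = bform b u u by [].
have PM u v : bform (P t *m M t) u v = bform (P t) u (M t *m v).
  by rewrite /bform !mulmxA.
have MP u v : bform ((M t)^T *m P t) u v = bform (P t) (M t *m u) v.
  by rewrite /bform trmx_mul !mulmxA.
have -> : qform ((K t - Kstar t)^T *m S *m (K t - Kstar t)) (x t) =
    qform (dP t + P t *m M t + (M t)^T *m P t) (x t)
    + qform (Q + (K t)^T *m S *m K t) (x t).
  by rewrite -qformD square subrK.
rewrite !qb !addm !PM !MP.
rewrite (sym1 (x t - omega t) (M t *m x t)) subr.
rewrite (subr _ _ (dP t)) (sym2 (x t - omega t) (x t)) subr.
rewrite (sym2 (x t - omega t) (omega t)) subr.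
rewrite (sym1 (x t) (M t *m x t)) (sym1 (omega t) (M t *m x t)).
rewrite (sym2 (x t) (omega t)); ring.
Qed.

(** Integrate [value_derivative].  The path [x] is as rough as the noise, but
    [x - omega] is a primitive, so that integration by parts applies to it; the
    price is the last bracket, whose expectation will turn out not to depend on
    [K]. *)
Lemma cost_identity :
  \int[mu]_(t in `[0, T]) qform (Q + (K t)^T *m S *m K t) (x t) =
  qform (P 0) x0
  + \int[mu]_(t in `[0, T])
      qform ((K t - Kstar t)^T *m S *m (K t - Kstar t)) (x t)
  + (\int[mu]_(t in `[0, T]) qform (dP t) (omega t)
     - 2 * \int[mu]_(t in `[0, T])
             bform (dP t + P t *m M t) (omega t) (x t)).
Proof.
pose y t := x t - omega t; pose v t := M t *m x t.
have primP := riccati_primitive.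
have primy i : primitive T (fun t => v t i 0) (fun t => y t i 0).
  have -> : (fun t => y t i 0) = (fun t => x t i 0 - omega t i 0).
    by apply/funext => t; rewrite /y !mxE.
  exact: xprim.
pose F t := \sum_i \sum_j (y t i 0 * P t i j) * y t j 0.
pose f t := \sum_i \sum_j ((v t i 0 * P t i j + y t i 0 * dP t i j) * y t j 0
  + y t i 0 * P t i j * v t j 0).
have primF : primitive T f F.
  apply: primitive_sum => i; apply: primitive_sum => j.
  exact: primitiveM (primitiveM (primy i) (primP i j)) (primy j).
have FE t : F t = qform (P t) (y t).
  rewrite [RHS](bformE (P t)); apply: eq_bigr => i _; apply: eq_bigr => j _; ring.
have fE t : f t = bform (P t) (v t) (y t) + qform (dP t) (y t)
    + bform (P t) (y t) (v t).
  rewrite -[qform _ _]/(bform (dP t) (y t) (y t)) !bformE -!big_split/=.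
  apply: eq_bigr => i _; rewrite -!big_split/=; apply: eq_bigr => j _; ring.
have TT : 0 <= T <= T by rewrite lexx ltW.
have [_ _ /(_ T TT)] := primF.
rewrite !FE; have [_ -> _] := Pric.
have -> : y 0 = x0 by [].
have -> : qform 0 (y T) = 0 by rewrite /qform mulmx0 mul0mx mxE.
have bKs := bounded_mx_riccati_gain.
have bdP := bounded_mx_riccati_velocity.
have bP := bounded_mx_riccati.
have bKK := bounded_mxD bK (bounded_mxN bKs).
have bM : bounded_mx T (fun t => M t).
  apply: bounded_mxD; first exact: bounded_mx_cst.
  by apply: bounded_mxM => //; exact: bounded_mx_cst.
have i1 := bform_integrable (bounded_mxM (bounded_mxM (bounded_mxT bKK)
  (bounded_mx_cst T S)) bKK) bx bx.
have i2 := bform_integrable (bounded_mxD (bounded_mx_cst T Q)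
  (bounded_mxM (bounded_mxM (bounded_mxT bK) (bounded_mx_cst T S)) bK)) bx bx.
have i3 := bform_integrable bdP bo bo.
have i4 := bform_integrable (bounded_mxD bdP (bounded_mxM bP bM)) bo bx.
have mI : measurable (`[0, T] : set (measurableTypeR R)) by [].
have i5 : mu.-integrable `[0, T] (EFin \o
    (fun t => 2 * bform (dP t + P t *m M t) (omega t) (x t))).
  by have := integrableZl mI 2 i4.
have i12 := integrableB mI i1 i2; have i35 := integrableB mI i3 i5.
have -> : \int[mu]_(t in `[0, T]) f t = \int[mu]_(t in `[0, T])
  (qform ((K t - Kstar t)^T *m S *m (K t - Kstar t)) (x t)
    - qform (Q + (K t)^T *m S *m K t) (x t)
    + (qform (dP t) (omega t)
       - 2 * bform (dP t + P t *m M t) (omega t) (x t))).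
  apply: eq_Rintegral => t; rewrite inE/= in_itv/= => tT.
  by rewrite fE value_derivative.
rewrite RintegralD// RintegralB// RintegralB// RintegralZl//; lra.
Qed.

End cost_identity.

(** * Adapted processes and their second moments *)

Section adapted_processes.
Context {R : realType} {disp : measure_display} {Omega : measurableType disp}.
Context {n : nat}.
Variables (Pr : probability Omega R) (W : R -> Omega -> 'cV[R]_n).
Hypotheses (cPr : measure_is_complete Pr) (BM : brownian_motion Pr W).

(** Completeness of the probability space makes the added null sets
    measurable. *)
Lemma augmented_measurable t :
  <<s augmented_gen Pr W t >> `<=` (@measurable _ Omega).
Proof.
apply: smallest_sub; first exact: sigma_algebra_measurable.
move=> E [[s [i [B [/andP[s0 _] mB ->]]]]|]; last exact: cPr.
by case: BM => mW _ _ _ _; rewrite -[_ @^-1` _]setTI; exact: mW.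
Qed.

(** Progressive measurability at the final time, forgetting the filtration. *)
Lemma progressive_measurable T m (Y : R -> Omega -> 'cV[R]_m) i : 0 <= T ->
  progressive Pr W T Y -> measurable_fun (`[0, T] `*` setT)
    (fun p : measurableTypeR R * Omega => Y p.1 p.2 i 0).
Proof.
move=> T0 /(_ T i); rewrite T0 lexx => /(_ isT) mY.
pose G := g_sigma_algebraType (augmented_gen Pr W T).
pose h (p : measurableTypeR R * Omega) : measurableTypeR R * G := (p.1, p.2).
have mid : @measurable_fun _ _ Omega G setT (fun w => w).
  by move=> _ A mA; rewrite setTI; exact: (augmented_measurable mA).
have mh : measurable_fun setT h.
  apply: measurable_fun_pair; first exact: measurable_fst.
  by apply: (measurableT_comp mid); exact: measurable_snd.
have := @measurable_comp _ _ _ _ _ _ (`[0, T] `*` setT) _ (`[0, T] `*` setT) h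
  _ _ mY (measurable_funTS mh).
apply; first by apply: measurableX.
by move=> _ [[t w] tT <-].
Qed.

Lemma truncated_measurable (T : R) (N : set Omega) (Y : R -> Omega -> R) :
  measurable N ->
  measurable_fun (`[0, T] `*` setT)
    (fun p : measurableTypeR R * Omega => Y p.1 p.2) ->
  measurable_fun setT
    (fun p : measurableTypeR R * Omega => truncated T N Y p.1 p.2).
Proof.
move=> mN mY; pose D : set (measurableTypeR R * Omega) := `[0, T] `*` ~` N.
have mD : measurable D by apply: measurableX => //; exact: measurableC.
have mYD : measurable_fun D (fun p => Y p.1 p.2).
  by apply: measurable_funS mY; [exact: measurableX|by move=> [t w] []].
have /(measurable_restrictT _ mD) := mYD.
apply: eq_measurable_fun => -[t w] _; rewrite patchE /truncated /=.
congr (if _ then _ else _); apply/idP/idP.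
  by rewrite inE => -[/=]; rewrite in_itv/= => -> Nw; rewrite memNset.
by move=> /andP[tT]; rewrite notin_setE inE => Nw; split => //=; rewrite in_itv.
Qed.

Lemma BM_regular_paths : exists2 N, measurable N /\ Pr N = 0%E &
  forall w, ~ N w -> W 0 w = 0 /\ {within `[0, +oo[, continuous (W ^~ w)}.
Proof.
have [_ W0 cW _ _] := BM.
have [N [mN PrN subN]] : {ae Pr, forall w,
    W 0 w = 0 /\ {within `[0, +oo[, continuous (W ^~ w)}} by exact: filterI.
by exists N => // w Nw; apply: contrapT => bad; exact/Nw/subN.
Qed.

End adapted_processes.

Section regular_processes.
Context {R : realType} {disp : measure_display} {Omega : measurableType disp}.
Variables (Pr : probability Omega R) (T : R).
Notation mu := (@lebesgue_measure R).

(** Bounded paths make the time integrals converge for each outcome; bounded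
    second moments allow to exchange them with expectations. *)
Definition regular_process m (Y : R -> Omega -> 'cV[R]_m) :=
  (forall i, L2_process Pr (fun t w => Y t w i 0)) /\
  forall w, bounded_mx T (Y ^~ w).

Definition moment_mx m k (Y : R -> Omega -> 'cV[R]_m) (Z : R -> Omega -> 'cV[R]_k)
    (t : R) : 'M[R]_(m, k) := \matrix_(i, j) \int[Pr]_w (Y t w i 0 * Z t w j 0).

Lemma bounded_mx_moment m k (Y : R -> Omega -> 'cV[R]_m)
    (Z : R -> Omega -> 'cV[R]_k) :
  regular_process Y -> regular_process Z -> bounded_mx T (moment_mx Y Z).
Proof.
move=> [Y2 _] [Z2 _]; have [c YZc] := boolp.choice (fun ij : 'I_m * 'I_k =>
  moment_bounded (Y2 ij.1) (Z2 ij.2)).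
split=> [i j|].
  have -> : (fun t => moment_mx Y Z t i j) =
    (fun t => \int[Pr]_w (Y t w i 0 * Z t w j 0)).
    by apply/funext => t; rewrite mxE.
  by apply: measurable_funTS; exact: measurable_moment (Y2 i) (Z2 j).
exists (\sum_i \sum_j c (i, j)) => t _; apply: ler_sum => i _.
by apply: ler_sum => j _; rewrite mxE; exact: (YZc (i, j)).
Qed.

(** Fubini's theorem, entry by entry. *)
Lemma expected_bform m k (b : R -> 'M[R]_(m, k)) (Y : R -> Omega -> 'cV[R]_m)
    (Z : R -> Omega -> 'cV[R]_k) :
  bounded_mx T b -> regular_process Y -> regular_process Z ->
  Pr.-integrable setT
    (EFin \o (fun w => \int[mu]_(t in `[0, T]) bform (b t) (Y t w) (Z t w))) /\
  \int[Pr]_w \int[mu]_(t in `[0, T]) bform (b t) (Y t w) (Z t w) =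
  \int[mu]_(t in `[0, T]) \tr (b t *m moment_mx Z Y t).
Proof.
move=> bb rY rZ; have [[Y2 bY] [Z2 bZ]] := (rY, rZ).
have mI : measurable (`[0, T] : set (measurableTypeR R)) by [].
pose J i j w := \int[mu]_(t in `[0, T]) (b t i j * (Y t w i 0 * Z t w j 0)).
have iYZ i j w : mu.-integrable `[0, T]
    (EFin \o (fun t => b t i j * (Y t w i 0 * Z t w j 0))).
  have [be bbe] := bounded_mx_entry i j bb.
  have [y Yy] := bounded_mx_entry i 0 (bY w).
  have [z Zz] := bounded_mx_entry j 0 (bZ w).
  apply: (bounded_integrable_itv (c := be * (y * z))).
    apply: measurable_funM; first by case: bb.
    by apply: measurable_funM; [case: (bY w)|case: (bZ w)].
  move=> t tT; rewrite !normrM; apply: ler_pM => //; first exact: bbe.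
  by apply: ler_pM => //; [exact: Yy|exact: Zz].
have pathE : (fun w => \int[mu]_(t in `[0, T]) bform (b t) (Y t w) (Z t w)) =
    (fun w => \sum_i \sum_j J i j w).
  apply/funext => w; under eq_Rintegral do rewrite bformE.
  have inner i := Rintegral_sum (index_enum 'I_k) mI (iYZ i ^~ w).
  have [_ ->] := Rintegral_sum (index_enum 'I_m) mI (fun i => (inner i).1).
  by apply: eq_bigr => i _; rewrite (inner i).2.
have iJ i j : Pr.-integrable setT (EFin \o J i j).
  have [c bc] := bounded_mx_entry i j bb; have [mb _] := bb.
  exact: integrable_Rintegral_process (mb i j) bc (Y2 i) (Z2 j).
have inner i := Rintegral_sum (index_enum 'I_k) measurableT (iJ i).
have [isum sumE] := Rintegral_sum (index_enum 'I_m) measurableT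
  (fun i => (inner i).1).
rewrite pathE; split; first exact: isum.
pose h i j t := b t i j * \int[Pr]_w (Y t w i 0 * Z t w j 0).
have ih i j : mu.-integrable `[0, T] (EFin \o h i j).
  have [be bbe] := bounded_mx_entry i j bb.
  have [c YZc] := moment_bounded (Y2 i) (Z2 j).
  apply: (bounded_integrable_itv (c := be * c)) => [|t tT].
    apply: measurable_funM; first by case: bb.
    by apply: measurable_funTS; exact: measurable_moment (Y2 i) (Z2 j).
  by rewrite normrM; apply: ler_pM => //; exact: bbe.
transitivity (\int[mu]_(t in `[0, T]) \sum_i \sum_j h i j t); last first.
  apply: eq_Rintegral => t _; apply: eq_bigr => i _; rewrite mxE.
  apply: eq_bigr => j _; rewrite mxE /h; congr (_ * _).
  by apply: eq_Rintegral => w _; rewrite mulrC.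
have inner' i := Rintegral_sum (index_enum 'I_k) mI (ih i).
have [_ ->] := Rintegral_sum (index_enum 'I_m) mI (fun i => (inner' i).1).
rewrite sumE; apply: eq_bigr => i _; rewrite (inner i).2 (inner' i).2.
apply: eq_bigr => j _; have [c bc] := bounded_mx_entry i j bb.
have [mb _] := bb.
exact: Rintegral_process_Fubini (mb i j) bc (Y2 i) (Z2 j).
Qed.

End regular_processes.

(** * Correlation of the state with the noise *)

(** A solution [X] of the closed-loop equation with drift matrix [M], and a null
    set [N] outside which the equation holds and the noise has continuous paths
    that start at zero. *)
Section closed_loop.
Context {R : realType} {disp : measure_display} {Omega : measurableType disp}.
Context {n : nat}.
Notation mu := (@lebesgue_measure R).
Variables (Pr : probability Omega R) (W : R -> Omega -> 'cV[R]_n).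
Hypotheses (cPr : measure_is_complete Pr) (BM : brownian_motion Pr W).
Variables (T L : R) (x0 : 'cV[R]_n) (M : R -> 'M[R]_n).
Variable X : R -> Omega -> 'cV[R]_n.
Hypotheses (T0 : 0 < T) (L0 : 0 < L) (bM : bounded_mx T M).
Hypothesis ML : forall t, 0 <= t <= T -> l1norm (M t) <= L.
Hypothesis mX : progressive Pr W T X.
Variable N : set Omega.
Hypotheses (mN : measurable N) (PrN : Pr N = 0%E).
Hypothesis W0 : forall w, ~ N w -> W 0 w = 0.
Hypothesis cW : forall w, ~ N w -> {within `[0, +oo[, continuous (W ^~ w)}.
Hypothesis iX : forall w, ~ N w -> forall i,
  mu.-integrable `[0, T] (fun s => ((M s *m X s w) i 0)%:E).
Hypothesis XE : forall w, ~ N w -> forall t i, 0 <= t <= T ->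
  X t w i 0 =
  x0 i 0 + \int[mu]_(s in `[0, t]) ((M s *m X s w) i 0) + W t w i 0.

Notation Xt := (truncated T N X).
Notation Wt := (truncated T N W).

Let T00 : 0 <= (0 : R) <= T. Proof. by rewrite lexx ltW. Qed.

Let truncated_null Y t w : N w -> truncated T N Y t w = 0 :> 'cV[R]_n.
Proof. by move=> Nw; rewrite /truncated mem_set// andbF. Qed.

Lemma truncated_drift_integrable w i : ~ N w ->
  mu.-integrable `[0, T] (fun s => ((M s *m Xt s w) i 0)%:E).
Proof.
move=> Nw; apply: eq_integrable (iX Nw i) => // s.
by rewrite inE/= in_itv/= => sT; rewrite truncatedE.
Qed.

Lemma truncated_equation w t i : ~ N w -> 0 <= t <= T ->
  Xt t w i 0 =
  x0 i 0 + \int[mu]_(s in `[0, t]) ((M s *m Xt s w) i 0) + Wt t w i 0.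
Proof.
move=> Nw /[dup] tT /andP[t0 t_T]; rewrite !truncatedE// XE//.
congr (_ + _ + _); apply: eq_Rintegral => s; rewrite inE/= in_itv/= => /andP[s0 st].
by rewrite truncatedE// s0 (le_trans st).
Qed.

Let WtE i : (fun t w => Wt t w i 0) = truncated T N (fun t w => W t w i 0).
Proof. by apply/funext => t; apply/funext => w; rewrite truncated_entry. Qed.

Let XtE i : (fun t w => Xt t w i 0) = truncated T N (fun t w => X t w i 0).
Proof. by apply/funext => t; apply/funext => w; rewrite truncated_entry. Qed.

Lemma L2_truncated_BM i : L2_process Pr (fun t w => Wt t w i 0).
Proof. by rewrite WtE; exact: truncated_BM_L2. Qed.

Lemma bounded_mx_truncated_BM w : bounded_mx T (Wt ^~ w).
Proof.
split=> [i j|].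
  have [mW _] := L2_truncated_BM i; rewrite (ord1 j).
  by apply: measurable_funTS; exact: (measurable_fun_pair1 w mW).
have [Nw|Nw] := pselect (N w).
  by exists 0 => t tT; rewrite truncated_null// l1norm0.
have cWT : {within `[0, T], continuous (W ^~ w)}.
  apply: continuous_subspaceW (cW Nw) => t /=.
  by rewrite !in_itv/= andbT => /andP[].
have [c _ Wc] := within_continuous_bounded (ltW T0) cWT.
by exists c => t tT; rewrite truncatedE ?Wc.
Qed.

Lemma measurable_truncated_state i : measurable_fun setT
  (fun p : measurableTypeR R * Omega => Xt p.1 p.2 i 0).
Proof.
rewrite -[X in measurable_fun _ X]/(fun p : measurableTypeR R * Omega =>
  (fun t w => Xt t w i 0) p.1 p.2) XtE.
apply: truncated_measurable => //.
exact: progressive_measurable cPr BM _ _ _ i (ltW T0) mX.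
Qed.

Lemma bounded_mx_truncated_state w : bounded_mx T (Xt ^~ w).
Proof.
have mXw i : measurable_fun `[0, T] (fun t => Xt t w i 0).
  apply: measurable_funTS.
  exact: (measurable_fun_pair1 w (measurable_truncated_state i)).
have [Nw|Nw] := pselect (N w).
  split; first by move=> i j; rewrite (ord1 j).
  by exists 0 => t tT; rewrite truncated_null// l1norm0.
exact: (path_bounded T0 L0 ML (bounded_mx_truncated_BM w)
  (fun i => truncated_drift_integrable i Nw)
  (fun t i => @truncated_equation w t i Nw)).
Qed.

Lemma truncated_state_primitive w i : ~ N w ->
  primitive T (fun t => (M t *m Xt t w) i 0)
    (fun t => Xt t w i 0 - Wt t w i 0).
Proof.
move=> Nw; apply: (path_primitive T0 (x0 := x0)) => //.
- by move=> t j; exact: truncated_equation.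
- exact: bounded_mx_truncated_state.
Qed.

Lemma truncated_state_init w : ~ N w -> Xt 0 w - Wt 0 w = x0.
Proof.
move=> Nw; apply/matrixP => i j; rewrite (ord1 j) !mxE truncated_equation//.
by rewrite set_itv1 Rintegral_set1 addr0 addrK.
Qed.

Let E := 2 * expR (2 * L * T).
Let V := \sum_k \int[Pr]_w (W T w k 0 ^+ 2).

Let c1 := 4 * E ^+ 2 * l1norm x0 ^+ 2.
Let c2 := 4 * E ^+ 2 * L ^+ 2 * T * n%:R.

Let c1_ge0 : 0 <= c1.
Proof. by rewrite /c1 mulr_ge0 ?sqr_ge0// mulr_ge0 ?sqr_ge0. Qed.

Let c2_ge0 : 0 <= c2.
Proof.
rewrite /c2 mulr_ge0//; apply: mulr_ge0; last exact: ltW.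
by rewrite mulr_ge0 ?sqr_ge0// mulr_ge0 ?sqr_ge0.
Qed.

Lemma truncated_state_sqr_bound w t i :
  Xt t w i 0 ^+ 2 <= 2 * Wt t w i 0 ^+ 2 + c1 +
    c2 * \sum_k \int[mu]_(s in `[0, T]) (Wt s w k 0 ^+ 2).
Proof.
have [tT|tT] := boolP ((0 <= t <= T) && (w \notin N)); last first.
  rewrite /truncated (negbTE tT) mxE expr0n/= addr_ge0//.
    by rewrite addr_ge0// mulr_ge0// sqr_ge0.
  rewrite mulr_ge0// sumr_ge0// => k _; apply: Rintegral_ge0 => s _.
  exact: sqr_ge0.
have /andP[tT' /set_mem Nw] : (0 <= t <= T) && (w \in ~` N).
  by rewrite in_setC.
exact: (path_sqr_bound T0 L0 ML (bounded_mx_truncated_BM w)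
  (fun i => truncated_drift_integrable i Nw)
  (fun t i => @truncated_equation w t i Nw)).
Qed.

(** It depends on the drift matrix through the bound [L] only, hence is uniform
    over all feedbacks with bounded gains. *)
Definition state_moment_bound := 2 * V + c1 + c2 * (T * V).

Lemma truncated_state_second_moment_le i t :
  (\int[Pr]_w (Xt t w i 0 ^+ 2)%:E <= state_moment_bound%:E)%E.
Proof.
pose v k := \int[Pr]_w (W T w k 0 ^+ 2).
pose J k w := \int[mu]_(s in `[0, T]) (Wt s w k 0 ^+ 2).
have v0 k : 0 <= v k by apply: Rintegral_ge0 => w _; exact: sqr_ge0.
have Wt2 k s : \int[Pr]_w (Wt s w k 0 ^+ 2) <= v k.
  have [_ i2] := L2_process_square_integrable s (L2_truncated_BM k).
  rewrite -lee_fin {1}/Rintegral fineK ?integrable_fin_num//.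
  have := truncated_BM_second_moment_le BM T mN PrN k s.
  by rewrite -WtE.
have iJ k : Pr.-integrable setT (EFin \o J k) /\ \int[Pr]_w J k w <= v k * T.
  have Y2 := L2_truncated_BM k.
  have m1 : measurable_fun (`[0, T] : set R) (fun=> 1 : R) by [].
  have b1 (s : R) : 0 <= s <= T -> `|1 : R| <= 1 by rewrite normr1.
  have JE : J k = fun w =>
      \int[mu]_(s in `[0, T]) (1 * (Wt s w k 0 * Wt s w k 0)).
    by apply/funext => w; apply: eq_Rintegral => s _; rewrite mul1r expr2.
  rewrite JE; split; first exact: (integrable_Rintegral_process m1 b1 Y2 Y2).
  rewrite (Rintegral_process_Fubini m1 b1 Y2 Y2).
  rewrite -[T in leRHS]subr0 -Rintegral_itv_cst ?(ltW T0)//.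
  have [c Yc] := moment_bounded Y2 Y2.
  apply: le_Rintegral => //.
  - apply: (bounded_integrable_itv (c := c)) => [|s _]; last by rewrite mul1r.
    apply: measurable_funM => //; apply: measurable_funTS.
    exact: (measurable_moment Y2 Y2).
  - by apply: (bounded_integrable_itv (c := `|v k|)).
  - by move=> s _; rewrite mul1r; under eq_Rintegral do rewrite -expr2.
have [isum sumE] := Rintegral_sum (index_enum 'I_n) measurableT
  (fun k => (iJ k).1).
have [_ iW] := L2_process_square_integrable t (L2_truncated_BM i).
have i1 : Pr.-integrable setT (EFin \o (fun w => 2 * Wt t w i 0 ^+ 2)).
  by have := integrableZl measurableT 2 iW.
have i2 : Pr.-integrable setT (EFin \o (fun w : Omega => c1)).
  exact: finite_measure_integrable_cst.
have i3 : Pr.-integrable setT (EFin \o (fun w => c2 * \sum_k J k w)).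
  by have := integrableZl measurableT c2 isum.
have i12 : Pr.-integrable setT (EFin \o (fun w => 2 * Wt t w i 0 ^+ 2 + c1)).
  by have := integrableD measurableT i1 i2.
have i123 : Pr.-integrable setT (EFin \o (fun w =>
    2 * Wt t w i 0 ^+ 2 + c1 + c2 * \sum_k J k w)).
  by have := integrableD measurableT i12 i3.
apply: (@le_trans _ _ (\int[Pr]_w (2 * Wt t w i 0 ^+ 2 + c1 +
    c2 * \sum_k J k w)%:E)%E).
  apply: ge0_le_integral => //.
  - by move=> w _; rewrite lee_fin sqr_ge0.
  - apply/measurable_EFinP/measurable_funX.
    exact: (measurable_fun_pair2 t (measurable_truncated_state i)).
  - exact: measurable_int i123.
  - by move=> w _; rewrite lee_fin; exact: truncated_state_sqr_bound.
rewrite -(fineK (integrable_fin_num measurableT i123)) lee_fin.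
rewrite -/(Rintegral Pr setT _) RintegralD// RintegralD// (Rintegral_cst _ _ c1)//.
rewrite !RintegralZl//= probability_setT mulr1 sumE /state_moment_bound.
apply: lerD; first rewrite lerD2r ler_wpM2l//.
  apply: le_trans (Wt2 i t) _.
  by rewrite /V (bigD1 i)//= lerDl; apply: sumr_ge0 => k _; exact: v0.
rewrite ler_wpM2l// mulrC /V mulr_suml; apply: ler_sum => k _.
exact: (iJ k).2.
Qed.

Lemma regular_truncated_BM : regular_process Pr T Wt.
Proof.
by split=> [i|w]; [exact: L2_truncated_BM|exact: bounded_mx_truncated_BM].
Qed.

Lemma regular_truncated_state : regular_process Pr T Xt.
Proof.
split=> [i|w]; last exact: bounded_mx_truncated_state.
split; first exact: measurable_truncated_state.
by eexists => t; exact: truncated_state_second_moment_le.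
Qed.

Notation D i j s t := (\int[Pr]_w (Xt s w i 0 * Wt t w j 0)).
Notation noise i j s t := (\int[Pr]_w (Wt s w i 0 * Wt t w j 0)).

Let mean_truncated_BM j t : 0 <= t <= T -> \int[Pr]_w Wt t w j 0 = 0.
Proof.
move=> tT; have [t0 _] := andP tT.
have mWt := L2_process_measurable t (L2_truncated_BM j).
have [mW _ _ _ _] := BM.
have -> : \int[Pr]_w Wt t w j 0 = \int[Pr]_w (W t w j 0 - W 0 w j 0).
  apply: ae_eq_Rintegral => //; first by apply: measurable_funB; exact: mW.
  exists N; split => // w /=; apply: contra_notP => Nw.
  by rewrite truncatedE// W0// mxE subr0.
move: t0; rewrite le_eqVlt => /predU1P[<-|t0].
  by under eq_Rintegral do rewrite subrr; rewrite Rintegral_cst// mul0r.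
by have [_] := BM_increment BM (s := 0) (t := t) j (introT andP (conj (lexx 0) t0)).
Qed.

Let noise_ahead i j s t : 0 <= s -> s <= t -> t <= T ->
  noise i j s t = noise i j s s.
Proof.
move=> s0 st tT; have := truncated_BM_orthogonal BM mN PrN i j s0 st tT.
by rewrite -!WtE.
Qed.

(** Multiply the equation by the noise at time [t] and take expectations. *)
Lemma correlation_equation i j s t : 0 <= s <= T -> 0 <= t <= T ->
  D i j s t = \sum_k \int[mu]_(r in `[0, s]) (M r i k * D k j r t)
              + noise i j s t.
Proof.
move=> sT tT; have [s0 s_T] := andP sT.
have [X2 bX] := regular_truncated_state.
have Wj2 := L2_process_square_integrable t (L2_truncated_BM j).
have Yj2 := L2_process_time_cst Wj2.
have iW := square_integrable_integrable Wj2.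
have iWW := square_integrable_mul
  (L2_process_square_integrable s (L2_truncated_BM i)) Wj2.
have mM k : measurable_fun (`[0, s] : set R) (fun r => M r i k).
  by case: bM => mM _; apply: measurable_funS (mM i k) => //;
    apply: subset_itv; rewrite bnd_simp.
have [c Mc] : exists c, forall k r, 0 <= r <= s -> `|M r i k| <= c.
  exists L => k r /andP[r0 rs]; apply: le_trans (le_entry_l1norm (M r) i k) _.
  by apply: ML; rewrite r0 (le_trans rs).
pose J k w := \int[mu]_(r in `[0, s]) (M r i k * (Xt r w k 0 * Wt t w j 0)).
have iJ k : Pr.-integrable setT (EFin \o J k).
  exact: integrable_Rintegral_process (mM k) (Mc k) (X2 k) Yj2.
have [isum sumE] := Rintegral_sum (index_enum 'I_n) measurableT iJ.
have i1 : Pr.-integrable setT (EFin \o (fun w => x0 i 0 * Wt t w j 0)).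
  by have := integrableZl measurableT (x0 i 0) iW.
have i12 : Pr.-integrable setT
    (EFin \o (fun w => x0 i 0 * Wt t w j 0 + \sum_k J k w)).
  by have := integrableD measurableT i1 isum.
have i123 : Pr.-integrable setT (EFin \o (fun w =>
    x0 i 0 * Wt t w j 0 + \sum_k J k w + Wt s w i 0 * Wt t w j 0)).
  by have := integrableD measurableT i12 iWW.
transitivity (\int[Pr]_w (x0 i 0 * Wt t w j 0 + \sum_k J k w
    + Wt s w i 0 * Wt t w j 0)).
  apply: ae_eq_Rintegral.
  - by apply: measurable_funM; [exact: L2_process_measurable (X2 i)|case: Wj2].
  - exact/measurable_EFinP/(measurable_int _ i123).
  - exists N; split => // w /=; apply: contra_notP => Nw.
    rewrite truncated_equation// !mulrDl; congr (_ + _ + _).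
    have iMX k : mu.-integrable `[0, s] (EFin \o (fun r => M r i k * Xt r w k 0)).
      apply: integrable_subitv (lexx 0) s_T _.
      have [m Mm] := bounded_mx_entry i k bM.
      have [x Xx] := bounded_mx_entry k 0 (bX w).
      apply: (bounded_integrable_itv (c := m * x)) => [|r rT].
        by apply: measurable_funM; [case: bM|case: (bX w)].
      by rewrite normrM; apply: ler_pM => //; [exact: Mm|exact: Xx].
    have mI : measurable (`[0, s] : set (measurableTypeR R)) by [].
    under eq_Rintegral do rewrite mxE.
    have [_ ->] := Rintegral_sum (index_enum 'I_n) mI iMX.
    rewrite mulr_suml; apply: eq_bigr => k _.
    rewrite -RintegralZr//; apply: eq_Rintegral => r _; ring.
rewrite RintegralD// RintegralD// RintegralZl// mean_truncated_BM// mulr0 add0r.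
rewrite sumE; congr (_ + _); apply: eq_bigr => k _.
exact: Rintegral_process_Fubini (mM k) (Mc k) (X2 k) Yj2.
Qed.

Lemma correlation_init i j t : 0 <= t <= T -> D i j 0 t = noise i j 0 t.
Proof.
move=> tT; rewrite (correlation_equation i j T00 tT) big1 ?add0r// => k _.
by rewrite set_itv1 Rintegral_set1.
Qed.

(** The noise after time [s] is uncorrelated with the state at any time
    [r <= s]: as functions of [r], both correlations satisfy the same linear
    equation, since the noise itself has this property. *)
Lemma correlation_ahead i j s t : 0 <= s -> s <= t -> t <= T ->
  D i j s t = D i j s s.
Proof.
move=> s0 st tT; have sT := le_trans st tT; have t0 := le_trans s0 st.
have tT' : 0 <= t <= T by rewrite t0.
have sT' : 0 <= s <= T by rewrite s0.
have [X2 _] := regular_truncated_state.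
have mI r : measurable (`[0, r] : set (measurableTypeR R)) by [].
have Wj2 r := L2_process_time_cst
  (L2_process_square_integrable r (L2_truncated_BM j)).
pose x r : 'cV[R]_n := \col_k (D k j r t - D k j r s).
have iMD u k l r : r <= T -> mu.-integrable `[0, r]
    (EFin \o (fun r => M r k l * D l j r u)).
  move=> rT; apply: integrable_subitv (lexx 0) rT _.
  have [m Mm] := bounded_mx_entry k l bM.
  have [c Dc] := moment_bounded (X2 l) (Wj2 u).
  apply: (bounded_integrable_itv (c := m * c)) => [|q qT].
    apply: measurable_funM; first by case: bM.
    by apply: measurable_funTS; exact: measurable_moment (X2 l) (Wj2 u).
  by rewrite normrM; apply: ler_pM => //; exact: Mm.
have iMx r k : r <= T -> mu.-integrable `[0, r]
    (EFin \o (fun r => (M r *m x r) k 0)) /\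
  \int[mu]_(q in `[0, r]) ((M q *m x q) k 0) =
  \sum_l \int[mu]_(q in `[0, r]) (M q k l * D l j q t) -
  \sum_l \int[mu]_(q in `[0, r]) (M q k l * D l j q s).
  move=> rT.
  have -> : (fun q => (M q *m x q) k 0) =
      (fun q => \sum_l M q k l * D l j q t - \sum_l M q k l * D l j q s).
    apply/funext => q; rewrite mxE -sumrB; apply: eq_bigr => l _.
    by rewrite mxE mulrBr.
  have [i1 sum1] := Rintegral_sum (index_enum 'I_n) (mI r)
    (fun l => iMD t k l r rT).
  have [i2 sum2] := Rintegral_sum (index_enum 'I_n) (mI r)
    (fun l => iMD s k l r rT).
  split; first by have := integrableB (mI r) i1 i2.
  by rewrite RintegralB// sum1 sum2.
have initial : s = 0 -> D i j s t = D i j s s.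
  move=> ->; apply: etrans (correlation_init i j tT') _.
  apply: etrans _ (esym (correlation_init i j T00)).
  exact: noise_ahead.
have [/initial//|s_neq0] := eqVneq s 0.
have s_gt0 : 0 < s by rewrite lt_neqAle eq_sym s_neq0.
suff /matrixP/(_ i 0) : x s = 0.
  by rewrite !mxE => /eqP; rewrite subr_eq0 => /eqP.
apply: (linear_equation_unique (T := s) (L := L) (M := M)) => //.
- by move=> r /andP[r0 rs]; apply: ML; rewrite r0 (le_trans rs).
- by move=> k; case: (iMx s k sT).
- move=> r k /andP[r0 rs]; have rT := le_trans rs sT.
  have rT' : 0 <= r <= T by rewrite r0.
  have [_ ->] := iMx r k rT; rewrite mxE.
  rewrite (correlation_equation k j rT' tT') (correlation_equation k j rT' sT').
  rewrite (noise_ahead k j r0 (le_trans rs st) tT) (noise_ahead k j r0 rs sT).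
  have cancel (a b c : R) : a + c - (b + c) = a - b by ring.
  exact: cancel.
- by rewrite s0 lexx.
Qed.

(** By [correlation_ahead], the integrands of [correlation_equation] only involve
    the correlations of the state and the noise at the same time: the equation
    closes. *)
Lemma correlation_primitive i j :
  primitive T (fun t => (M t *m moment_mx Pr Xt Wt t) i j)
    (fun t => moment_mx Pr Xt Wt t i j - moment_mx Pr Wt Wt t i j).
Proof.
have bD := bounded_mx_moment regular_truncated_state regular_truncated_BM.
have bMD := bounded_mxM bM bD.
have FE t : moment_mx Pr Xt Wt t i j - moment_mx Pr Wt Wt t i j =
    D i j t t - noise i j t t by rewrite !mxE.
have increment t : 0 <= t <= T -> D i j t t - noise i j t t =
    \int[mu]_(s in `[0, t]) ((M s *m moment_mx Pr Xt Wt s) i j).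
  move=> /[dup] tT /andP[t0 t_T].
  have mI : measurable (`[0, t] : set (measurableTypeR R)) by [].
  have iMD k : mu.-integrable `[0, t]
      (EFin \o (fun s => M s i k * moment_mx Pr Xt Wt s k j)).
    apply: integrable_subitv (lexx 0) t_T _.
    have [m Mm] := bounded_mx_entry i k bM.
    have [c Dc] := bounded_mx_entry k j bD.
    apply: (bounded_integrable_itv (c := m * c)) => [|s sT].
      by apply: measurable_funM; [case: bM|case: bD].
    by rewrite normrM; apply: ler_pM => //; [exact: Mm|exact: Dc].
  rewrite correlation_equation// addrK.
  under [RHS]eq_Rintegral do rewrite mxE.
  have [_ ->] := Rintegral_sum (index_enum 'I_n) mI iMD.
  apply: eq_bigr => k _; apply: eq_Rintegral => s; rewrite inE/= in_itv/=.
  by move=> /andP[s0 st]; rewrite mxE correlation_ahead.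
split; [by case: bMD|exact: bounded_mx_entry|].
by move=> t tT; rewrite !FE !increment// set_itv1 Rintegral_set1 add0r.
Qed.

End closed_loop.

(** * The expected cost identity *)

Lemma mxtrace_mulE {R : realType} m n (A : 'M[R]_(m, n)) (B : 'M[R]_(n, m)) :
  \tr (A *m B) = \sum_i \sum_j A i j * B j i.
Proof. by apply: eq_bigr => i _; rewrite mxE. Qed.

Section closed_loop_expectation.
Context {R : realType} {disp : measure_display} {Omega : measurableType disp}.
Context {n d : nat}.
Notation mu := (@lebesgue_measure R).
Variables (Pr : probability Omega R) (W : R -> Omega -> 'cV[R]_n).
Hypotheses (cPr : measure_is_complete Pr) (BM : brownian_motion Pr W).
Variables (T : R) (A : 'M[R]_n) (B : 'M[R]_(n, d)) (Q : 'M[R]_n) (S : 'M[R]_d).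
Variable P : R -> 'M[R]_n.
Hypotheses (T0 : 0 < T) (Qpsd : sym_psd Q) (Spd : sym_pd S).
Hypothesis Pric : riccati_solution T A B Q S P.
Variables (L : R) (x0 : 'cV[R]_n) (K : R -> 'M[R]_(d, n)).
Variable X : R -> Omega -> 'cV[R]_n.
Hypotheses (L0 : 0 < L) (bK : bounded_mx T K).
Notation M t := (A + B *m K t).
Hypothesis ML : forall t, 0 <= t <= T -> l1norm (M t) <= L.
Hypothesis mX : progressive Pr W T X.
Variable N : set Omega.
Hypotheses (mN : measurable N) (PrN : Pr N = 0%E).
Hypothesis W0 : forall w, ~ N w -> W 0 w = 0.
Hypothesis cW : forall w, ~ N w -> {within `[0, +oo[, continuous (W ^~ w)}.
Hypothesis iX : forall w, ~ N w -> forall i,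
  mu.-integrable `[0, T] (fun s => ((M s *m X s w) i 0)%:E).
Hypothesis XE : forall w, ~ N w -> forall t i, 0 <= t <= T ->
  X t w i 0 =
  x0 i 0 + \int[mu]_(s in `[0, t]) ((M s *m X s w) i 0) + W t w i 0.

Notation Xt := (truncated T N X).
Notation Wt := (truncated T N W).
Notation D := (moment_mx Pr Xt Wt).
Notation V := (moment_mx Pr Wt Wt).
Notation Kstar := (riccati_gain B S P).
Notation dP := (riccati_velocity A B Q S P).

Let mI : measurable (`[0, T] : set (measurableTypeR R)). Proof. by []. Qed.

Let bM : bounded_mx T (fun t => M t).
Proof.
apply: bounded_mxD; first exact: bounded_mx_cst.
by apply: bounded_mxM => //; exact: bounded_mx_cst.
Qed.

Let rX : regular_process Pr T Xt.
Proof. exact: (regular_truncated_state cPr BM T0 L0 ML mX mN PrN cW iX XE). Qed.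

Let rW : regular_process Pr T Wt.
Proof. exact: (regular_truncated_BM BM T0 mN PrN cW). Qed.

Let integrable_mxtrace (b : R -> 'M[R]_n) : bounded_mx T b ->
  mu.-integrable `[0, T] (EFin \o (fun t => \tr (b t))).
Proof.
move=> bb.
by have [] := Rintegral_sum (index_enum 'I_n) mI
  (fun i => bounded_mx_integrable i i bb).
Qed.

(** Integrate the derivative of [\tr (P (D - V))]: it vanishes at time zero since
    the initial state is deterministic, and at the final time since [P] does.
    So the only term of [cost_identity] that couples the noise with the state
    has an expectation that does not depend on the feedback. *)
Lemma cross_moment :
  \int[mu]_(t in `[0, T]) \tr ((dP t + P t *m M t) *m D t) =
  \int[mu]_(t in `[0, T]) \tr (dP t *m V t).
Proof.
have bP := bounded_mx_riccati T0 Pric.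
have bdP := bounded_mx_riccati_velocity T0 Pric.
have bD := bounded_mx_moment rX rW; have bV := bounded_mx_moment rW rW.
have prim i j := primitiveM (riccati_primitive T0 Pric i j)
  (correlation_primitive cPr BM T0 L0 bM ML mX mN PrN W0 cW iX XE j i).
have := primitive_sum (index_enum 'I_n) (fun i =>
  primitive_sum (index_enum 'I_n) (fun j => prim i j)).
have TT : 0 <= T <= T by rewrite lexx ltW.
have T00 : 0 <= (0 : R) <= T by rewrite lexx ltW.
have [_ PT _] := Pric.
move=> [_ _ /(_ T TT)].
rewrite [X in X = _ -> _]big1 => [|i _]; last first.
  by apply: big1 => j _; rewrite PT mxE mul0r.
rewrite [X in _ = X + _ -> _]big1 => [|i _]; last first.
  apply: big1 => j _; rewrite [moment_mx _ _ _ 0 _ _]mxE.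
  rewrite (correlation_init cPr BM T0 L0 bM ML mX mN PrN W0 cW iX XE j i T00).
  by rewrite [moment_mx _ _ _ 0 _ _]mxE subrr mulr0.
rewrite add0r => zero; apply/eqP; rewrite -subr_eq0 -RintegralB//; last 2 first.
- apply: integrable_mxtrace; apply: bounded_mxM => //; apply: bounded_mxD => //.
  exact: bounded_mxM.
- by apply: integrable_mxtrace; exact: bounded_mxM.
apply/eqP; rewrite [RHS]zero; apply: eq_Rintegral => t _.
rewrite mulmxDl -mulmxA linearD/= !mxtrace_mulE addrAC -sumrB -big_split/=.
apply: eq_bigr => i _; rewrite -sumrB -big_split/=; apply: eq_bigr => j _.
by rewrite mulrBr.
Qed.

Lemma expected_cost_identity :
  \int[Pr]_w \int[mu]_(t in `[0, T]) qform (Q + (K t)^T *m S *m K t) (Xt t w) =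
  qform (P 0) x0 - \int[mu]_(t in `[0, T]) \tr (dP t *m V t)
  + \int[mu]_(t in `[0, T])
      \tr ((K t - Kstar t)^T *m S *m (K t - Kstar t) *m moment_mx Pr Xt Xt t).
Proof.
have bP := bounded_mx_riccati T0 Pric.
have bdP := bounded_mx_riccati_velocity T0 Pric.
have bKK := bounded_mxD bK (bounded_mxN (bounded_mx_riccati_gain T0 Pric)).
have b1 : bounded_mx T (fun t => Q + (K t)^T *m S *m K t).
  apply: bounded_mxD; first exact: bounded_mx_cst.
  apply: bounded_mxM => //; apply: bounded_mxM; last exact: bounded_mx_cst.
  exact: bounded_mxT.
have b2 : bounded_mx T (fun t => (K t - Kstar t)^T *m S *m (K t - Kstar t)).
  apply: bounded_mxM => //; apply: bounded_mxM; last exact: bounded_mx_cst.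
  exact: bounded_mxT.
have b3 : bounded_mx T (fun t => dP t + P t *m M t).
  by apply: bounded_mxD => //; exact: bounded_mxM.
have [i1 _] := expected_bform b1 rX rX.
have [i2 E2] := expected_bform b2 rX rX.
have [i3 E3] := expected_bform bdP rW rW.
have [i4 E4] := expected_bform b3 rW rX.
pose I2 w := \int[mu]_(t in `[0, T])
  qform ((K t - Kstar t)^T *m S *m (K t - Kstar t)) (Xt t w).
pose I3 w := \int[mu]_(t in `[0, T]) qform (dP t) (Wt t w).
pose I4 w := \int[mu]_(t in `[0, T]) bform (dP t + P t *m M t) (Wt t w) (Xt t w).
have i4' : Pr.-integrable setT (EFin \o (fun w => 2 * I4 w)).
  by have := integrableZl measurableT 2 i4.
have i34 : Pr.-integrable setT (EFin \o (fun w => I3 w - 2 * I4 w)).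
  by have := integrableB measurableT i3 i4'.
have i0 : Pr.-integrable setT (EFin \o (fun w : Omega => qform (P 0) x0)).
  exact: finite_measure_integrable_cst.
have i02 : Pr.-integrable setT (EFin \o (fun w => qform (P 0) x0 + I2 w)).
  by have := integrableD measurableT i0 i2.
have i_rhs : Pr.-integrable setT
    (EFin \o (fun w => qform (P 0) x0 + I2 w + (I3 w - 2 * I4 w))).
  by have := integrableD measurableT i02 i34.
transitivity (\int[Pr]_w (qform (P 0) x0 + I2 w + (I3 w - 2 * I4 w))).
  apply: ae_eq_Rintegral.
  - exact/measurable_EFinP/(measurable_int _ i1).
  - exact/measurable_EFinP/(measurable_int _ i_rhs).
  - exists N; split => // w /=; apply: contra_notP => Nw.
    apply: cost_identity => //; [by case: rX|by case: rW| |].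
      move=> i.
      exact: (truncated_state_primitive cPr BM T0 L0 bM ML mX mN PrN cW iX XE i Nw).
    exact: (truncated_state_init T0 XE Nw).
rewrite RintegralD// RintegralD// RintegralB//.
have -> : \int[Pr]_w qform (P 0) x0 = qform (P 0) x0.
  by rewrite Rintegral_cst//= probability_setT mulr1.
rewrite [\int[Pr]_w (2 * I4 w)]RintegralZl//.
rewrite [\int[Pr]_w I2 w]E2 [\int[Pr]_w I3 w]E3 [\int[Pr]_w I4 w](etrans E4 cross_moment).
have rearrange (a b c : R) : a + b + (c - 2 * c) = a - c + b by ring.
exact: rearrange.
Qed.

(** The integrand is quadratic in [K t - Kstar t]. *)
Lemma expected_deviation_le eps : 0 <= eps ->
  (forall t, 0 <= t <= T -> l1norm (K t - Kstar t) <= eps) ->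
  `|\int[mu]_(t in `[0, T])
      \tr ((K t - Kstar t)^T *m S *m (K t - Kstar t) *m moment_mx Pr Xt Xt t)| <=
  2 * (n * n)%:R * l1norm S * state_moment_bound Pr W T L x0 * T * eps ^+ 2.
Proof.
move=> eps0 Keps; set c := state_moment_bound Pr W T L x0.
have bKK := bounded_mxD bK (bounded_mxN (bounded_mx_riccati_gain T0 Pric)).
have b2 : bounded_mx T (fun t => (K t - Kstar t)^T *m S *m (K t - Kstar t)).
  apply: bounded_mxM => //; apply: bounded_mxM; last exact: bounded_mx_cst.
  exact: bounded_mxT.
have bXX := bounded_mx_moment rX rX; have [X2 _] := rX.
have Xc i t := truncated_state_second_moment_le cPr BM T0 L0 ML mX mN PrN cW iX
  XE i t.
have c0 t : l1norm (moment_mx Pr Xt Xt t) <= (n * n)%:R * (c + c).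
  apply: l1norm_le_entries => i j; rewrite mxE.
  exact: moment_le (X2 i) (X2 j) (Xc i t) (Xc j t).
have int_tr := integrable_mxtrace (bounded_mxM b2 bXX).
have -> : 2 * (n * n)%:R * l1norm S * c * T * eps ^+ 2 =
    eps * l1norm S * eps * ((n * n)%:R * (c + c)) * (T - 0) by ring.
apply: le_normr_Rintegral_itv; first exact: ltW.
  by have /measurable_EFinP := measurable_int _ int_tr.
move=> t tT; apply: le_trans (normr_mxtrace_le_l1norm _) _.
apply: le_trans (l1normM _ _) _; apply: ler_pM; rewrite ?l1norm_ge0//.
apply: le_trans (l1normM _ _) _; apply: ler_pM; rewrite ?l1norm_ge0 ?Keps//.
apply: le_trans (l1normM _ _) _; apply: ler_pM; rewrite ?l1norm_ge0//.
by rewrite l1normT Keps.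
Qed.

End closed_loop_expectation.

(** * The cost of a feedback *)

Section cost_evaluation.
Context {R : realType} {disp : measure_display} {Omega : measurableType disp}.
Context {n d : nat}.
Notation mu := (@lebesgue_measure R).
Variables (Pr : probability Omega R) (W : R -> Omega -> 'cV[R]_n).
Hypothesis cPr : measure_is_complete Pr.
Variables (T : R) (T0 : 0 < T).

(** [G] is only known almost surely, whence the use of completeness: its
    measurability comes from that of the quadratic form. *)
Lemma complete_integral_qform (Y : R -> Omega -> 'cV[R]_n) (b : R -> 'M[R]_n)
    (G : R -> Omega -> R) :
  regular_process Pr T Y -> bounded_mx T b ->
  {ae Pr, forall w, forall t, 0 <= t <= T -> G t w = qform (b t) (Y t w)} ->
  (\int[Pr]_w \int[mu]_(t in `[0%R, T]) (G t w)%:E =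
   (\int[Pr]_w \int[mu]_(t in `[0, T]) qform (b t) (Y t w))%:E)%E.
Proof.
move=> rY bb GE.
pose I w := \int[mu]_(t in `[0, T]) qform (b t) (Y t w).
have [iI _] := expected_bform bb rY rY.
have eqI : ae_eq Pr setT (EFin \o I)
    (fun w => \int[mu]_(t in `[0%R, T]) (G t w)%:E)%E.
  apply: filterS GE => w GE _; rewrite /I /= /Rintegral fineK.
    apply: eq_integral => t; rewrite inE/= in_itv/= => tT.
    by rewrite GE.
  have bY := rY.2 w; have := bform_integrable bb bY bY.
  by move=> /(integrable_fin_num _); apply.
have mI := measurable_int _ iI.
have mG := ae_measurable_fun cPr eqI mI.
rewrite -(ae_eq_integral _ _ measurableT mI mG eqI).
by rewrite /Rintegral fineK// integrable_fin_num.
Qed.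

(** The noise cancels in the difference of two solutions. *)
Lemma sde_state_unique (x0 : 'cV[R]_n) (A : 'M[R]_n) (u : R -> Omega -> 'cV[R]_n)
    (X Y : R -> Omega -> 'cV[R]_n) :
  sde_solution Pr W T x0 (fun t w x => A *m x + u t w) X ->
  sde_solution Pr W T x0 (fun t w x => A *m x + u t w) Y ->
  {ae Pr, forall w, forall t, 0 <= t <= T -> X t w = Y t w}.
Proof.
move=> [_ iX XE] [_ iY YE].
apply: filterS2 (filterI iX XE) (filterI iY YE) => w [iXw XEw] [iYw YEw] t tT.
apply/eqP; rewrite -subr_eq0; apply/eqP.
have mI s : measurable (`[0, s] : set (measurableTypeR R)) by [].
have driftE i s : (A *m (X s w - Y s w)) i 0 =
    (A *m X s w + u s w) i 0 - (A *m Y s w + u s w) i 0.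
  rewrite mulmxBr.
  by move: (A *m X s w) (A *m Y s w) => a b; rewrite !mxE; ring.
apply: (linear_equation_unique (T := T) (L := l1norm A + 1) (M := fun=> A)
  (x := fun s => X s w - Y s w)) => //.
- by rewrite ltr_wpDl ?l1norm_ge0.
- by move=> _ _; rewrite lerDl.
- move=> i; have -> : (fun s => ((A *m (X s w - Y s w)) i 0)%:E) = (fun s =>
      ((A *m X s w + u s w) i 0)%:E - ((A *m Y s w + u s w) i 0)%:E)%E.
    by apply/funext => s; rewrite driftE.
  by have := integrableB (mI T) (iXw i) (iYw i).
- move=> s i /[dup] sT /andP[s0 s_T].
  under eq_Rintegral do rewrite driftE.
  rewrite RintegralB//; last 2 first.
  + exact: integrable_subitv (lexx 0) s_T (iXw i).
  + exact: integrable_subitv (lexx 0) s_T (iYw i).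
  rewrite [LHS]mxE [(- Y s w) i 0]mxE XEw// YEw//.
  have cancel (a b c e : R) : a + b + e - (a + c + e) = b - c by ring.
  exact: cancel.
Qed.

Variables (x0 : 'cV[R]_n) (A : 'M[R]_n) (B : 'M[R]_(n, d)).
Variables (Q : 'M[R]_n) (S : 'M[R]_d) (K : R -> 'M[R]_(d, n)).
Variable X : R -> Omega -> 'cV[R]_n.
Hypothesis bK : bounded_mx T K.

Lemma progressive_feedback : progressive Pr W T X ->
  progressive Pr W T (feedback K X).
Proof.
move=> mX t i tT; have [t0 t_T] := andP tT.
have -> : (fun p : measurableTypeR R * g_sigma_algebraType (augmented_gen Pr W t)
    => feedback K X p.1 p.2 i 0) =
  (fun p => \sum_k K p.1 i k * X p.1 p.2 k 0).
  by apply/funext => p; rewrite /feedback mxE.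
apply: measurable_sum => k; apply: measurable_funM; last exact: mX.
apply: (@measurable_comp _ _ _ _ _ _ (`[0, t] : set (measurableTypeR R))
  (fun s => K s i k) _ fst) => //.
- by move=> _ [[s w] [/= st _] <-].
- case: bK => mK _; apply: measurable_funS (mK i k) => //.
  by apply: subset_itv; rewrite bnd_simp.
- by apply: measurable_funTS; exact: measurable_fst.
Qed.

Lemma controlled_state_feedback : closed_loop_solution Pr W T x0 A B K X ->
  {ae Pr, forall w, forall t, 0 <= t <= T ->
     controlled_state Pr W T x0 A B (feedback K X) t w = X t w}.
Proof.
move=> [mX iX XE].
have driftE t w i :
    (A *m X t w + B *m K t *m X t w) i 0 = (A *m X t w + B *m feedback K X t w) i 0.
  by rewrite /feedback mulmxA.
have Xsol : sde_solution Pr W T x0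
    (fun t w x => A *m x + B *m feedback K X t w) X.
  split; first exact: mX.
    apply: filterS iX => w + i => /(_ i); congr (_.-integrable _ _).
    by apply/funext => t; rewrite driftE.
  apply: filterS XE => w XEw t i tT; rewrite (XEw t i tT); congr (_ + _ + _).
  by apply: eq_Rintegral => s _; rewrite driftE.
pose u t w := B *m feedback K X t w.
apply: (@sde_state_unique x0 A u _ X); last exact: Xsol.
exact: (xgetPex (fun _ _ => 0) (ex_intro _ X Xsol)).
Qed.

Variable Y : R -> Omega -> 'cV[R]_n.
Hypotheses (rY : regular_process Pr T Y)
  (XY : {ae Pr, forall w, forall t, 0 <= t <= T -> X t w = Y t w}).

(** The squared norm of the control is itself a quadratic form of the state. *)
Lemma admissible_feedback : progressive Pr W T X ->
  admissible Pr W T (feedback K X).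
Proof.
move=> mX; split; first exact: progressive_feedback.
have bKK := bounded_mxM (bounded_mxM (bounded_mxT bK) (bounded_mx_cst T 1%:M)) bK.
rewrite (complete_integral_qform rY bKK); first exact: ltry.
apply: filterS XY => w XYw t tT; rewrite /feedback XYw// qform_conj frobenius_sqr.
rewrite /qform mulmx1 mxE; apply: eq_bigr => i _.
by rewrite big_ord1 [_^T _ _]mxE expr2.
Qed.

Lemma lqr_cost_feedback : closed_loop_solution Pr W T x0 A B K X ->
  lqr_cost Pr W T x0 A B Q S (feedback K X) =
  (\int[Pr]_w \int[mu]_(t in `[0, T])
     qform (Q + (K t)^T *m S *m K t) (Y t w))%:E.
Proof.
move=> Xsol; have [mX _ _] := Xsol.
rewrite /lqr_cost asboolT; last exact: admissible_feedback.
have bKK := bounded_mxM (bounded_mxM (bounded_mxT bK) (bounded_mx_cst T S)) bK.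
apply: complete_integral_qform (rY) (bounded_mxD (bounded_mx_cst T Q) bKK) _.
apply: filterS2 XY (controlled_state_feedback Xsol) => w XYw stateE t tT.
by rewrite stateE// XYw// qformD qform_conj /feedback XYw.
Qed.

End cost_evaluation.

(** The function is constant between two consecutive multiples of [tau]. *)
Lemma measurable_truncn_comp {R : realType} (T tau : R) (g : nat -> R) :
  0 < tau -> measurable_fun `[0, T]
    (fun t => g (Num.truncn (t / tau))).
Proof.
move=> tau0.
pose E (j : nat) : set (measurableTypeR R) :=
    `[j%:R * tau, j.+1%:R * tau[%classic.
apply: (@measurable_funS _ _ _ _ (\bigcup_j E j)).
- by apply: bigcup_measurable => j _; rewrite /E.
- move=> t /=; rewrite in_itv/= => /andP[t0 _].
  have /truncn_itv/andP[jt tj] : 0 <= t / tau by rewrite divr_ge0 ?(ltW tau0).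
  exists (Num.truncn (t / tau)) => //; rewrite /E/= in_itv/=.
  by rewrite -ler_pdivlMr// -ltr_pdivrMr// jt.
- apply/measurable_fun_bigcup => j; first by rewrite /E.
  apply: (eq_measurable_fun (fun=> g j)); last exact: measurable_cst.
  move=> t; rewrite inE /E/= in_itv/= => /andP[jt tj].
  congr g; apply/esym/eqP.
  rewrite truncn_eq ?ler_pdivlMr ?ltr_pdivrMr ?jt//.
  by rewrite mul0r (le_trans _ jt)// mulr_ge0 ?(ltW tau0).
Qed.

Section feedback_cost.
Context {R : realType} {disp : measure_display} {Omega : measurableType disp}.
Context {n d : nat}.
Notation mu := (@lebesgue_measure R).
Variables (Pr : probability Omega R) (W : R -> Omega -> 'cV[R]_n).
Hypotheses (cPr : measure_is_complete Pr) (BM : brownian_motion Pr W).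
Variables (T : R) (A : 'M[R]_n) (B : 'M[R]_(n, d)) (Q : 'M[R]_n) (S : 'M[R]_d).
Variable P : R -> 'M[R]_n.
Hypotheses (T0 : 0 < T) (Qpsd : sym_psd Q) (Spd : sym_pd S).
Hypothesis Pric : riccati_solution T A B Q S P.
Variables (L : R) (x0 : 'cV[R]_n).
Hypothesis L0 : 0 < L.

(** All feedbacks share the part of the cost that is displayed first; what
    remains is quadratic in the distance to the optimal gain. *)
Lemma feedback_cost (K : R -> 'M[R]_(d, n)) (X : R -> Omega -> 'cV[R]_n) :
  bounded_mx T K -> (forall t, 0 <= t <= T -> l1norm (A + B *m K t) <= L) ->
  closed_loop_solution Pr W T x0 A B K X ->
  exists2 e : R,
    lqr_cost Pr W T x0 A B Q S (feedback K X) =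
      (qform (P 0) x0 - \int[mu]_(t in `[0, T])
         \tr (riccati_velocity A B Q S P t *m moment_mx Pr W W t) + e)%:E &
    forall eps, 0 <= eps ->
      (forall t, 0 <= t <= T -> l1norm (K t - riccati_gain B S P t) <= eps) ->
      `|e| <= 2 * (n * n)%:R * l1norm S * state_moment_bound Pr W T L x0 * T
              * eps ^+ 2.
Proof.
move=> bK ML Xsol; have [mX iX XE] := Xsol.
have driftE t w i : (A *m X t w + B *m K t *m X t w) i 0 =
    ((A + B *m K t) *m X t w) i 0 by rewrite mulmxDl.
have [N1 [mN1 PrN1] N1W] := BM_regular_paths BM.
have [N [mN PrN subN]] : {ae Pr, forall w, [/\ ~ N1 w,
    forall i, mu.-integrable `[0, T]
      (fun s => (((A + B *m K s) *m X s w) i 0)%:E)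
  & forall t i, 0 <= t <= T -> X t w i 0 = x0 i 0 +
      \int[mu]_(s in `[0, t]) (((A + B *m K s) *m X s w) i 0) + W t w i 0]}.
  have N1ae : {ae Pr, forall w, ~ N1 w}.
    by exists N1; split => // w /= /contrapT.
  apply: filterS2 N1ae (filterI iX XE) => w N1w [iXw XEw]; split => //.
    move=> i; have := iXw i; congr (_.-integrable _ _).
    by apply/funext => t; rewrite driftE.
  move=> t i tT; rewrite (XEw t i tT); congr (_ + _ + _).
  by apply: eq_Rintegral => s _; rewrite driftE.
have good w : ~ N w -> [/\ ~ N1 w,
    forall i, mu.-integrable `[0, T]
      (fun s => (((A + B *m K s) *m X s w) i 0)%:E)
  & forall t i, 0 <= t <= T -> X t w i 0 = x0 i 0 +
      \int[mu]_(s in `[0, t]) (((A + B *m K s) *m X s w) i 0) + W t w i 0].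
  by move=> Nw; apply: contrapT => bad; exact/Nw/subN.
have W0 w : ~ N w -> W 0 w = 0 by move=> /good[/N1W[]].
have cW w : ~ N w -> {within `[0, +oo[, continuous (W ^~ w)}.
  by move=> /good[/N1W[]].
have iXN w : ~ N w -> forall i, mu.-integrable `[0, T]
    (fun s => (((A + B *m K s) *m X s w) i 0)%:E) by move=> /good[].
have XEN w : ~ N w -> forall t i, 0 <= t <= T -> X t w i 0 = x0 i 0 +
    \int[mu]_(s in `[0, t]) (((A + B *m K s) *m X s w) i 0) + W t w i 0.
  by move=> /good[].
have bM : bounded_mx T (fun t => A + B *m K t).
  apply: bounded_mxD; first exact: bounded_mx_cst.
  by apply: bounded_mxM => //; exact: bounded_mx_cst.
have rX := regular_truncated_state cPr BM T0 L0 ML mX mN PrN cW iXN XEN.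
have XXt : {ae Pr, forall w, forall t, 0 <= t <= T ->
    X t w = truncated T N X t w}.
  exists N; split => // w /=; apply: contra_notP => Nw t tT.
  by rewrite truncatedE.
exists (\int[mu]_(t in `[0, T])
  \tr ((K t - riccati_gain B S P t)^T *m S *m (K t - riccati_gain B S P t) *m
       moment_mx Pr (truncated T N X) (truncated T N X) t)); last first.
  move=> eps eps0 Keps.
  exact: (expected_deviation_le cPr BM T0 Pric L0 bK ML mX mN PrN cW iXN XEN).
rewrite (lqr_cost_feedback cPr T0 Q S bK rX XXt Xsol).
have noise : \int[mu]_(t in `[0, T]) \tr (riccati_velocity A B Q S P t *m
      moment_mx Pr (truncated T N W) (truncated T N W) t) =
    \int[mu]_(t in `[0, T])
      \tr (riccati_velocity A B Q S P t *m moment_mx Pr W W t).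
  apply: eq_Rintegral => t; rewrite inE/= in_itv/= => tT.
  congr (\tr (_ *m _)); apply/matrixP => i j; rewrite !mxE.
  have [mW _ _ _ _] := BM; have [t0 _] := andP tT.
  have mWt k := L2_process_measurable t (L2_truncated_BM BM T mN PrN cW k).
  apply: ae_eq_Rintegral; first exact: measurable_funM.
    by apply: measurable_funM; exact: mW.
  exists N; split => // w /=; apply: contra_notP => Nw.
  by rewrite truncatedE.
have combine (a b c c' e : R) : a = b - c + e -> c = c' ->
    a%:E = (b - c' + e)%:E by move=> -> ->.
exact: combine (expected_cost_identity cPr BM T0 Qpsd Spd Pric L0 bK ML mX mN PrN
  W0 cW iXN XEN) noise.
Qed.

End feedback_cost.

(** * The performance gap *)

Lemma bounded_parameter {R : realType} n d (Theta : set 'M[R]_(n + d, n)) :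
  frobenius_bounded Theta -> exists c, forall theta, Theta theta ->
    l1norm (theta_A theta) <= c /\ l1norm (theta_B theta) <= c.
Proof.
move=> [M ThetaM]; exists (Num.max ((n * n)%:R * M) ((n * d)%:R * M)).
move=> theta /ThetaM thetaM; rewrite !le_max; split; apply/orP; [left|right].
  apply: l1norm_le_entries => i j; rewrite !mxE.
  exact: le_trans (le_entry_frobenius _ _ _) thetaM.
apply: l1norm_le_entries => i j; rewrite !mxE.
exact: le_trans (le_entry_frobenius _ _ _) thetaM.
Qed.

Lemma parameter_error {R : realType} n d (theta : 'M[R]_(n + d, n))
    (A : 'M[R]_n) (B : 'M[R]_(n, d)) :
  l1norm (theta_A theta - A) + l1norm (theta_B theta - B) <=
  (n * n + n * d)%:R * frobenius (theta - mk_theta A B).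
Proof.
have subE m k (X Y : 'M[R]_(m, k)) i j : (X - Y) i j = X i j - Y i j.
  by rewrite !mxE.
rewrite natrD mulrDl; apply: lerD; apply: l1norm_le_entries => i j.
  have -> : (theta_A theta - A) i j = (theta - mk_theta A B) (lshift d j) i.
    by rewrite !subE /mk_theta col_mxEu !mxE.
  exact: le_entry_frobenius.
have -> : (theta_B theta - B) i j = (theta - mk_theta A B) (rshift n j) i.
  by rewrite !subE /mk_theta col_mxEd !mxE.
exact: le_entry_frobenius.
Qed.

Unset Implicit Arguments.

Theorem proposition3p12 (R : realType) (disp : measure_display)
    (Omega : measurableType disp) (Pr : probability Omega R)
    (n d : nat) (W : R -> Omega -> 'cV[R]_n)
    (T : R) (x0 : 'cV[R]_n) (Astar : 'M[R]_n) (Bstar : 'M[R]_(n, d))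
    (Q : 'M[R]_n) (S : 'M[R]_d) (Theta : set 'M[R]_(n + d, n))
    (Pstar : R -> 'M[R]_n) (Xstar : R -> Omega -> 'cV[R]_n) :
  let J := lqr_cost Pr W T x0 Astar Bstar Q S in
  let thetastar := mk_theta Astar Bstar in
  let Kstar := riccati_gain Bstar S Pstar in
  let K (theta : 'M[R]_(n + d, n)) (N : nat) :=
    piecewise_gain T (theta_A theta) (theta_B theta) Q S N in
  measure_is_complete Pr ->
  brownian_motion Pr W ->
  0 < T ->
  sym_psd Q ->
  sym_pd S ->
  frobenius_bounded Theta ->
  riccati_solution T Astar Bstar Q S Pstar ->
  closed_loop_solution Pr W T x0 Astar Bstar Kstar Xstar ->
  exists2 C : R, 0 < C &
    forall (theta : 'M[R]_(n + d, n)) (N : nat) (X : R -> Omega -> 'cV[R]_n),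
      Theta theta -> (0 < N)%N ->
      closed_loop_solution Pr W T x0 Astar Bstar (K theta N) X ->
      (`| J (feedback (K theta N) X) - J (feedback Kstar Xstar) |
        <= (C * (N%:R ^- 2 + frobenius (theta - thetastar) ^+ 2))%R%:E)%E.

Proof.
move=> J thetastar Kstar K cPr BM T0 Qpsd Spd bTheta Pric Xstar_sol.
have [c Theta_c] := bounded_parameter bTheta.
pose a := Num.max c (l1norm Astar); pose b := Num.max c (l1norm Bstar).
have Astar_a : l1norm Astar <= a by rewrite le_max lexx orbT.
have Bstar_b : l1norm Bstar <= b by rewrite le_max lexx orbT.
have [C C0 gain_error] := piecewise_gain_error T0 Qpsd Spd Pric Astar_a Bstar_b.
have bKs : bounded_mx T Kstar := bounded_mx_riccati_gain T0 Pric.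
have [_ [ks Ks_le]] := bKs.
have ks0 : 0 <= ks.
  by apply: le_trans (l1norm_ge0 _) (Ks_le 0 _); rewrite lexx ltW.
(* A bound on all closed-loop drifts, positive even if both matrices vanish. *)
pose L := l1norm Astar + l1norm Bstar * (C + ks) + 1.
have L0 : 0 < L.
  rewrite ltr_wpDl// addr_ge0 ?l1norm_ge0// mulr_ge0 ?l1norm_ge0//.
  exact: addr_ge0.
have drift_le (G : 'M[R]_(d, n)) : l1norm G <= C + ks ->
    l1norm (Astar + Bstar *m G) <= L.
  move=> GC; apply: le_trans (l1normD _ _) _; rewrite /L -addrA lerD2l.
  apply: le_trans (l1normM _ _) _; apply: (@le_trans _ _ (l1norm Bstar * (C + ks))).
    by rewrite ler_wpM2l ?l1norm_ge0.
  by rewrite lerDl.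
have cost := feedback_cost cPr BM T0 Qpsd Spd Pric L0 (x0 := x0).
set base := qform (Pstar 0) x0 - _ in cost.
set D := 2 * _ * _ * _ * _ in cost.
(* The optimal gain deviates from itself by zero. *)
have star_cost : J (feedback Kstar Xstar) = base%:E.
  have [|e JE /(_ 0 (lexx 0))] := cost Kstar Xstar bKs _ Xstar_sol.
    by move=> t tT; apply: drift_le; apply: le_trans (Ks_le t tT) _; rewrite lerDr.
  rewrite expr0n mulr0 normr_le0 => e0; rewrite /J JE (eqP (e0 _)) ?addr0// => t _.
  by rewrite subrr l1norm0.
pose M := (n * n + n * d)%:R : R.
exists (1 + `|D| * (2 * C ^+ 2 * (T ^+ 2 + M ^+ 2))).
  rewrite ltr_pwDl// mulr_ge0// mulr_ge0 ?addr_ge0 ?sqr_ge0//.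
  by rewrite mulr_ge0 ?sqr_ge0.
move=> theta N X Theta_theta N0 Xsol.
have [Ac Bc] := Theta_c theta Theta_theta.
have Aa : l1norm (theta_A theta) <= a by rewrite le_max Ac.
have Bb : l1norm (theta_B theta) <= b by rewrite le_max Bc.
have Kerr t tT := gain_error _ _ N t N0 Aa Bb tT.
have tau0 : 0 < T / N%:R by rewrite divr_gt0// ltr0n.
have bK : bounded_mx T (K theta N).
  split; last by exists C => t /Kerr[].
  move=> i j.
  exact: (measurable_truncn_comp (fun k =>
    discrete_gain T (theta_A theta) (theta_B theta) Q S N k i j) tau0).
have [|e JE e_le] := cost (K theta N) X bK _ Xsol.
  by move=> t /Kerr[KC _]; apply: drift_le; apply: le_trans KC _; rewrite lerDl.
set f := frobenius (theta - thetastar).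
have f0 : 0 <= f by exact: sqrtr_ge0.
pose eps := C * (T / N%:R + M * f).
have M0 : 0 <= M by [].
have eps0 : 0 <= eps.
  by rewrite mulr_ge0// addr_ge0 ?(ltW tau0)// mulr_ge0.
have Keps t : 0 <= t <= T -> l1norm (K theta N t - Kstar t) <= eps.
  move=> /Kerr[_ KKs]; apply: le_trans KKs _; rewrite ler_wpM2l// lerD2l.
  exact: parameter_error.
rewrite star_cost /J JE -EFinB abse_EFin lee_fin addrAC subrr add0r.
apply: le_trans (e_le eps eps0 Keps) _.
apply: (@le_trans _ _ (`|D| * eps ^+ 2)).
  by rewrite ler_wpM2r ?sqr_ge0// ler_norm.
have eps_le : eps ^+ 2 <= 2 * C ^+ 2 * (T ^+ 2 + M ^+ 2) *
    (N%:R ^- 2 + f ^+ 2).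
  rewrite /eps exprMn -exprVn [2 * _]mulrC -!mulrA ler_wpM2l ?sqr_ge0//.
  move: (N%:R^-1) => v.
  have := sqr_ge0 (T * v - M * f); have := sqr_ge0 (T * f).
  have := sqr_ge0 (M * v); nra.
rewrite mulrDl mul1r; apply: ler_wpDl.
  by rewrite addr_ge0 ?sqr_ge0// invr_ge0 sqr_ge0.
by rewrite -[leRHS]mulrA ler_wpM2l.
Qed.
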